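(* Assume the Template Hypothesis stated in the context. Then there exists $k\in\mathbb{Z}_+$ such that a $k$-connected binary matroid $M$ with at least $2k$ elements has no minor isomorphic to $\mathrm{PG}(3,2)\backslash L$ or to $M^*(K_6)$ if and only if $M$ is an even-cycle matroid with a blocking pair.
   Context: Binary frame template: a tuple $\Phi=(C,X,Y_0,Y_1,A_1,\Delta,\Lambda)$ where $C,X,Y_0,Y_1$ are disjoint finite sets, $A_1$ is a binary matrix with rows indexed by $X$ and columns by $Y_0\cup Y_1\cup C$, $\Lambda$ is a subgroup of $\mathrm{GF}(2)^X$ and $\Delta$ a subgroup of $\mathrm{GF}(2)^{Y_0\cup Y_1\cup C}$; moreover (standard form) there are partitions $C=C_0\cup C_1$, $X=X_0\cup X_1$ with $A_1[X_0,C_0]$ an identity matrix and $A_1[X_1,C]$ a zero matrix. A binary frame matrix is a binary matrix each of whose columns has at most two nonzero entries. A binary matrix $A'$ with rows indexed by $B$ and columns by $E$ ($B,E$ disjoint finite sets) respects $\Phi$ if: $X\subseteq B$ and $C,Y_0,Y_1\subseteq E$; $A'[X,C\cup Y_0\cup Y_1]=A_1$; there is $Z\subseteq E-(C\cup Y_0\cup Y_1)$ with $A'[X,Z]=0$, each column of $A'[B-X,Z]$ a unit vector, and $A'[B-X,E-(C\cup Y_0\cup Y_1\cup Z)]$ a binary frame matrix; each column of $A'[X,E-(C\cup Y_0\cup Y_1\cup Z)]$ lies in $\Lambda$; each row of $A'[B-X,C\cup Y_0\cup Y_1]$ lies in $\Delta$. A matrix $A\in\mathrm{GF}(2)^{B\times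 E}$ conforms to $\Phi$ if for such $A'$ and $Z$ we have $A[B,E-Z]=A'[B,E-Z]$ and for each $i\in Z$ there is $j\in Y_1$ such that column $i$ of $A$ equals the sum of columns $i$ and $j$ of $A'$. A matroid $M$ conforms to $\Phi$ if $M\cong M(A)/C\backslash Y_1$ for some $A$ conforming to $\Phi$; $\mathcal{M}(\Phi)$ is the set of such matroids, and $\mathcal{M}^*(\Phi)$ the set of matroids whose duals conform to $\Phi$. Template Hypothesis: for every proper minor-closed class $\mathcal{M}$ of binary matroids there exist $k\in\mathbb{Z}_+$ and binary frame templates $\Phi_1,\dots,\Phi_s,\Psi_1,\dots,\Psi_t$ such that $\mathcal{M}$ contains each $\mathcal{M}(\Phi_i)$ and each $\mathcal{M}^*(\Psi_j)$, and every $k$-connected member of $\mathcal{M}$ with at least $2k$ elements either lies in some $\mathcal{M}(\Phi_i)$ or has its dual in some $\mathcal{M}(\Psi_j)$. Even-cycle matroid: a binary matroid $M\binom{w}{D}$ where $D$ is the vertex-edge incidence matrix over $\mathrm{GF}(2)$ of a graph $G=(V,E)$ and $w$ is the characteristic vector of a set $W\subseteq E$ (odd edges); $(G,W)$ is an even-cycle representation. Resigning at a vertex $u$ replaces $W$ by its symmetric difference with the set of edges incident with $u$ (this does not change the matroid). Vertices $u,v$ form a blocking pair of $(G,W)$ if after some sequence of resignings every odd edge is incident with $u$ or $v$. An even-cycle matroid has a blocking pair if some even-cycle representation of it has a blocking pair. $\mathrm{PG}(3,2)\backslash L$ is $\mathrm{PG}(3,2)$ with the three points of a line deleted. *)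

(* Defs.v *)
From HB Require Import structures.
From mathcomp Require Import all_boot all_order all_algebra zify.

Set Implicit Arguments.
Unset Strict Implicit.
Unset Printing Implicit Defensive.

Import GRing.Theory.
Local Open Scope ring_scope.

(* A finite matroid presented by its rank function (axioms R1-R3 of Oxley,
   Matroid Theory, Section 1.3); the ground set is the whole type [ground]. *)
Record matroid := Matroid {
  ground : finType;
  rk : {set ground} -> nat;
  rk_le_card : forall S : {set ground}, (rk S <= #|S|)%N;
  rkS : forall S T : {set ground}, S \subset T -> (rk S <= rk T)%N;
  rk_submod : forall S T : {set ground},
    (rk (S :|: T) + rk (S :&: T) <= rk S + rk T)%N
}.

Definition isom (M N : matroid) : Prop :=
  exists f : ground M -> ground N,
    bijective f /\ forall S : {set ground M}, rk (f @: S) = rk S.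

Lemma rk_cover (M : matroid) (S T : {set ground M}) :
  (rk (S :|: T) <= rk S + rk T)%N.
Proof. by apply: leq_trans (rk_submod S T); apply: leq_addr. Qed.

Section Dual.
Variable M : matroid.
Implicit Types S T : {set ground M}.

Definition dual_rk S : nat := (#|S| + rk (~: S) - rk [set: ground M])%N.

Lemma dual_rk_ge S : (rk [set: ground M] <= #|S| + rk (~: S))%N.
Proof.
have := rk_cover S (~: S); rewrite setUCr; have := rk_le_card S; lia.
Qed.

Lemma dual_rk_le_card S : (dual_rk S <= #|S|)%N.
Proof. have := rkS (subsetT (~: S)); rewrite /dual_rk; lia. Qed.

Lemma dual_rkS S T : S \subset T -> (dual_rk S <= dual_rk T)%N.
Proof.
move=> sST; rewrite /dual_rk leq_sub2r //.
have -> : ~: S = ~: T :|: (T :\: S).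
  apply/setP=> x; rewrite !inE; have := subsetP sST x.
  by case: (x \in S); case: (x \in T) => // /(_ isT).
have := rk_cover (~: T) (T :\: S); have := rk_le_card (T :\: S).
have := cardsDS sST; have := subset_leq_card sST; lia.
Qed.

Lemma dual_rk_submod S T :
  (dual_rk (S :|: T) + dual_rk (S :&: T) <= dual_rk S + dual_rk T)%N.
Proof.
have := rk_submod (~: S) (~: T); rewrite -setCI -setCU.
have := cardsUI S T; rewrite /dual_rk.
have := dual_rk_ge S; have := dual_rk_ge T.
have := dual_rk_ge (S :|: T); have := dual_rk_ge (S :&: T); lia.
Qed.

Definition dual : matroid :=
  Matroid dual_rk_le_card dual_rkS dual_rk_submod.

End Dual.

Section Minors.
Variables (M : matroid) (C : {set ground M}).

Definition outside : finType := {x : ground M | x \notin C}.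
Definition out_val (x : outside) : ground M := val x.
Implicit Types S T : {set outside}.

Lemma out_val_inj : injective out_val.
Proof. exact: val_inj. Qed.

Definition delete_rk S : nat := rk (out_val @: S).

Lemma delete_rk_le_card S : (delete_rk S <= #|S|)%N.
Proof. by rewrite -(card_imset S out_val_inj) rk_le_card. Qed.

Lemma delete_rkS S T : S \subset T -> (delete_rk S <= delete_rk T)%N.
Proof. by move=> sST; rewrite rkS // imsetS. Qed.

Lemma delete_rk_submod S T :
  (delete_rk (S :|: T) + delete_rk (S :&: T) <= delete_rk S + delete_rk T)%N.
Proof.
by rewrite /delete_rk imsetU imsetI ?rk_submod //; move=> ? ? _ _; apply: out_val_inj.
Qed.

Definition delete : matroid :=
  Matroid delete_rk_le_card delete_rkS delete_rk_submod.

Definition contract_rk S : nat := (rk ((out_val @: S) :|: C) - rk C)%N.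

Lemma contract_rk_le_card S : (contract_rk S <= #|S|)%N.
Proof.
have := delete_rk_le_card S; have := rk_cover (out_val @: S) C.
rewrite /delete_rk /contract_rk; lia.
Qed.

Lemma contract_rkS S T : S \subset T -> (contract_rk S <= contract_rk T)%N.
Proof. by move=> sST; rewrite leq_sub2r // rkS // setSU // imsetS. Qed.

Lemma contract_rk_submod S T :
  (contract_rk (S :|: T) + contract_rk (S :&: T)
     <= contract_rk S + contract_rk T)%N.
Proof.
have leC (U : {set outside}) : (rk C <= rk (out_val @: U :|: C))%N.
  by rewrite rkS // subsetUr.
have := rk_submod (out_val @: S :|: C) (out_val @: T :|: C).
rewrite -setUUl -setUIl -imsetU -imsetI; last by move=> ? ? _ _; apply: out_val_inj.
have := leC S; have := leC T; have := leC (S :|: T); have := leC (S :&: T).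
rewrite /contract_rk; lia.
Qed.

Definition contract : matroid :=
  Matroid contract_rk_le_card contract_rkS contract_rk_submod.

End Minors.

Definition contract_delete (M : matroid) (C D : {set ground M}) : matroid :=
  @delete (contract C) [set x | out_val x \in D].

Definition has_minor (M N : matroid) : Prop :=
  exists C D : {set ground M}, [disjoint C & D] /\ isom N (contract_delete C D).

(* Tutte connectivity. *)
Definition connectivity (M : matroid) (S : {set ground M}) : nat :=
  (rk S + rk (~: S) - rk [set: ground M])%N.

Definition separation (M : matroid) (j : nat) (S : {set ground M}) : Prop :=
  [/\ (j <= #|S|)%N, (j <= #|~: S|)%N & (connectivity S < j)%N].

Definition k_connected (k : nat) (M : matroid) : Prop :=
  forall (j : nat) (S : {set ground M}), (0 < j < k)%N -> ~ separation j S.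

(* A binary matrix with rows indexed by R and columns indexed by K. *)
Definition bmatrix (R K : finType) := R -> K -> 'F_2.

Definition mxcol (R K : finType) (A : bmatrix R K) (e : K) : {ffun R -> ('F_2)^o} :=
  [ffun b => A b e].

Section VectorMatroid.
Variables (R K : finType) (A : bmatrix R K).
Implicit Types S T : {set K}.

Definition col_space S : {vspace {ffun R -> ('F_2)^o}} :=
  <<[seq mxcol A e | e <- enum S]>>%VS.

Definition col_rk S : nat := \dim (col_space S).

Lemma mem_col_space S e : e \in S -> mxcol A e \in col_space S.
Proof. by move=> eS; apply/memv_span/map_f; rewrite mem_enum. Qed.

Lemma col_space_sub S (U : {vspace {ffun R -> ('F_2)^o}}) :
  (forall e, e \in S -> mxcol A e \in U) -> (col_space S <= U)%VS.
Proof. by move=> h; apply/span_subvP=> _ /mapP[e + ->]; rewrite mem_enum => /h. Qed.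

Lemma col_spaceS S T : S \subset T -> (col_space S <= col_space T)%VS.
Proof. by move/subsetP=> sST; apply: col_space_sub => e /sST /mem_col_space. Qed.

Lemma col_spaceU S T : (col_space (S :|: T) = col_space S + col_space T)%VS.
Proof.
apply/eqP; rewrite eqEsubv subv_add !col_spaceS ?subsetUl ?subsetUr // !andbT.
apply: col_space_sub => e; rewrite inE => /orP[] /mem_col_space.
  exact: (subvP (addvSl _ _)).
exact: (subvP (addvSr _ _)).
Qed.

Lemma col_rk_le_card S : (col_rk S <= #|S|)%N.
Proof. by rewrite (leq_trans (dim_span _)) // size_map -cardE. Qed.

Lemma col_rkS S T : S \subset T -> (col_rk S <= col_rk T)%N.
Proof. by move=> sST; rewrite dimvS // col_spaceS. Qed.

Lemma col_rk_submod S T :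
  (col_rk (S :|: T) + col_rk (S :&: T) <= col_rk S + col_rk T)%N.
Proof.
rewrite /col_rk col_spaceU -(dimv_sum_cap (col_space S)) leq_add2l dimvS //.
by rewrite subv_cap !col_spaceS ?subsetIl ?subsetIr.
Qed.

Definition vector_matroid : matroid :=
  Matroid col_rk_le_card col_rkS col_rk_submod.

End VectorMatroid.

Definition binary (M : matroid) : Prop :=
  exists (R K : finType) (A : bmatrix R K), isom M (vector_matroid A).

(* Graphs may have loops and parallel edges; [ends e] lists the two ends of [e]
   in an arbitrary order. *)
Record graph := Graph {
  vertex : finType;
  edge : finType;
  ends : edge -> vertex * vertex
}.

Definition incident (G : graph) (e : edge G) (u : vertex G) : bool :=
  (u == (ends e).1) || (u == (ends e).2).

Definition is_loop (G : graph) (e : edge G) : bool := (ends e).1 == (ends e).2.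

(* Over GF(2) the column of a loop is zero. *)
Definition incidence (G : graph) : bmatrix (vertex G) (edge G) :=
  fun u e => (incident e u && ~~ is_loop e)%:R.

Definition adjacent (G : graph) (F : {set edge G}) : rel (vertex G) :=
  fun u v => [exists e in F, (ends e == (u, v)) || (ends e == (v, u))].

(* F contains no cycle: no edge e of F has its ends joined by a path that
   avoids e (a loop has its ends joined by the empty path). *)
Definition forest (G : graph) (F : {set edge G}) : bool :=
  [forall e in F, ~~ connect (adjacent (F :\ e)) (ends e).1 (ends e).2].

Section CycleMatroid.
Variable G : graph.
Implicit Types F S T : {set edge G}.
Local Notation D := (@incidence G).

Definition cycle_rk S : nat := \max_(F : {set edge G} | (F \subset S) && forest F) #|F|.

Definition dvec (u v : vertex G) : {ffun vertex G -> ('F_2)^o} :=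
  [ffun x => (x == u)%:R + (x == v)%:R].

Lemma F2_addrr (x : 'F_2) : x + x = 0.
Proof. by case: x => [[|[|[]]] ?] //; apply/val_inj. Qed.

Lemma mxcol_incidence e : mxcol D e = dvec (ends e).1 (ends e).2.
Proof.
apply/ffunP=> x; rewrite !ffunE /incidence /incident /is_loop.
case: (eqVneq (ends e).1 (ends e).2) => [->|ne].
  by rewrite andbF F2_addrr.
rewrite andbT; case: (eqVneq x (ends e).1) => [->|_] /=; last by rewrite add0r.
by rewrite (negPf ne) addr0.
Qed.

Lemma dvecD u v w : dvec u w = dvec u v + dvec v w.
Proof.
apply/ffunP=> x; rewrite !ffunE addrA -[X in _ = X + _]addrA.
by rewrite (F2_addrr (x == v)%:R) addr0.
Qed.

Lemma dvecC u v : dvec u v = dvec v u.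
Proof. by apply/ffunP=> x; rewrite !ffunE addrC. Qed.

Lemma mem_span_connect F e :
  (mxcol D e \in col_space D F) = connect (adjacent F) (ends e).1 (ends e).2.
Proof.
set u := (ends e).1; set v := (ends e).2; apply/idP/idP; last first.
  rewrite mxcol_incidence -/u -/v; move: u v => u v; case/connectP=> p + ->; elim: p u => [|x p IHp] u /=.
    move=> _; suff -> : dvec u u = 0 by rewrite mem0v.
    by apply/ffunP=> x; rewrite !ffunE F2_addrr.
  case/andP=> /existsP[f /andP[fF ends_f]] /IHp; rewrite (dvecD u x) => ?.
  rewrite rpredD //; have := mem_col_space D fF; rewrite mxcol_incidence.
  by case/orP: ends_f => /eqP-> //=; rewrite dvecC.
have symF : connect_sym (adjacent F).
  apply: sym_connect_sym => x y; apply: eq_existsb => f.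
  by rewrite [X in _ && X]orbC.
pose phi (f : {ffun vertex G -> ('F_2)^o}) : ('F_2)^o :=
  \sum_(x | connect (adjacent F) u x) f x.
have phi_lin : linear phi.
  move=> a f g; rewrite /phi scaler_sumr -big_split; apply: eq_bigr => x _.
  by rewrite !ffunE.
pose lphi := GRing.isLinear.Build _ _ _ _ phi phi_lin.
pose Phi : {linear {ffun vertex G -> ('F_2)^o} -> ('F_2)^o} := HB.pack phi lphi.
have phi_d a b : phi (dvec a b) =
    (connect (adjacent F) u a)%:R + (connect (adjacent F) u b)%:R.
  rewrite /phi; under eq_bigr do rewrite ffunE.
  have one c : \sum_(x | connect (adjacent F) u x) (x == c)%:R =
      (connect (adjacent F) u c)%:R :> 'F_2.
    case: (boolP (connect _ u c)) => uc.
      rewrite (bigD1 c) //= eqxx big1 ?addr0 // => x /andP[_ /negPf->] //.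
    rewrite big1 // => x ux; case: eqP => // xc; by rewrite -xc ux in uc.
  by rewrite big_split /= !one.
have sub : (col_space D F <= lker (linfun Phi))%VS.
  apply: col_space_sub => f fF; rewrite memv_ker lfunE /= mxcol_incidence phi_d.
  have fa : adjacent F (ends f).1 (ends f).2.
    by apply/existsP; exists f; rewrite fF -surjective_pairing eqxx.
  by rewrite (same_connect_r symF (connect1 fa)) F2_addrr.
move/(subvP sub); rewrite memv_ker lfunE /= mxcol_incidence -/u -/v phi_d connect0.
by case: (connect _ u v).
Qed.

Lemma col_rkU1 F e :
  col_rk D (e |: F) = ((mxcol D e \notin col_space D F) + col_rk D F)%N.
Proof.
rewrite /col_rk col_spaceU.
have -> : col_space D [set e] = <[mxcol D e]>%VS.
  by rewrite /col_space enum_set1 /= span_seq1.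
case: (boolP (mxcol D e \in _)) => he /=.
  by congr (\dim _); apply/addv_idPr; rewrite -memvE.
have nz : mxcol D e != 0 by apply: contraNneq he => ->; rewrite mem0v.
rewrite dimv_disjoint_sum ?dim_vline ?nz //; apply/eqP; rewrite -subv0.
apply/subvP=> x /memv_capP[/vlineP[a ->] xF]; case: (eqVneq a 0) => [->|a0].
  by rewrite scale0r mem0v.
by have := memvZ a^-1 xF; rewrite scalerA mulVf // scale1r (negPf he).
Qed.

Lemma forestE F : forest F = (col_rk D F == #|F|).
Proof.
apply/idP/eqP => [|rkF].
  move En: #|F| => n; elim: n F En => [|n IHn] F cF fF.
    by apply/eqP; rewrite -leqn0 -cF col_rk_le_card.
  have /card_gt0P[e eF] : (0 < #|F|)%N by rewrite cF.
  have cFe : #|F :\ e| = n by have := cardsD1 e F; rewrite eF cF => -[].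
  rewrite -(setD1K eF) col_rkU1 mem_span_connect (forall_inP fF) // IHn //.
  apply/forall_inP=> f; rewrite !inE => /andP[_ /(forall_inP fF)].
  apply: contra; apply: connect_sub => x y /existsP[g /andP[gF xy]].
  apply: connect1; apply/existsP; exists g; rewrite xy andbT.
  by move: gF; rewrite !inE => /and3P[-> _ ->].
apply/forall_inP=> e eF; rewrite -mem_span_connect; apply/negP=> he.
have := col_rk_le_card D (F :\ e); have := cardsD1 e F; rewrite eF -rkF.
by rewrite -{1}(setD1K eF) col_rkU1 he; lia.
Qed.

Lemma cycle_rkE S : cycle_rk S = col_rk D S.
Proof.
apply/eqP; rewrite eqn_leq; apply/andP; split.
  apply/bigmax_leqP=> F /andP[sFS]; rewrite forestE => /eqP <-; exact: col_rkS.
suff [F [sFS fF <-]] : exists F, [/\ F \subset S, forest F & #|F| = col_rk D S].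
  by apply: leq_bigmax_cond; rewrite sFS.
move En: #|S| => n; elim: n S En => [|n IHn] S cS.
  exists set0; rewrite sub0set cards0; split=> //.
    by apply/forall_inP=> e; rewrite inE.
  by apply/eqP; rewrite eq_sym -leqn0 -cS col_rk_le_card.
have /card_gt0P[e eS] : (0 < #|S|)%N by rewrite cS.
have cSe : #|S :\ e| = n by have := cardsD1 e S; rewrite eS cS => -[].
have [F [sF fF cF]] := IHn _ cSe; have sFS := subset_trans sF (subsetDl _ _).
have := col_rkU1 (S :\ e) e; rewrite (setD1K eS).
case: (boolP (_ \in _)) => he /= rkS; first by exists F; rewrite cF rkS.
have heF : mxcol D e \notin col_space D F.
  by apply: contra he; apply: subvP; apply: col_spaceS.
have eF : e \notin F by apply: contra heF => /mem_col_space.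
exists (e |: F); rewrite subUset sub1set eS sFS cardsU1 eF cF rkS; split=> //.
by rewrite forestE cardsU1 eF col_rkU1 heF -(eqP (etrans (esym (forestE F)) fF)).
Qed.

Lemma cycle_rk_le_card S : (cycle_rk S <= #|S|)%N.
Proof. by rewrite cycle_rkE col_rk_le_card. Qed.

Lemma cycle_rkS S T : S \subset T -> (cycle_rk S <= cycle_rk T)%N.
Proof. by rewrite !cycle_rkE; apply: col_rkS. Qed.

Lemma cycle_rk_submod S T :
  (cycle_rk (S :|: T) + cycle_rk (S :&: T) <= cycle_rk S + cycle_rk T)%N.
Proof. by rewrite !cycle_rkE col_rk_submod. Qed.

Definition cycle_matroid : matroid :=
  Matroid cycle_rk_le_card cycle_rkS cycle_rk_submod.

End CycleMatroid.

Definition complete_graph (n : nat) : graph :=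
  @Graph 'I_n {p : 'I_n * 'I_n | (p.1 < p.2)%N} val.

(* PG(n,2): the points are the nonzero vectors of GF(2)^(n+1). *)
Definition PG_point (n : nat) : finType := {v : 'rV['F_2]_n.+1 | v != 0}.

Definition PG (n : nat) : matroid :=
  vector_matroid (fun (i : 'I_n.+1) (p : PG_point n) => val p 0 i).

Definition PG_line (n : nat) (L : {set ground (PG n)}) : Prop :=
  exists U : {vspace 'rV['F_2]_n.+1},
    \dim U = 2%N /\ forall p : PG_point n, (p \in L) = (val p \in U).

(* The row [None] is the characteristic vector of the set W of odd edges. *)
Definition even_cycle_matrix (G : graph) (W : {set edge G}) :
    bmatrix (option (vertex G)) (edge G) :=
  fun r e => if r is Some u then incidence u e else (e \in W)%:R.

Definition even_cycle_representation (G : graph) (W : {set edge G})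
    (M : matroid) : Prop :=
  isom M (vector_matroid (even_cycle_matrix W)).

(* A loop at u meets u twice, so resigning at u leaves its parity unchanged:
   resigning adds row u of the incidence matrix to the row of W. *)
Definition resign (G : graph) (W : {set edge G}) (u : vertex G) : {set edge G} :=
  let d := [set e | incident e u && ~~ is_loop e] in (W :\: d) :|: (d :\: W).

Definition blocking_pair (G : graph) (W : {set edge G}) (u v : vertex G) : Prop :=
  u != v /\ exists s : seq (vertex G),
    forall e, e \in foldl (@resign G) W s -> incident e u || incident e v.

Definition even_cycle_with_blocking_pair (M : matroid) : Prop :=
  exists (G : graph) (W : {set edge G}),
    even_cycle_representation W M /\
    exists u v : vertex G, blocking_pair W u v.

Definition identity_matrix (R K : finType) (A : bmatrix R K) : Prop :=
  exists f : R -> K, bijective f /\ forall r c, A r c = (f r == c)%:R.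

(* The sets X, Y_0, Y_1, C are types; Y_0, Y_1 and C are made disjoint by taking
   their sum. *)
Record template := Template {
  tC : finType;
  tX : finType;
  tY0 : finType;
  tY1 : finType;
  tA1 : bmatrix tX (tY0 + tY1 + tC)%type;
  tDelta : {set {ffun (tY0 + tY1 + tC)%type -> 'F_2}};
  tLambda : {set {ffun tX -> 'F_2}};
  tDelta_subgroup : zmod_closed (mem tDelta);
  tLambda_subgroup : zmod_closed (mem tLambda);
  t_standard_form : exists (X0 : {set tX}) (C0 : {set tC}),
    identity_matrix
      (fun (x : {x | x \in X0}) (c : {c | c \in C0}) => tA1 (val x) (inr (val c)))
    /\ forall (x : tX) (c : tC), x \in ~: X0 -> tA1 x (inr c) = 0
}.

Definition tcol (Phi : template) : finType := (tY0 Phi + tY1 Phi + tC Phi)%type.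

Section Conform.
Variables (Phi : template) (B E : finType).
(* The inclusions of X into B and of the union of Y_0, Y_1, C into E. *)
Variables (iX : tX Phi -> B) (iY : tcol Phi -> E).

Definition Xset : {set B} := [set iX x | x : tX Phi].
Definition YCset : {set E} := [set iY y | y : tcol Phi].
Definition Cset : {set E} := [set iY (inr c) | c : tC Phi].
Definition Y1set : {set E} := [set iY (inl (inr y)) | y : tY1 Phi].

(* The number of nonzero entries of column e of A'[B - X, E]. *)
Definition lower_weight (A' : bmatrix B E) (e : E) : nat :=
  #|[set b in ~: Xset | A' b e != 0]|.

Record respects_with (A' : bmatrix B E) (Z : {set E}) : Prop := RespectsWith {
  resp_A1 : forall x y, A' (iX x) (iY y) = tA1 x y;
  resp_Z : Z \subset ~: YCset;
  resp_Z_zero : forall b z, b \in Xset -> z \in Z -> A' b z = 0;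
  resp_Z_unit : forall z, z \in Z -> lower_weight A' z = 1%N;
  resp_frame : forall e, e \in ~: (YCset :|: Z) -> (lower_weight A' e <= 2)%N;
  resp_Lambda : forall e, e \in ~: (YCset :|: Z) ->
    [ffun x => A' (iX x) e] \in tLambda Phi;
  resp_Delta : forall b, b \in ~: Xset ->
    [ffun y => A' b (iY y)] \in tDelta Phi
}.

Definition matrix_conforms (A : bmatrix B E) : Prop :=
  exists (A' : bmatrix B E) (Z : {set E}),
    [/\ respects_with A' Z,
        (forall b e, e \notin Z -> A b e = A' b e) &
        (forall i, i \in Z -> exists2 j, j \in Y1set &
           forall b, A b i = A' b i + A' b j)].

End Conform.

Definition conforms (Phi : template) (M : matroid) : Prop :=
  exists (B E : finType) (iX : tX Phi -> B) (iY : tcol Phi -> E)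
         (A : bmatrix B E),
    [/\ injective iX, injective iY, matrix_conforms iX iY A &
        isom M (@contract_delete (vector_matroid A) (Cset iY) (Y1set iY))].

Definition coconforms (Psi : template) (M : matroid) : Prop :=
  conforms Psi (dual M).

(* With C = D = set0 in [has_minor], such a class is closed under isomorphism. *)
Definition minor_closed (P : matroid -> Prop) : Prop :=
  forall M N, P M -> has_minor M N -> P N.

Definition proper_class (P : matroid -> Prop) : Prop :=
  (forall M, P M -> binary M) /\ exists M, binary M /\ ~ P M.

Definition template_hypothesis : Prop :=
  forall P : matroid -> Prop, proper_class P -> minor_closed P ->
  exists (k s t : nat) (Phi : 'I_s -> template) (Psi : 'I_t -> template),
    [/\ (0 < k)%N,
        (forall i M, conforms (Phi i) M -> P M),
        (forall j M, coconforms (Psi j) M -> P M) &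
        (forall M, P M -> k_connected k M -> (2 * k <= #|ground M|)%N ->
           (exists i, conforms (Phi i) M) \/ (exists j, conforms (Psi j) (dual M)))].

(* Main.v *)
Require Import Defs.
From HB Require Import structures.
From mathcomp Require Import all_boot all_order all_algebra finfield zify ring.
Import Defs.

Set Implicit Arguments.
Unset Strict Implicit.
Unset Printing Implicit Defensive.

Import GRing.Theory.
Local Open Scope ring_scope.

(* A matroid is an even-cycle matroid with a blocking pair exactly when it is a
   graphic matroid quotiented by the sum of four vertices ([terminal_quotient]):
   split each blocking vertex into an even and an odd copy. This class is closed
   under minors, and comparing vertex degrees with cocircuit sizes shows that it
   contains neither PG(3,2)\L nor M*(K6).

   Conversely, describe the highly connected binary matroids without these two
   minors by templates. Every cotemplate produces
   M*(K6), so only templates occur. If all matroids conforming to a template avoid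
   PG(3,2)\L, then (i) modulo the columns in C the group Lambda is trivial, and
   Delta lies in the row space of A1, so that only the vectors of Y0 and Y1 modulo
   C matter; (ii) the Y1 vectors and 0 are terminals of a complete graph, and an
   affine dependence between them, or a Y0 vector in their span, is an even set of
   terminals. Contracting such sets yields PG(3,2)\L unless each has at most four
   elements and all 4-sets share a common triple, which is the four-terminal
   structure. High connectivity puts the Y0 vectors in the span of the Y1 vectors. *)

(** * Quotient ranks over GF(2) *)

(** Every matroid is carried as a family of vectors modulo a subspace [K]: contraction enlarges [K]
    and deletion forgets vectors, so no matrix is ever pivoted. Two presentations are compared
    through a linear map that matches the vectors and is injective between the quotients. A template
    is tested on one conforming matroid at a time ([univ_matroid]), with rows of Delta chosen for
    the occasion and with every column that conformity then permits; a copy of PG(3,2) minus a line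
    is sought among its vectors. Contracting a terminal vector plus a unit vector turns that
    terminal into a row, hence into a vertex. Six points with sum zero have all 15 points of PG(3,2)
    as pairwise sums, which is the origin of the bound four on the even sets. These tests constrain
    a [Y0] vector only if it lies in the span of the [Y1] and [C] columns. The others are excluded
    by connectivity: if the elements outside [Y0] failed to span, the at most |Y0| elements of [Y0]
    would form a separation. Hence the constant of the theorem has to exceed every |Y0|. *)

Lemma F2_natE (a : 'F_2) : a = (a != 0)%:R.
Proof. by case: a => [[|[|[]]] ?] //; apply/val_inj. Qed.

Lemma F2_addvv (V : lmodType 'F_2) (v : V) : v + v = 0.
Proof. by rewrite -[v]scale1r -scalerDl F2_addrr scale0r. Qed.

Lemma oppv_id (V : lmodType 'F_2) (v : V) : - v = v.
Proof. by apply/eqP; rewrite eq_sym -addr_eq0 F2_addvv. Qed.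

(** Reflection for sums over GF(2): the value of a sum depends only on the parity with which each
    atom occurs. *)
Inductive f2expr := F2zero | F2var of nat | F2add of f2expr & f2expr.

Fixpoint f2parity (e : f2expr) (i : nat) : bool :=
  match e with
  | F2zero => false
  | F2var n => n == i
  | F2add a b => f2parity a i (+) f2parity b i
  end.

Fixpoint f2eval (V : lmodType 'F_2) (env : seq V) (e : f2expr) : V :=
  match e with
  | F2zero => 0
  | F2var n => nth 0 env n
  | F2add a b => f2eval env a + f2eval env b
  end.

Lemma f2evalE (V : lmodType 'F_2) (env : seq V) e :
  f2eval env e = \sum_(i < size env) env`_i *+ f2parity e i.
Proof.
elim: e => [|n|a IHa b IHb] /=.
- by rewrite big1.
- have [ltn|len] := ltnP n (size env).
    rewrite (bigD1 (Ordinal ltn)) //= eqxx big1 ?addr0 // => i.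
    by rewrite -val_eqE /= eq_sym => /negPf->.
  rewrite nth_default // big1 // => i _.
  by case: eqP => // ni; have := ltn_ord i; rewrite -ni ltnNge len.
- rewrite IHa IHb -big_split /=; apply: eq_bigr => i _.
  by case: (f2parity a i); case: (f2parity b i); rewrite /= ?addr0 ?add0r ?F2_addvv.
Qed.

Lemma f2_normal (V : lmodType 'F_2) (env : seq V) e1 e2 :
  all (fun i => f2parity e1 i == f2parity e2 i) (iota 0 (size env)) ->
  f2eval env e1 = f2eval env e2.
Proof.
move/allP=> h; rewrite !f2evalE; apply: eq_bigr => i _.
by rewrite (eqP (h i _)) // mem_iota add0n ltn_ord.
Qed.

Ltac f2_mem x l :=
  lazymatch l with
  | nil => constr:(false)
  | x :: _ => constr:(true)
  | _ :: ?l' => f2_mem x l'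
  end.
Ltac f2_index x l :=
  lazymatch l with
  | x :: _ => constr:(O)
  | _ :: ?l' => let n := f2_index x l' in constr:(S n)
  end.
Ltac f2_atoms l e :=
  lazymatch e with
  | (?a + ?b)%R => let l' := f2_atoms l a in f2_atoms l' b
  | 0%R => l
  | ?x => match f2_mem x l with true => l | false => constr:(x :: l) end
  end.
Ltac f2_quote l e :=
  lazymatch e with
  | (?a + ?b)%R => let a' := f2_quote l a in let b' := f2_quote l b in
                   constr:(F2add a' b')
  | 0%R => constr:(F2zero)
  | ?x => let n := f2_index x l in constr:(F2var n)
  end.
(* Decides equalities between sums of vectors over GF(2). *)
Ltac f2 :=
  rewrite ?oppv_id;
  lazymatch goal with
  | |- ?a = ?b :> ?T =>
    let l0 := constr:(@nil T) in
    let l1 := f2_atoms l0 a in let l := f2_atoms l1 b in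
    let a' := f2_quote l a in let b' := f2_quote l b in
    exact: (@f2_normal _ l a' b' isT)
  end.

Section QuotientRank.
Variables (V V' : vectType 'F_2) (E : finType).
Implicit Types (S : {set E}) (K : {vspace V}).

(** Quotient spaces are not constructed; subtracting a projection onto [K] gives an endomorphism
    that plays the part of the quotient map. *)
Lemma quotient_map K :
  exists q : 'End(V), lker q = K.
Proof.
exists (\1 - projv K)%VF; apply/vspaceP=> v; rewrite memv_ker add_lfunE opp_lfunE.
rewrite id_lfunE subr_eq0; apply/eqP/idP => [->|/projv_id->//].
exact: memv_proj.
Qed.

(** The hypotheses say that [f] induces an injection of [(U + K') / K'] into the quotient by [K].
    The equation compares source and image, by rank-nullity for [q] and for [q \o f]. *)
Lemma dim_quotient (f : 'Hom(V', V)) K (K' U : {vspace V'}) :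
  (f @: K' <= K)%VS ->
  (forall v, v \in (U + K')%VS -> f v \in K -> v \in K') ->
  (\dim (f @: U + K) + \dim K' = \dim (U + K') + \dim K)%N.
Proof.
move=> fK' kerf; have [q kerq] := quotient_map K.
have qK : (q @: K = 0)%VS by apply/eqP; rewrite -lkerE kerq.
have := limg_ker_dim q (f @: U + K); rewrite kerq limgD qK addv0.
have -> : ((f @: U + K) :&: K = K)%VS by apply/capv_idPr; apply: addvSr.
have := limg_ker_dim (q \o f)%VF (U + K'); rewrite limgD.
have -> : ((q \o f) @: K' = 0)%VS.
  by apply/eqP; rewrite -subv0 limg_comp -qK limgS.
have -> : ((U + K') :&: lker (q \o f) = K')%VS.
  apply/vspaceP=> v; rewrite memv_cap; apply/andP/idP => [[vU]|vK'].
    rewrite memv_ker comp_lfunE -memv_ker kerq; exact: kerf.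
  split; first by apply: (subvP (addvSr _ _)).
  by rewrite memv_ker comp_lfunE -memv_ker kerq (subvP fK') // memv_img.
rewrite addv0 limg_comp; lia.
Qed.

End QuotientRank.

Definition fspan (V : vectType 'F_2) (E : finType) (c : E -> V) (S : {set E}) :
  {vspace V} := <<[seq c e | e <- enum S]>>%VS.

(** The rank of the image of [S] in the quotient of [V] by [K]. *)
Definition qrk (V : vectType 'F_2) (E : finType) (c : E -> V) (K : {vspace V})
  (S : {set E}) : nat := (\dim (fspan c S + K) - \dim K)%N.

Section FSpan.
Variables (V : vectType 'F_2) (E : finType) (c : E -> V).
Implicit Types S T : {set E}.

Lemma mem_fspan S e : e \in S -> c e \in fspan c S.
Proof. by move=> eS; apply/memv_span/map_f; rewrite mem_enum. Qed.

Lemma fspan_sub S (U : {vspace V}) :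
  (forall e, e \in S -> c e \in U) -> (fspan c S <= U)%VS.
Proof. by move=> h; apply/span_subvP=> _ /mapP[e + ->]; rewrite mem_enum => /h. Qed.

Lemma fspanS S T : S \subset T -> (fspan c S <= fspan c T)%VS.
Proof. by move/subsetP=> sST; apply: fspan_sub => e /sST /mem_fspan. Qed.

Lemma fspan0 : fspan c set0 = 0%VS.
Proof. by rewrite /fspan enum_set0 span_nil. Qed.

Lemma fspanU S T : (fspan c (S :|: T) = fspan c S + fspan c T)%VS.
Proof.
apply/eqP; rewrite eqEsubv subv_add !fspanS ?subsetUl ?subsetUr // !andbT.
apply: fspan_sub => e; rewrite inE => /orP[] /mem_fspan.
  exact: (subvP (addvSl _ _)).
exact: (subvP (addvSr _ _)).
Qed.

(** The only scalars are 0 and 1, so linear combinations are subset sums. *)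
Lemma memv_fspan S v : v \in fspan c S ->
  exists2 T : {set E}, T \subset S & v = \sum_(e in T) c e.
Proof.
move=> vS; suff gen s w : uniq s -> w \in <<map c s>>%VS ->
    exists2 T : {set E}, T \subset [set x in s] & w = \sum_(e in T) c e.
  by have [T] := gen (enum S) v (enum_uniq _) vS; rewrite set_enum; exists T.
elim: s w {v vS} => [|e s IHs] v /= => [_|/andP[es us]].
  by rewrite span_nil memv0 => /eqP->; exists set0; rewrite ?sub0set ?big_set0.
rewrite span_cons => /memv_addP[_ /vlineP[a ->] [w /(IHs _ us)[T sT ->] ->]].
have sT' : T \subset [set x in e :: s].
  by apply: subset_trans sT _; apply/subsetP=> x; rewrite !inE orbC => ->.
rewrite [a]F2_natE; case: (a != 0).
  exists (e |: T); first by rewrite subUset sT' sub1set inE mem_head.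
  rewrite big_setU1 ?scale1r //; apply: contra es => /(subsetP sT).
  by rewrite inE.
by exists T; rewrite // scale0r add0r.
Qed.

End FSpan.

Lemma fspan_imset (V : vectType 'F_2) (E E' : finType) (c : E -> V) (f : E' -> E)
    (S : {set E'}) : fspan c (f @: S) = fspan (c \o f) S.
Proof.
apply/eqP; rewrite eqEsubv; apply/andP; split; apply: fspan_sub => e.
  by case/imsetP=> x xS ->; apply: (mem_fspan (c \o f)).
by move=> eS /=; apply: mem_fspan; apply: imset_f.
Qed.

Lemma limg_fspan (V V' : vectType 'F_2) (E : finType) (c : E -> V)
    (f : 'Hom(V, V')) S : (f @: fspan c S)%VS = fspan (f \o c) S.
Proof. by rewrite /fspan limg_span -map_comp. Qed.

(** This is the comparison tool for all representations. Injectivity is required only on [H],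
    because the maps used below may kill vectors outside the span of the columns, for instance a
    root vertex that is sent to zero. *)
Lemma qrk_transfer (V V' : vectType 'F_2) (E : finType) (c : E -> V) (c' : E -> V')
    (K : {vspace V}) (K' H : {vspace V'}) (f : 'Hom(V', V)) :
  (forall e, c e + f (c' e) \in K) ->
  (forall v, v \in K' -> f v \in K) ->
  (forall e, c' e \in H) -> (K' <= H)%VS ->
  (forall v, v \in H -> f v \in K -> v \in K') ->
  qrk c K =1 qrk c' K'.
Proof.
move=> cf fK' cH KH kerf S; rewrite /qrk.
have fK : (f @: K' <= K)%VS.
  by apply/subvP=> _ /memv_imgP[v vK ->]; apply: fK'.
have h v : v \in (fspan c' S + K')%VS -> f v \in K -> v \in K'.
  move=> vS; apply: kerf; apply: subvP vS; rewrite subv_add KH andbT.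
  by apply: fspan_sub.
have := dim_quotient fK h.
have -> : (f @: fspan c' S + K = fspan c S + K)%VS.
  rewrite limg_fspan; apply/eqP; rewrite eqEsubv !subv_add !addvSr !andbT.
  apply/andP; split; apply: fspan_sub => e eS /=.
    have -> : f (c' e) = c e + (c e + f (c' e)) by f2.
    by rewrite memv_add ?mem_fspan.
  have -> : c e = f (c' e) + (c e + f (c' e)) by f2.
  by rewrite memv_add // (mem_fspan (f \o c')).
have := dimvS (addvSr (fspan c S) K); have := dimvS (addvSr (fspan c' S) K'); lia.
Qed.

Definition represents (M : matroid) (V : vectType 'F_2) (c : ground M -> V)
  (K : {vspace V}) : Prop := forall S, rk S = qrk c K S.

Lemma col_rk_qrk (R E : finType) (A : bmatrix R E) : col_rk A =1 qrk (mxcol A) 0.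
Proof. by move=> S; rewrite /qrk dimv0 subn0 addv0. Qed.

Lemma vector_matroid_represents (R E : finType) (A : bmatrix R E) :
  @represents (vector_matroid A) _ (mxcol A) 0.
Proof. exact: col_rk_qrk. Qed.

Lemma isom_represents (M N : matroid) (V : vectType 'F_2) (c : ground N -> V) K :
  represents c K -> isom M N ->
  exists c' : ground M -> V, represents c' K.
Proof.
move=> repc [f [_ rkf]]; exists (c \o f) => S.
by rewrite -rkf repc /qrk fspan_imset.
Qed.

Lemma represents_isom_vector (M : matroid) (V : vectType 'F_2) (c : ground M -> V)
    K (R E : finType) (A : bmatrix R E) (h : ground M -> E) :
  represents c K -> bijective h ->
  (forall S, qrk c K S = qrk (mxcol A \o h) 0 S) ->
  isom M (vector_matroid A).
Proof.
move=> repc bh eqr; exists h; split=> // S.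
by rewrite repc eqr /= col_rk_qrk /qrk fspan_imset.
Qed.

Lemma binary_represents (M : matroid) : binary M ->
  exists (V : vectType 'F_2) (c : ground M -> V) (K : {vspace V}), represents c K.
Proof.
case=> R [E [A iM]].
have [c' rc'] := isom_represents (@vector_matroid_represents _ _ A) iM.
by exists {ffun R -> ('F_2)^o}, c', 0%VS.
Qed.

Lemma represents_binary (M : matroid) (V : vectType 'F_2) (c : ground M -> V) K :
  represents c K -> binary M.
Proof.
move=> repc; have [q kerq] := quotient_map K.
pose om (v : V) : {ffun 'I_(\dim (@fullv _ V)) -> ('F_2)^o} := [ffun i => coord (vbasis fullv) i (q v)].
have om_lin : linear om.
  by move=> a u v; apply/ffunP=> i; rewrite !ffunE !linearP.
pose Om : {linear V -> {ffun 'I_(\dim (@fullv _ V)) -> ('F_2)^o}} :=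
  HB.pack om (GRing.isLinear.Build _ _ _ _ om om_lin).
pose A : bmatrix 'I_(\dim (@fullv _ V)) (ground M) := fun i e => coord (vbasis fullv) i (q (c e)).
exists 'I_(\dim (@fullv _ V)), (ground M), A.
apply: (represents_isom_vector repc (h := id)); first by exists id.
have ker v : (linfun Om v \in 0%VS) = (v \in K).
  rewrite memv0 -kerq memv_ker lfunE /=; apply/eqP/eqP => [/ffunP h|h].
    rewrite (coord_vbasis (memvf (q v))) big1 // => i _.
    by have := h i; rewrite !ffunE => ->; rewrite scale0r.
  by apply/ffunP=> i; rewrite !ffunE h linear0.
move=> S; apply: esym; apply: (@qrk_transfer _ _ _ (mxcol A \o id) c 0 K fullv (linfun Om)).
- move=> e; rewrite lfunE /= memv0; apply/eqP/ffunP=> i; rewrite !ffunE /A.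
  exact: F2_addrr.
- by move=> v; rewrite ker.
- by move=> e; apply: memvf.
- exact: subvf.
- by move=> v _; rewrite ker.
Qed.

(** * Minors *)

Section Minors.
Implicit Types M N : matroid.

Lemma rk0 M : rk (set0 : {set ground M}) = 0%N.
Proof. by apply/eqP; rewrite -leqn0 -(cards0 (ground M)) rk_le_card. Qed.

(** The deleted set can be left implicit, being whatever lies outside [C] and the image of [f]. This
    form avoids the nested subtypes of [contract_delete]. *)
Lemma has_minorP M N : has_minor M N <->
  exists (C : {set ground M}) (f : ground N -> ground M),
    [/\ injective f, forall x, f x \notin C &
        forall S, rk S = (rk (f @: S :|: C) - rk C)%N].
Proof.
split=> [[C [D [_ [h [[g hK gK] rkh]]]]]|[C [f [injf fC rkf]]]].
  exists C, (fun x => out_val (out_val (h x))); split.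
  - by move=> x y hxy; apply: (can_inj hK); do 2!apply: out_val_inj.
  - by move=> x; apply: (valP (out_val (h x))).
  - move=> S; rewrite -rkh /= /delete_rk /= /contract_rk; congr (rk (_ :|: _) - _)%N.
    by rewrite -!imset_comp.
pose D := ~: (C :|: [set f x | x : ground N]).
have hD x (fx : {y | y \notin C}) : val fx = f x ->
    fx \notin [set x : outside C | out_val x \in D].
  by move=> fxE; rewrite !inE negbK /out_val fxE imset_f ?orbT.
pose h x : ground (contract_delete C D) :=
  Sub (Sub (f x) (fC x) : {y | y \notin C}) (hD x (Sub (f x) (fC x)) (SubK _ _)).
have hE x : out_val (out_val (h x)) = f x by rewrite /out_val !SubK.
have injh : injective h by move=> x y hxy; apply: injf; rewrite -!hE hxy.
exists C, D; split.
  by rewrite -setI_eq0; apply/eqP/setP=> x; rewrite !inE; case: (x \in C).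
exists h; split.
  have surj y : exists x, h x = y.
    have := valP y; have := valP (out_val y); rewrite !inE negbK => /negPf->/=.
    case/imsetP=> x _ yE; exists x; apply: val_inj; apply: val_inj.
    by rewrite -[LHS]/(out_val (out_val (h x))) hE -yE.
  have [g gK] := fin_all_exists surj.
  by exists g => // x; apply: injh; rewrite gK.
move=> S; rewrite rkf /= /delete_rk /= /contract_rk; congr (rk (_ :|: _) - _)%N.
by rewrite -!imset_comp; apply: eq_imset => x /=; rewrite hE.
Qed.

Lemma has_minor_trans M N N' : has_minor M N -> has_minor N N' -> has_minor M N'.
Proof.
move=> /has_minorP[C [f [injf fC rkf]]] /has_minorP[C' [f' [injf' fC' rkf']]].
apply/has_minorP; exists (f @: C' :|: C), (f \o f'); split.
- exact: inj_comp.
- move=> x; rewrite inE negb_or fC andbT; apply/imsetP=> -[y yC' /injf fxy].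
  by have := fC' x; rewrite fxy yC'.
- move=> S; rewrite rkf' !rkf imsetU imset_comp setUA.
  have := rkS (subsetUr (f @: C') C); lia.
Qed.

Lemma has_minor_dual M N : has_minor M N -> has_minor (dual M) (dual N).
Proof.
move=> /has_minorP[C [f [injf fC rkf]]]; apply/has_minorP.
(* Duality exchanges the two operations: the elements deleted from [M] are those contracted in its
   dual. *)
pose C' := ~: (f @: setT :|: C); exists C', f; split=> //.
  by move=> x; rewrite !inE imset_f.
have fI (S : {set ground N}) : [disjoint f @: S & C].
  by rewrite disjoint_subset; apply/subsetP=> _ /imsetP[x _ ->]; rewrite inE fC.
move=> S; move: (S : {set ground N}) => {}S; rewrite /= /dual_rk !rkf.
have cC' : ~: C' = f @: setT :|: C by rewrite setCK.
have cS : ~: (f @: S :|: C') = f @: (~: S) :|: C.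
  apply/setP=> x; rewrite !inE negb_or negbK.
  have [xC|xC] := boolP (x \in C).
    rewrite !orbT andbT; apply/imsetP=> -[y _ xy]; by have := fC y; rewrite -xy xC.
  rewrite !orbF; apply/andP/imsetP => [[xS /imsetP[y _ xy]]|[y yS ->]].
    exists y => //; rewrite inE; apply: contra xS => yS; rewrite xy; exact: imset_f.
  split; last exact: imset_f.
  by apply: contraTN yS => /imsetP[z zS /injf->]; rewrite inE negbK.
have dis : f @: S :&: C' = set0.
  apply/setP=> x; rewrite !inE; apply/andP=> -[/imsetP[y _ ->]].
  by rewrite imset_f.
have := cardsUI (f @: S) C'; rewrite dis cards0 addn0 (card_imset _ injf) => cU.
rewrite cC' cS cU.
have sS : f @: (~: S) :|: C \subset f @: setT :|: C by rewrite setSU // imsetS // subsetT.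
have := dual_rk_ge C'; have := dual_rk_ge (f @: S :|: C'); rewrite cC' cS cU.
have := rkS (subsetUr (f @: setT) C); have := rkS (subsetUr (f @: (~: S)) C).
have := rkS sS; lia.
Qed.

Lemma dual_dual_isom M : isom (dual (dual M)) M.
Proof.
exists id; split; first by exists id.
move=> S; move: (S : {set ground M}) => {}S.
rewrite imset_id /= /dual_rk /= /dual_rk setCK setCT cardsT.
have := cardsC S; have := rkS (subsetT S); have := dual_rk_ge (~: S); rewrite setCK.
have := rk_le_card (set0 : {set ground M}); rewrite cards0.
by have := rk_le_card [set: ground M]; rewrite cardsT; lia.
Qed.

Lemma isom_has_minor M N : isom M N -> has_minor M N.
Proof.
case=> f [[g fK gK] rkf]; apply/has_minorP; exists set0, g; split=> [||S].
- exact: can_inj gK.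
- by move=> x; rewrite inE.
rewrite -rkf imsetU imset0 setU0 -imset_comp.
have -> : [set (f \o g) x | x in S] = S.
  by rewrite -[RHS]imset_id; apply: eq_imset => x /=; rewrite gK.
by rewrite rk0 subn0.
Qed.

Lemma isom_sym M N : isom M N -> isom N M.
Proof.
case=> f [[g fK gK] rkf]; exists g; split; first by exists f.
move=> S; rewrite -rkf -imset_comp; congr (rk _).
by rewrite -[RHS]imset_id; apply: eq_imset => x /=; rewrite gK.
Qed.

Lemma isom_trans M N N' : isom M N -> isom N N' -> isom M N'.
Proof.
case=> f [bf rkf] [g [bg rkg]]; exists (g \o f); split; first exact: bij_comp.
by move=> S; rewrite imset_comp rkg rkf.
Qed.

Lemma minor_represents M (V : vectType 'F_2) (c : ground M -> V) K
    (C : {set ground M}) (E : finType) (f : E -> ground M) (S : {set E}) :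
  represents c K ->
  (rk (f @: S :|: C) - rk C)%N = qrk (c \o f) (fspan c C + K) S.
Proof.
move=> repc; rewrite !repc /qrk fspanU fspan_imset addvA.
have := dimvS (addvSr (fspan c C) K).
have := dimvS (addvSr (fspan (c \o f) S) (fspan c C + K)%VS); rewrite addvA.
lia.
Qed.

Lemma binary_minor M N : binary M -> has_minor M N -> binary N.
Proof.
case/binary_represents=> V [c [K repc]] /has_minorP[C [f [_ _ rkf]]].
apply: (@represents_binary _ V (c \o f) (fspan c C + K)%VS) => S.
by rewrite rkf (minor_represents _ _ _ repc).
Qed.

Lemma delete_has_minor M (D : {set ground M}) : has_minor M (delete D).
Proof.
apply/has_minorP; exists set0, (@out_val M D); split.
- exact: out_val_inj.
- by move=> x; rewrite inE.
by move=> S; rewrite setU0 rk0 subn0.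
Qed.

Lemma contract_delete_represents M (V : vectType 'F_2) (c : ground M -> V) K
    (C D : {set ground M}) :
  represents c K ->
  @represents (contract_delete C D) V (fun x => c (out_val (out_val x)))
    (fspan c C + K)%VS.
Proof.
move=> repc S; rewrite /= /delete_rk /= /contract_rk -imset_comp.
exact: (minor_represents C _ _ repc).
Qed.

End Minors.

(** * Even-cycle matroids with a blocking pair *)

Definition unitv (T : finType) (x : T) : {ffun T -> ('F_2)^o} :=
  [ffun z => (z == x)%:R].

Lemma linear_hom (V V' : vectType 'F_2) (om : V -> V') :
  linear om -> {f : 'Hom(V, V') | f =1 om}.
Proof.
move=> om_lin.
pose Om : {linear V -> V'} := HB.pack om (GRing.isLinear.Build _ _ _ _ om om_lin).
by exists (linfun Om) => v; rewrite lfunE.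
Qed.

Lemma lincomb (T : finType) (V : vectType 'F_2) (t : T -> V) :
  {f : 'Hom({ffun T -> ('F_2)^o}, V) |
    (forall v, f v = \sum_x v x *: t x) /\ forall x, f (unitv x) = t x}.
Proof.
have om_lin : linear (fun v : {ffun T -> ('F_2)^o} => \sum_x v x *: t x).
  move=> a u v; rewrite scaler_sumr -big_split; apply: eq_bigr => x _.
  by rewrite !ffunE scalerDl scalerA.
have [f fE] := linear_hom om_lin; exists f; split=> // x.
rewrite fE (bigD1 x) //= ffunE eqxx scale1r big1 ?addr0 // => y.
by rewrite ffunE => /negPf->; rewrite scale0r.
Qed.

(* Four terminals of a graph, identified modulo their sum: this is the shape of
   an even-cycle matroid with a blocking pair once both blocking vertices are
   split into an even and an odd copy. The terminals may coincide. *)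
Definition terminal_quotient (M : matroid) : Prop :=
  exists (T : finType) (x y : ground M -> T) (p q s t : T),
    represents (fun e => unitv (x e) + unitv (y e))
      <[unitv p + unitv q + unitv s + unitv t]>.

(** Contracting edges merges each component of the contracted graph into one vertex, and a terminal
    follows its component. Terminals that merge do no harm, since they are allowed to coincide. *)
Lemma terminal_quotient_minor (M N : matroid) :
  terminal_quotient M -> has_minor M N -> terminal_quotient N.
Proof.
case=> T [x [y [p [q [s [t repM]]]]]] /has_minorP[C [f [_ _ rkf]]].
set d := (fun e => _) in repM; set kappa := (X in <[X]>%VS) in repM.
pose G := @Graph T (ground M) (fun e => (x e, y e)).
pose a := @adjacent G C; pose r : T -> T := fingraph.root a.
have a_sym : connect_sym a.
  apply: sym_connect_sym => u v; apply: eq_existsb => e.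
  by rewrite [X in _ && X]orbC.
have conn u v : connect a u v -> unitv u + unitv v \in fspan d C.
  case/connectP=> w + ->; elim: w u => [|z w IHw] u /=.
    by move=> _; rewrite F2_addvv mem0v.
  case/andP=> /existsP[e /andP[eC endse]] /IHw h.
  have -> : unitv u + unitv (last z w) = (unitv u + unitv z) +
     (unitv z + unitv (last z w)) by f2.
  rewrite rpredD //; have := mem_fspan d eC; rewrite /d /=.
  by case/orP: endse => /eqP[-> ->] //; rewrite addrC.
have rr u : r (r u) = r u by apply: root_root.
have cr u : unitv u + unitv (r u) \in fspan d C by apply/conn/connect_root.
have [Rho [_ RhoE]] := lincomb (fun u => unitv (r u)).
(* The vectors fixed by [Rho] are those supported on component representatives; on them the
   contracted edges identify nothing further. *)
pose H := lker (Rho - \1)%VF.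
have memH v : (v \in H) = (Rho v == v).
  by rewrite memv_ker add_lfunE opp_lfunE id_lfunE subr_eq0.
pose kappa' := unitv (r p) + unitv (r q) + unitv (r s) + unitv (r t).
exists T, (fun e => r (x (f e))), (fun e => r (y (f e))), (r p), (r q), (r s), (r t).
move=> S; rewrite rkf (minor_represents _ _ _ repM).
have kk : kappa + kappa' \in fspan d C.
  have -> : kappa + kappa' = (unitv p + unitv (r p)) + (unitv q + unitv (r q)) +
    (unitv s + unitv (r s)) + (unitv t + unitv (r t)) by rewrite /kappa /kappa'; f2.
  exact: (rpredD (rpredD (rpredD (cr p) (cr q)) (cr s)) (cr t)).
have Rk : Rho kappa = kappa' by rewrite /kappa !linearD /= !RhoE.
have Rk' : Rho kappa' = kappa' by rewrite /kappa' !linearD /= !RhoE !rr.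
apply: (@qrk_transfer _ _ _ _ _ _ <[kappa']> H \1%VF).
- move=> e; rewrite id_lfunE /=; apply: (subvP (addvSl _ _)).
  have -> : d (f e) + (unitv (r (x (f e))) + unitv (r (y (f e)))) =
    (unitv (x (f e)) + unitv (r (x (f e)))) + (unitv (y (f e)) + unitv (r (y (f e)))).
    by rewrite /d; f2.
  exact: rpredD.
- move=> v /vlineP[b ->]; rewrite id_lfunE memvZ //.
  have -> : kappa' = (kappa + kappa') + kappa by f2.
  by rewrite memv_add // memv_line.
- by move=> e; rewrite memH linearD /= !RhoE !rr.
- by apply/subvP=> _ /vlineP[b ->]; rewrite memH linearZ /= Rk'.
- move=> v; rewrite memH id_lfunE => /eqP Rv /memv_addP[w wC [_ /vlineP[b ->] vE]].
  rewrite -Rv vE linearD linearZ /= Rk.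
  suff /subvP/(_ w wC) : (fspan d C <= lker Rho)%VS.
    by rewrite memv_ker => /eqP->; rewrite add0r memvZ ?memv_line.
  apply: fspan_sub => e eC; rewrite memv_ker /d linearD /= !RhoE addr_eq0 oppv_id.
  apply/eqP; congr unitv; apply/eqP; rewrite /r (root_connect a_sym).
  by apply: connect1; apply/existsP; exists e; rewrite eC eqxx.
Qed.

Lemma mxcol_even_cycle (G : graph) (W : {set edge G}) (e : edge G) :
  mxcol (even_cycle_matrix W) e =
  unitv (Some (ends e).1) + unitv (Some (ends e).2) + (e \in W)%:R *: unitv None.
Proof.
apply/ffunP=> -[z|]; rewrite !ffunE /=; last by rewrite !add0r /GRing.scale /= mulr1.
rewrite scaler0 addr0 !(inj_eq Some_inj).
by have /ffunP/(_ z) := mxcol_incidence e; rewrite !ffunE.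
Qed.

(** Resigning adds row [u] to the row of [W], which is an injective linear map on columns. *)
Lemma resign_qrk (G : graph) (W : {set edge G}) u :
  qrk (mxcol (even_cycle_matrix (resign W u))) 0 =1
  qrk (mxcol (even_cycle_matrix W)) 0.
Proof.
pose om (x : {ffun option (vertex G) -> ('F_2)^o}) := x + x (Some u) *: unitv None.
have om_lin : linear om.
  move=> a x y; rewrite /om !ffunE !scalerDl scalerDr scalerA -!addrA; congr (_ + _).
  by rewrite addrCA.
have [f fE] := linear_hom om_lin.
apply: (qrk_transfer (f := f) (H := fullv)).
- move=> e; rewrite fE /om memv0 !mxcol_even_cycle; apply/eqP.
  rewrite !ffunE !(inj_eq Some_inj) /= mulr0n scaler0 addr0.
  have -> : (e \in resign W u)%:R = (e \in W)%:R + ((u == (ends e).1)%:R + (u == (ends e).2)%:R) :> 'F_2.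
    rewrite !inE /incident /is_loop.
    case: (eqVneq u (ends e).1) => [e1|n1]; case: (eqVneq u (ends e).2) => [e2|n2] /=.
    + by rewrite -e1 -e2 eqxx /= F2_addrr addr0 andbF orbF.
    + by rewrite -e1 n2 /= addr0 andbT; case: (e \in W); apply/val_inj.
    + by rewrite -e2 eq_sym n1 /= add0r andbT; case: (e \in W); apply/val_inj.
    + by rewrite !addr0 ?andbF ?andFb orbF.
  rewrite !scalerDl; f2.
- by move=> v; rewrite memv0 => /eqP->; rewrite linear0 mem0v.
- by move=> e; apply: memvf.
- exact: subvf.
- move=> v _; rewrite fE /om !memv0 => /eqP/ffunP h.
  have hu w : v (Some w) = 0 by have := h (Some w); rewrite !ffunE scaler0 addr0.
  apply/eqP/ffunP=> -[w|]; first by rewrite hu ffunE.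
  by have := h None; rewrite !ffunE hu scale0r addr0.
Qed.

Lemma foldl_resign_qrk (G : graph) (W : {set edge G}) s :
  qrk (mxcol (even_cycle_matrix (foldl (@resign G) W s))) 0 =1
  qrk (mxcol (even_cycle_matrix W)) 0.
Proof. by elim: s W => //= u s IHs W S; rewrite IHs resign_qrk. Qed.

(** Each odd edge is moved from a blocking end to the odd copy of that end. Both pairs of copies
    then represent the basis vector [None], so their sum has to be factored out. *)
Lemma blocking_pair_terminal_quotient (M : matroid) :
  even_cycle_with_blocking_pair M -> terminal_quotient M.
Proof.
case=> G [W [[h [bh rkh]] [u [v [uv [sq odd_edges]]]]]].
set W' := foldl _ W sq in odd_edges.
have rkW S : rk S = qrk (mxcol (even_cycle_matrix W') \o h) 0 S.
  rewrite -rkh /= col_rk_qrk -(foldl_resign_qrk W sq) -/W' /qrk.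
  by rewrite fspan_imset.
pose T : finType := (vertex G + bool)%type.
pose U' : T := inr true; pose V' : T := inr false.
(* An odd loop at a blocking vertex becomes an edge between the two copies of that vertex. *)
pose en (e : edge G) : T * T := let: (a, b) := ends e in
  if e \notin W' then (inl a, inl b) else if a == u then (U', inl b) else
  if b == u then (inl a, U') else if a == v then (V', inl b) else (inl a, V').
exists T, (fun e => (en (h e)).1), (fun e => (en (h e)).2), (inl u), (inl v), U', V'.
move=> S; rewrite rkW.
(* Folds the copies back, recording odd copies in the coordinate [None]; the kernel is spanned by
   the sum of the four terminals. *)
pose om (x : {ffun T -> ('F_2)^o}) : {ffun option (vertex G) -> ('F_2)^o} :=
  [ffun r => if r is Some z then x (inl z) + (z == u)%:R * x U' + (z == v)%:R * x V'
             else x U' + x V'].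
have om_lin : linear om.
  move=> a x y; apply/ffunP=> -[z|]; rewrite !ffunE /GRing.scale /=; last first.
    by rewrite mulrDr addrACA.
  by move: (x _) (x _) (x _) (y _) (y _) (y _) => x1 x2 x3 y1 y2 y3; ring.
have [f fE] := linear_hom om_lin.
have fl z : f (unitv (inl z)) = unitv (Some z).
  rewrite fE; apply/ffunP=> -[w|]; rewrite !ffunE //= ?mulr0 ?addr0 //.
have fU : f (unitv U') = unitv (Some u) + unitv None.
  by rewrite fE; apply/ffunP=> -[w|]; rewrite !ffunE //= ?mulr0 ?mulr1 ?addr0 ?add0r.
have fV : f (unitv V') = unitv (Some v) + unitv None.
  by rewrite fE; apply/ffunP=> -[w|]; rewrite !ffunE //= ?mulr0 ?mulr1 ?addr0 ?add0r.
apply: (qrk_transfer (f := f) (H := fullv)).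
- move=> e; rewrite memv0 /= mxcol_even_cycle linearD /= /en.
  have := odd_edges (h e); rewrite /incident; case: (ends (h e)) => a b /=.
  case: (h e \in W') => /=; last by rewrite scale0r addr0 !fl F2_addvv.
  move/(_ isT); rewrite scale1r ![_ == a]eq_sym ![_ == b]eq_sym.
  case: (eqVneq a u) => [->|_] /=; first by rewrite fl fU => _; apply/eqP; f2.
  case: (eqVneq b u) => [->|_] /=; first by rewrite fl fU => _; apply/eqP; f2.
  case: (eqVneq a v) => [->|_] /=; first by rewrite fl fV => _; apply/eqP; f2.
  by move=> /eqP->; rewrite fl fV; apply/eqP; f2.
- move=> x /vlineP[b ->]; rewrite memv0 linearZ /=.
  rewrite (_ : f _ = 0) ?scaler0 // !linearD /= !fl fU fV; f2.
- by move=> e; apply: memvf.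
- exact: subvf.
- move=> x _; rewrite fE memv0 => /eqP/ffunP om0; apply/vlineP; exists (x U').
  have xUV : x U' = x V'.
    by have := om0 None; rewrite !ffunE => /eqP; rewrite addr_eq0 oppv_id => /eqP.
  apply/ffunP=> -[z|[]]; rewrite !ffunE /GRing.scale /=.
  + have := om0 (Some z); rewrite !ffunE -xUV -addrA => /eqP.
    rewrite addr_eq0 oppv_id => /eqP->; rewrite !addr0 mulrDr ![x U' * _]mulrC.
    by rewrite !(inj_eq (@inl_inj _ _)).
  + by rewrite !add0r addr0 mulr1.
  + by rewrite !add0r mulr1 xUV.
Qed.

(** For distinct terminals, fold [q] onto [p] and [t] onto [s], and call an edge odd when exactly
    one of its ends is a folded vertex; [p] and [s] then form the blocking pair. *)
Lemma terminal_quotient_blocking_pair (M : matroid) :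
  terminal_quotient M -> even_cycle_with_blocking_pair M.
Proof.
case=> T [x [y [p [q [s [t]]]]]].
(* If two terminals coincide they cancel, and the quotient merely identifies the other two: the
   matroid is graphic, with all edges even. The isolated vertices in [bool] supply two distinct
   vertices for the blocking pair. *)
have degenerate a b :
    represents (fun e => unitv (x e) + unitv (y e)) <[unitv a + unitv b]> ->
    even_cycle_with_blocking_pair M.
  move=> repM; pose phi z := if z == b then a else z.
  pose G := @Graph (T + bool)%type (ground M) (fun e => (inl (phi (x e)), inl (phi (y e)))).
  exists G, set0; split; last first.
    by exists (inr true), (inr false); split=> //; exists [::] => e; rewrite inE.
  apply: (represents_isom_vector repM (h := id)) => [|S]; first by exists id.
  pose om (w : {ffun T -> ('F_2)^o}) : {ffun option (T + bool) -> ('F_2)^o} :=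
    [ffun r => if r is Some (inl z) then (z != b)%:R * w z + (z == a)%:R * w b else 0].
  have om_lin : linear om.
    move=> k u v; apply/ffunP=> -[[z|i]|]; rewrite !ffunE /GRing.scale /= ?mulr0 ?addr0 //.
    rewrite !mulrDr !mulrA ![_ * k]mulrC; exact: addrACA.
  have [f fE] := linear_hom om_lin.
  have fu z : f (unitv z) = unitv (Some (inl (phi z))).
    rewrite fE; apply/ffunP=> -[[w|i]|]; rewrite !ffunE //=.
    rewrite (inj_eq Some_inj) (inj_eq (@inl_inj _ _)) /phi (eq_sym b z).
    case: (eqVneq z b) => [->|zb].
      by case: (eqVneq w b) => _; rewrite /= ?mulr0 ?mul0r add0r mulr1.
    rewrite mulr0 addr0; case: (eqVneq w z) => [->|]; first by rewrite zb mulr1.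
    by rewrite mulr0.
  apply: esym; apply: (qrk_transfer (f := f) (H := fullv)).
  - move=> e; rewrite memv0 [(_ \o id) e](@mxcol_even_cycle G set0 e) linearD /= !fu.
    rewrite inE scale0r addr0.
    by rewrite F2_addvv.
  - move=> w /vlineP[k ->]; rewrite memv0 linearZ /=.
    rewrite (_ : f _ = 0) ?scaler0 // linearD /= !fu /phi eqxx.
    by case: (eqVneq a b) => _; rewrite F2_addvv.
  - by move=> e; apply: memvf.
  - exact: subvf.
  - move=> w _; rewrite fE memv0 => /eqP/ffunP om0; apply/vlineP; exists (w b).
    apply/ffunP=> z; rewrite !ffunE /GRing.scale /=.
    have := om0 (Some (inl z)); rewrite !ffunE.
    case: (eqVneq z b) => [->|zb] /=.
      rewrite mul0r add0r eq_sym; case: (eqVneq b a) => _ /=; last by rewrite add0r mulr1.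
      by rewrite mul1r => ->; rewrite mul0r.
    rewrite mul1r addr0 mulrC => /eqP; rewrite addr_eq0 => /eqP->.
    exact: (oppv_id (_ : ('F_2)^o)).
case: (eqVneq p q) => [->|pq].
  rewrite (_ : _ + unitv s + _ = unitv s + unitv t); first exact: degenerate.
  f2.
case: (eqVneq p s) => [->|ps].
  rewrite (_ : _ + unitv t = unitv q + unitv t); first exact: degenerate.
  f2.
case: (eqVneq p t) => [->|pt].
  rewrite (_ : _ + unitv t = unitv q + unitv s); first exact: degenerate.
  f2.
case: (eqVneq q s) => [->|qs].
  rewrite (_ : _ + unitv t = unitv p + unitv t); first exact: degenerate.
  f2.
case: (eqVneq q t) => [->|qt].
  rewrite (_ : _ + unitv t = unitv p + unitv s); first exact: degenerate.
  f2.
case: (eqVneq s t) => [->|st].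
  rewrite (_ : _ + unitv t = unitv p + unitv q); first exact: degenerate.
  f2.
move=> repM; pose phi z := if z == q then p else if z == t then s else z.
pose sigma z := (z == q) || (z == t).
pose G := @Graph T (ground M) (fun e => (phi (x e), phi (y e))).
pose W : {set edge G} := [set e | sigma (x e) (+) sigma (y e)].
exists G, W; split; last first.
  exists p, s; split=> //; exists [::] => e; rewrite /= inE /sigma /incident /= /phi.
  case: (eqVneq (x e) q) => _ /=; first by rewrite eqxx.
  case: (eqVneq (y e) q) => _ /=; first by rewrite eqxx !orbT.
  case: (eqVneq (x e) t) => _ /=; first by rewrite eqxx !orbT.
  by case: (eqVneq (y e) t) => _ //=; rewrite eqxx !orbT.
apply: (represents_isom_vector repM (h := id)) => [|S]; first by exists id.
pose om (w : {ffun T -> ('F_2)^o}) : {ffun option T -> ('F_2)^o} :=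
  [ffun r => if r is Some z then (~~ sigma z)%:R * w z + (z == p)%:R * w q + (z == s)%:R * w t
    else w q + w t].
have om_lin : linear om.
  move=> k u v; apply/ffunP=> -[z|]; rewrite !ffunE /GRing.scale /=; last first.
    by rewrite mulrDr addrACA.
  by move: (u _) (u _) (u _) (v _) (v _) (v _) => u1 u2 u3 v1 v2 v3; ring.
have [f fE] := linear_hom om_lin.
have fu z : f (unitv z) = unitv (Some (phi z)) + (sigma z)%:R *: unitv None.
  rewrite fE; apply/ffunP=> -[w|]; rewrite !ffunE /GRing.scale /= ?mulr0 ?mulr1 ?addr0 ?add0r.
    rewrite (inj_eq Some_inj) /phi /sigma (eq_sym q z) (eq_sym t z).
    case: (eqVneq z q) => [->|zq].
      rewrite (negPf qt) mulr1 mulr0 addr0.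
      by case: (eqVneq w q) => _; rewrite /= ?mulr0 ?mul0r add0r.
    case: (eqVneq z t) => [->|zt].
      rewrite mulr1 mulr0 addr0.
      by case: (eqVneq w t) => _; rewrite /= ?mulr0 ?orbT ?mul0r add0r.
    rewrite !mulr0 !addr0; case: (eqVneq w z) => [->|]; last by rewrite mulr0.
    by rewrite (negPf zq) (negPf zt) mulr1.
  rewrite /sigma (eq_sym q) (eq_sym t); case: (eqVneq z q) => [->|_].
    by rewrite (negPf qt) addr0.
  by rewrite add0r.
apply: esym; apply: (qrk_transfer (f := f) (H := fullv)).
- move=> e; rewrite memv0 [(_ \o id) e](@mxcol_even_cycle G W e) linearD /= !fu inE.
  case: (sigma (x e)); case: (sigma (y e)); rewrite /= ?scale1r ?scale0r; apply/eqP; f2.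
- move=> w /vlineP[k ->]; rewrite memv0 linearZ /=.
  rewrite (_ : f _ = 0) ?scaler0 // !linearD /= !fu /phi /sigma !eqxx.
  rewrite (negPf pq) (negPf pt) (eq_sym t q) (negPf qt) (eq_sym s q) (negPf qs) (negPf st) /=.
  rewrite !scale1r !scale0r; f2.
- by move=> e; apply: memvf.
- exact: subvf.
- move=> w _; rewrite fE memv0 => /eqP/ffunP om0; apply/vlineP; exists (w q).
  have wqt : w q = w t.
    by have := om0 None; rewrite !ffunE => /eqP; rewrite addr_eq0 oppv_id => /eqP.
  apply/ffunP=> z; rewrite !ffunE /GRing.scale /=.
  have := om0 (Some z); rewrite !ffunE -wqt /sigma.
  case: (eqVneq z q) => [->|zq] /=.
    by rewrite (eq_sym q p) (negPf pq) (negPf qs) (negPf qt) add0r !addr0 mulr1.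
  case: (eqVneq z t) => [->|zt] /=.
    by rewrite (eq_sym t p) (negPf pt) (eq_sym t s) (negPf st) !add0r mulr1.
  rewrite mul1r !addr0 -addrA => /eqP; rewrite addr_eq0 => /eqP->.
  rewrite -mulrDl mulrC; exact: (oppv_id (_ : ('F_2)^o)).
Qed.

(** * Excluded minors *)

Section RankFacts.
Variables (M : matroid) (V : vectType 'F_2) (c : ground M -> V) (K : {vspace V}).
Hypothesis repM : represents c K.

Lemma rkU1_closure (S : {set ground M}) e :
  (rk (e |: S) <= rk S)%N = (c e \in (fspan c S + K)%VS).
Proof.
rewrite !repM /qrk leq_sub2rE; last by rewrite dimvS ?addvSr.
have sub : (fspan c S + K <= fspan c (e |: S) + K)%VS.
  by rewrite addvS // fspanS // subsetUr.
apply/idP/idP => [le|ceS].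
  have /eqP-> : (fspan c S + K == fspan c (e |: S) + K)%VS by rewrite eqEdim sub.
  by apply: (subvP (addvSl _ _)); rewrite mem_fspan // setU11.
rewrite dimvS // subv_add addvSr andbT; apply: fspan_sub => f.
by rewrite !inE => /orP[/eqP->//|fS]; apply: (subvP (addvSl _ _)); rewrite mem_fspan.
Qed.

(** The support of a functional that vanishes on [K] is a cocycle; when it is nonempty, its
    complement lies in a proper flat. *)
Lemma rk_cocycle (phi : 'Hom(V, ('F_2)^o)) e : (K <= lker phi)%VS -> phi (c e) != 0 ->
  (rk (~: [set f | phi (c f) != 0%R]) < rk [set: ground M])%N.
Proof.
move=> Kphi phie; set S := ~: _; rewrite ltnNge; apply/negP=> le.
have : (rk (e |: S) <= rk S)%N by apply: leq_trans le; apply: rkS; apply: subsetT.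
rewrite rkU1_closure => /(subvP (_ : _ <= lker phi)%VS); rewrite memv_ker (negPf phie).
suff sub : (fspan c S + K <= lker phi)%VS by move/(_ sub).
rewrite subv_add Kphi andbT; apply: fspan_sub => f.
by rewrite !inE negbK memv_ker.
Qed.

End RankFacts.

Lemma dim_fspan_indep (V : vectType 'F_2) (E : finType) (c : E -> V) (S : {set E}) :
  (forall D : {set E}, D \subset S -> \sum_(e in D) c e = 0 -> D = set0) ->
  \dim (fspan c S) = #|S|.
Proof.
move En: #|S| => n; elim: n S En => [|n IHn] S cS ind.
  by rewrite (cards0_eq cS) fspan0 dimv0.
have /card_gt0P[e eS] : (0 < #|S|)%N by rewrite cS.
have cSe : #|S :\ e| = n by have := cardsD1 e S; rewrite eS cS => -[].
have dS := IHn _ cSe (fun D sD => ind D (subset_trans sD (subsetDl _ _))).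
have eE : fspan c [set e] = <[c e]>%VS by rewrite /fspan enum_set1 /= span_seq1.
have ceS : c e \notin fspan c (S :\ e).
  apply/negP=> /memv_fspan[D sD ceD].
  have eD : e \notin D by apply/negP=> /(subsetP sD); rewrite !inE eqxx.
  have /setP/(_ e) : e |: D = set0.
    apply: ind; last by rewrite big_setU1 //= -ceD F2_addvv.
    by rewrite subUset sub1set eS (subset_trans sD) // subsetDl.
  by rewrite !inE eqxx.
rewrite -(setD1K eS) fspanU eE dimv_disjoint_sum ?dS ?dim_vline.
  have -> : c e != 0 by apply: contraNneq ceS => ->; rewrite mem0v.
  by [].
apply/eqP; rewrite -subv0; apply/subvP=> v /memv_capP[/vlineP[a ->]].
rewrite [a]F2_natE; case: (a != 0); rewrite ?scale1r ?scale0r ?mem0v //.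
by rewrite (negPf ceS).
Qed.

Lemma dim_fspan_le (V : vectType 'F_2) (E : finType) (c : E -> V) (S : {set E}) :
  (\dim (fspan c S) <= #|S|)%N.
Proof. by rewrite (leq_trans (dim_span _)) // size_map -cardE. Qed.

(** * Edge vectors and vertex stars *)

Section EdgeVectors.
Variables (E T : finType) (x y : E -> T).
Definition edgev (e : E) : {ffun T -> ('F_2)^o} := unitv (x e) + unitv (y e).
Definition star (z : T) : {set E} := [set e | edgev e z != 0%R].

Lemma in_star z e : e \in star z -> exists2 w, w != z & edgev e = unitv z + unitv w.
Proof.
rewrite inE /edgev !ffunE; case: (eqVneq z (x e)) => [->|zx].
  by case: (eqVneq (x e) (y e)) => // xy _; exists (y e); rewrite // eq_sym.
case: (eqVneq z (y e)) => // zy _; exists (x e); last by rewrite zy addrC.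
by rewrite eq_sym.
Qed.

Lemma edgev_eq z w e : z != w -> edgev e z != 0 -> edgev e w != 0 ->
  edgev e = unitv z + unitv w.
Proof.
move=> zw ez ew; have [|v vz eE] := @in_star z e; first by rewrite inE.
rewrite eE; move: ew; rewrite eE !ffunE (eq_sym w z) (negPf zw) add0r.
by case: (eqVneq w v) => [->|]; rewrite ?eqxx.
Qed.

(** By injectivity each edge at [z] has an other end of its own, and that coordinate isolates the
    edge in any sum. *)
Lemma star_indep z : injective edgev -> \dim (fspan edgev (star z)) = #|star z|.
Proof.
move=> injd; apply: dim_fspan_indep => D sD sum0; apply/setP=> e; rewrite inE.
apply/negP=> eD; have [w wz ew] := in_star (subsetP sD _ eD).
have /ffunP/(_ w) := sum0; rewrite sum_ffunE ffunE (bigD1 e) //= big1.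
  by rewrite addr0 ew !ffunE eqxx (negPf wz) add0r => /eqP; rewrite oner_eq0.
move=> f /andP[fD fe]; apply/eqP; apply: contraNT fe => fw.
apply/eqP/injd; rewrite ew; apply: edgev_eq fw; first by rewrite eq_sym.
by have := subsetP sD _ fD; rewrite inE.
Qed.

End EdgeVectors.

Lemma coord_hom (T : finType) (z : T) :
  {f : 'Hom({ffun T -> ('F_2)^o}, ('F_2)^o) | forall v, f v = v z}.
Proof.
by have [|f fE] := @linear_hom _ _ (fun v : {ffun T -> ('F_2)^o} => v z);
  [move=> a u v; rewrite !ffunE | exists f].
Qed.

(** * PG(3,2) minus a line is not a terminal quotient *)

Section PG3Line.
Variables (L : {set ground (PG 3)}).
Hypothesis hL : PG_line L.

Definition pg_vec (e : ground (delete L)) : 'rV['F_2]_4 := val (out_val e).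

Lemma pg_vec_inj : injective pg_vec.
Proof. by move=> e f /val_inj ef; apply: out_val_inj. Qed.

Lemma pg_vec_neq0 e : pg_vec e != 0.
Proof. exact: (valP (out_val e)). Qed.

Lemma pg_vec_represents : represents pg_vec 0.
Proof.
have lin : linear (fun v : 'rV['F_2]_4 => [ffun i => v 0 i] : {ffun 'I_4 -> ('F_2)^o}).
  by move=> a u v; apply/ffunP=> i; rewrite !ffunE !mxE.
have [f fE] := linear_hom lin; move=> S.
transitivity (qrk (mxcol (fun (i : 'I_4) (p : PG_point 3) => val p 0 i) \o @out_val (PG 3) L) 0 S).
  by rewrite /= /delete_rk /= col_rk_qrk /qrk fspan_imset.
apply: (qrk_transfer (f := f) (H := fullv)).
- move=> e; rewrite memv0 fE; apply/eqP/ffunP=> i; rewrite !ffunE; exact: F2_addrr.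
- by move=> v; rewrite memv0 => /eqP->; rewrite linear0 mem0v.
- by move=> e; apply: memvf.
- exact: subvf.
- move=> v _; rewrite !memv0 fE => /eqP/ffunP v0; apply/eqP/rowP=> i.
  by have := v0 i; rewrite !ffunE mxE.
Qed.

Lemma PG3_line_subspace : exists U : {vspace 'rV['F_2]_4}, \dim U = 2%N /\
  pg_vec @: [set: ground (delete L)] = [set v | v \notin U].
Proof.
have [U [dU LU]] := hL; exists U; split=> //; apply/setP=> v; rewrite inE.
apply/imsetP/idP => [[e _ ->]|vU].
  by have := valP e; rewrite /= -LU.
have v0 : v != 0 by apply: contraNneq vU => ->; rewrite mem0v.
have vL : (Sub v v0 : PG_point 3) \notin L by rewrite LU.
by exists (Sub (Sub v v0 : PG_point 3) vL).
Qed.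

Lemma card_sub_vspace (H U : {vspace 'rV['F_2]_4}) :
  (#|[set v | v \in H & v \notin U]| + 2 ^ \dim (H :&: U) = 2 ^ \dim H)%N.
Proof.
have cs (W : {vspace 'rV['F_2]_4}) : (2 ^ \dim W)%N = #|[set v | v \in W]|.
  by rewrite cardsE; have := card_vspace W; rewrite card_Fp.
rewrite !cs -(cardsID [set v | v \in U] [set v | v \in H]) addnC; congr (_ + _)%N.
  by apply: eq_card => v; rewrite !inE memv_cap.
by apply: eq_card => v; rewrite !inE andbC.
Qed.

Lemma card_PG3_line : #|ground (delete L)| = 12%N.
Proof.
have [U [dU imU]] := PG3_line_subspace.
rewrite -cardsT -(card_imset _ pg_vec_inj) imU.
have := card_sub_vspace fullv U; rewrite capfv dU dimvf /dim /= => h.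
move: h; rewrite [X in (X + _)%N](_ : _ = #|[set v : 'rV['F_2]_4 | v \notin U]|).
  by rewrite mul1n => /(congr1 (subn^~ 4)); rewrite addnK.
by apply: eq_card => v; rewrite !inE memvf.
Qed.

(** A hyperplane of the 4-dimensional space meets the 2-dimensional [U] in dimension at least 1,
    which leaves at most 8 - 2 vectors outside [U]. *)
Lemma PG3_line_nonspanning (S : {set ground (delete L)}) : (rk S < 4)%N -> (#|S| <= 6)%N.
Proof.
have [U [dU imU]] := PG3_line_subspace.
rewrite pg_vec_represents /qrk addv0 dimv0 subn0; set H := fspan _ S => dH.
have csv := card_sub_vspace H U; set X := #|_| in csv.
have le : (#|S| <= X)%N.
  rewrite -(card_imset _ pg_vec_inj); apply: subset_leq_card; apply/subsetP=> _ /imsetP[e eS ->].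
  rewrite inE mem_fspan //=; have : pg_vec e \in pg_vec @: [set: ground (delete L)] by apply: imset_f.
  by rewrite imU inE.
have := dimv_sum_cap H U.
have : (\dim (H + U) <= 4)%N by apply: leq_trans (dimvS (subvf _)) _; rewrite dimvf.
rewrite dU; move: (\dim H) (\dim (H + U)) (\dim (H :&: U)) dH csv => h a b.
have b_gt0 : (0 < 2 ^ b.-2)%N by rewrite expn_gt0.
move: X #|S| le => X n le.
case: h => [|[|[|[|]]]] //; case: b b_gt0 => [|[|b]] //=;
  rewrite ?expnS ?expn0; lia.
Qed.

Lemma PG3_line_rk_le (S : {set ground (delete L)}) : (rk S <= 4)%N.
Proof.
rewrite pg_vec_represents /qrk addv0 dimv0 subn0.
by apply: leq_trans (dimvS (subvf _)) _; rewrite dimvf.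
Qed.

(** A nonempty star at a nonterminal vertex has a nonspanning complement, so it contains at least 12
    - 6 edges. These are independent before the quotient by one vector, so their rank is at least 5,
    which is impossible. Hence every element joins two of at most four terminals, and there are only
    6 such pairs for 12 elements. *)
Lemma PG3_line_not_terminal_quotient : ~ terminal_quotient (delete L).
Proof.
case=> T [x [y [p [q [s [t rep]]]]]]; set d := (fun e => _) in rep.
have dE : d = edgev x y by [].
set kappa := (X in <[X]>%VS) in rep.
have rk_le e S : (rk (e |: S) <= rk S)%N = (pg_vec e \in fspan pg_vec S).
  by rewrite (rkU1_closure pg_vec_represents) addv0.
have d_neq0 e : d e != 0.
  apply/eqP=> de; have := rkU1_closure rep set0 e.
  by rewrite de mem0v rk_le fspan0 memv0 (negPf (pg_vec_neq0 e)).
have injd : injective d.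
  move=> e f def; apply: pg_vec_inj.
  have : (rk (e |: [set f]) <= rk [set f])%N.
    by rewrite (rkU1_closure rep) def (subvP (addvSl _ _)) // mem_fspan ?set11.
  rewrite rk_le /fspan enum_set1 /= span_seq1 => /vlineP[a].
  rewrite [a]F2_natE; case: (a != 0); rewrite ?scale1r // scale0r => e0.
  by have := pg_vec_neq0 e; rewrite e0 eqxx.
pose Ts := [set p; q; s; t].
have star0 z : z \notin Ts -> star x y z = set0.
  move=> zT; apply/eqP/set0Pn=> -[e ez].
  have [f fE] := coord_hom z.
  have kf : (<[kappa]> <= lker f)%VS.
    apply/subvP=> _ /vlineP[a ->]; rewrite memvZ // memv_ker fE !ffunE.
    by move: zT; rewrite !inE !negb_or -!andbA => /and4P[/negPf-> /negPf-> /negPf-> /negPf->].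
  have phie : f (d e) != 0 by move: ez; rewrite fE inE.
  have := rk_cocycle rep kf phie.
  have -> : [set g | f (d g) != 0] = star x y z by apply/setP=> g; rewrite !inE fE.
  move=> lt; have /PG3_line_nonspanning := leq_trans lt (PG3_line_rk_le _).
  have := cardsC (star x y z); rewrite card_PG3_line.
  have := PG3_line_rk_le (star x y z); rewrite rep /qrk.
  have := dimvS (addvSl (fspan d (star x y z)) <[kappa]>).
  rewrite dE (star_indep z injd) dim_vline.
  by case: (_ != _); lia.
have xy e : x e != y e.
  by apply: contraNneq (d_neq0 e) => exy; rewrite /d exy F2_addvv.
have inT e z : d e z != 0 -> z \in Ts.
  apply: contraNT => /star0/setP/(_ e); rewrite !inE; by case: eqP.
have endsT e : [set x e; y e] \subset Ts.
  rewrite subUset !sub1set; apply/andP; split; apply: (inT e); rewrite /d !ffunE eqxx.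
    by rewrite (negPf (xy e)).
  by rewrite (eq_sym (y e)) (negPf (xy e)).
have dset e : d e = \sum_(z in [set x e; y e]) unitv z.
  by rewrite big_setU1 ?big_set1 // inE.
have inj2 : injective (fun e => [set x e; y e]).
  by move=> e f ef; apply: injd; rewrite !dset ef.
have := card_PG3_line; rewrite -cardsT -(card_imset _ inj2) => c12.
have : (#|[set [set x e; y e] | e in [set: ground (delete L)]]| <= 'C(#|Ts|, 2))%N.
  rewrite -cards_draws; apply: subset_leq_card; apply/subsetP=> _ /imsetP[e _ ->].
  by rewrite inE endsT cards2 (xy e).
have : ('C(#|Ts|, 2) <= 'C(4, 2))%N.
  apply: leq_bin2l; rewrite /Ts -!setUA !cardsU1 cards1.
  by do !case: (_ \notin _).
rewrite c12; move=> h1 h2; by have := leq_trans h2 h1.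
Qed.

End PG3Line.

Lemma card_set_sum (E : finType) (P : pred E) : #|[set e | P e]| = (\sum_e P e)%N.
Proof. by rewrite -sum1dep_card big_mkcond; apply: eq_bigr => e _; case: (P e). Qed.

(** * Degree counting against M*(K6) *)

Section DegreeCount.
Variables (M : matroid) (T : finType) (x y : ground M -> T).
Local Notation d := (edgev x y).
Local Notation R := (star x y).

Lemma sum_star : (\sum_z #|R z| <= 2 * #|ground M|)%N.
Proof.
have -> : (\sum_z #|R z| = \sum_z \sum_e (d e z != 0%R))%N.
  by apply: eq_bigr => z _; apply: card_set_sum.
rewrite exchange_big /= mulnC -sum_nat_const; apply: leq_sum => e _.
rewrite -(card_set_sum (fun z => d e z != 0%R)).
apply: (@leq_trans #|[set x e; y e]|); last by rewrite cards2; case: (_ != _).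
apply: subset_leq_card; apply/subsetP=> z; rewrite !inE /edgev !ffunE.
by case: (z == x e); case: (z == y e).
Qed.

Definition touched : {set T} := [set z | R z != set0].

Lemma edgev_touched e z : d e z != 0 -> z \in touched.
Proof. by move=> dez; rewrite inE; apply/set0Pn; exists e; rewrite inE. Qed.

Lemma edgev_ends e : d e = 0 \/ (x e \in touched /\ y e \in touched).
Proof.
case: (eqVneq (x e) (y e)) => [xy|xy]; [left|right].
  by rewrite /edgev xy F2_addvv.
split; apply: (@edgev_touched e); rewrite /edgev !ffunE eqxx.
  by rewrite (negPf xy).
by rewrite (eq_sym (y e)) (negPf xy).
Qed.

(** The edge vectors lie in the even-weight space on the touched vertices, which is spanned by the
    sums of one fixed vertex with each of the others. *)
Lemma dim_touched : (0 < \dim (fspan d setT) -> \dim (fspan d setT) < #|touched|)%N.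
Proof.
move=> dim_gt0; have [tz|[v vN]] := set_0Vmem touched.
  suff : (fspan d setT <= 0)%VS by rewrite subv0 => /eqP f0; rewrite f0 dimv0 in dim_gt0.
  by apply: fspan_sub => e _; case: (edgev_ends e) => [->|[]]; rewrite ?mem0v // tz inE.
have := cardsD1 v touched; rewrite vN add1n => ->; rewrite ltnS.
apply: leq_trans (dim_fspan_le (fun w => unitv v + unitv w) _); apply: dimvS.
apply: fspan_sub => e _; case: (edgev_ends e) => [->|[xN yN]]; first exact: mem0v.
have U z : z \in touched ->
    unitv v + unitv z \in fspan (fun w => unitv v + unitv w) (touched :\ v).
  move=> zN; case: (eqVneq z v) => [->|zv]; first by rewrite F2_addvv mem0v.
  by apply: (mem_fspan (fun w => unitv v + unitv w)); rewrite in_setD1 zv zN.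
have -> : d e = (unitv v + unitv (x e)) + (unitv v + unitv (y e)) by rewrite /edgev; f2.
by rewrite rpredD ?U.
Qed.

(** Equal stars consist only of copies of the edge [zw]. The pair is then a component by itself, and
    each further component costs one more dimension. *)
Lemma dim_touched_eq z w : z != w -> z \in touched -> w \in touched -> R z = R w ->
  (3 <= #|touched| -> (\dim (fspan d setT)).+2 <= #|touched|)%N.
Proof.
move=> zw zN wN Rzw t3; pose N' := touched :\ z :\ w.
have cN : (#|touched| = #|N'|.+2)%N.
  by rewrite (cardsD1 z touched) zN (cardsD1 w (_ :\ z)) in_setD1 eq_sym zw wN.
have [v vN] : exists v, v \in N' by apply/card_gt0P; move: t3; rewrite cN; lia.
pose N := N' :\ v; have cN' : #|N'| = #|N|.+1 by rewrite (cardsD1 v) vN.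
pose g u := unitv v + unitv u; pose U := (<[(unitv z + unitv w)%R]> + fspan g N)%VS.
suff sub : (fspan d setT <= U)%VS.
  rewrite cN cN' !ltnS; apply: leq_trans (dimvS sub) _.
  apply: leq_trans (dimv_add_leqif _ _) _; rewrite dim_vline.
  by have := dim_fspan_le g N; case: (_ != _); lia.
apply: fspan_sub => e _; case: (edgev_ends e) => [->|[xN yN]]; first exact: mem0v.
have [dz|dz] := boolP (e \in R z).
  have dw : e \in R w by rewrite -Rzw.
  have -> : d e = unitv z + unitv w by move: dz dw; rewrite !inE; apply: edgev_eq.
  by apply: (subvP (addvSl _ _)); rewrite memv_line.
have dw : e \notin R w by rewrite -Rzw.
case: (eqVneq (x e) (y e)) => [xy|xy]; first by rewrite /edgev xy F2_addvv mem0v.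
have Uu u : u \in touched -> d e u != 0 -> unitv v + unitv u \in U.
  move=> uN du; case: (eqVneq u v) => [->|uv]; first by rewrite F2_addvv mem0v.
  apply: (subvP (addvSr _ _)); apply: (mem_fspan g).
  rewrite !in_setD1 uv uN andbT /=; apply/andP; split.
    by apply: contraNneq dw => <-; rewrite inE.
  by apply: contraNneq dz => <-; rewrite inE.
have -> : d e = (unitv v + unitv (x e)) + (unitv v + unitv (y e)) by rewrite /edgev; f2.
apply: rpredD; apply: Uu => //; rewrite /edgev !ffunE eqxx.
  by rewrite (negPf xy).
by rewrite (eq_sym (y e)) (negPf xy).
Qed.

(** The data of M*(K6). The cogirth condition holds there because the simple graph K6 has no circuit
    with at most two edges. *)
Hypotheses (cardM : #|ground M| = 15%N) (rkM : (10 <= rk [set: ground M])%N).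
Hypothesis cogirth : forall S : {set ground M}, (#|S| <= 2)%N ->
  rk (~: S) = rk [set: ground M].
Variable kappa : {ffun T -> ('F_2)^o}.
Hypothesis repM : represents d <[kappa]>.
Hypothesis kappa4 : (#|[set z | kappa z != 0%R]| <= 4)%N.

Lemma star_ge3 z : kappa z = 0 -> z \in touched -> (3 <= #|R z|)%N.
Proof.
move=> kz; rewrite inE => /set0Pn[e]; rewrite inE => ez; have [f fE] := coord_hom z.
have kf : (<[kappa]> <= lker f)%VS.
  by apply/subvP=> _ /vlineP[a ->]; rewrite memvZ // memv_ker fE kz.
have phie : f (d e) != 0 by rewrite fE.
have := rk_cocycle repM kf phie.
have -> : [set g | f (d g) != 0] = R z by apply/setP=> g; rewrite !inE fE.
by rewrite ltnNge => h; rewrite ltnNge; apply: contra h => /cogirth->.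
Qed.

(** The coordinate of a single terminal does not vanish on [kappa], but the sum of two such
    coordinates does. Thus the symmetric difference of two terminal stars is a cocycle. *)
Lemma star_sum_ge3 z w : kappa z != 0 -> kappa w != 0 -> R z != R w ->
  (3 <= #|R z| + #|R w|)%N.
Proof.
move=> kz kw Rzw; have [f fE] := coord_hom z; have [g gE] := coord_hom w.
have kzw : kappa z + kappa w = 0.
  by rewrite (F2_natE (kappa z)) (F2_natE (kappa w)) kz kw; apply/val_inj.
have kf : (<[kappa]> <= lker (f + g)%R)%VS.
  by apply/subvP=> _ /vlineP[a ->]; rewrite memvZ // memv_ker add_lfunE fE gE kzw.
have E e : ((f + g)%R (d e) != 0) = (e \in R z) (+) (e \in R w).
  rewrite add_lfunE fE gE !inE; move: (F2_natE (d e z)) (F2_natE (d e w)).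
  by case: (d e z != 0); case: (d e w != 0) => -> ->.
have [e De] : exists e, (e \in R z) (+) (e \in R w).
  apply/existsP; apply: contraNT Rzw; rewrite negb_exists => /forallP h.
  by apply/eqP/setP=> e; have := h e; case: (e \in R z); case: (e \in R w).
have phie : (f + g)%R (d e) != 0 by rewrite E.
have := rk_cocycle repM kf phie => lt; rewrite ltnNge.
apply/negP=> le2; move: lt; rewrite cogirth ?ltnn //.
apply: leq_trans le2; apply: (@leq_trans #|R z :|: R w|).
  apply: subset_leq_card; apply/subsetP=> h; rewrite inE E in_setU.
  by case: (h \in R z).
by rewrite cardsU leq_subr.
Qed.

(** If [kappa] is 0, at least 11 vertices of degree at least 3 exceed the degree sum 30. If [kappa]
    is a nonzero vector of the span, there are at least 12 vertices, of which at most four are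
    terminals and at most one has degree 1; the degree sum is then at least 24 + 8 - 1 = 31. *)
Lemma degree_count : kappa = 0 \/ kappa \in fspan d setT -> False.
Proof.
have sum_touched : (\sum_(z in touched) #|R z| <= 30)%N.
  apply: leq_trans (_ : 2 * 15 <= _)%N; last by [].
  rewrite -cardM; apply: leq_trans sum_star.
  by rewrite big_mkcond /=; apply: leq_sum => z _; case: (_ \in _).
have := rkM; rewrite repM /qrk dim_vline => dimF k0.
case: (eqVneq kappa 0) k0 dimF => [k0 _|kn0 [k0|kF]].
- have -> : <[kappa]>%VS = 0%VS by apply/eqP; rewrite -dimv_eq0 dim_vline k0 eqxx.
  rewrite /= addv0 subn0 => dimF.
  have /dim_touched t10 : (0 < \dim (fspan d setT))%N by lia.
  have : (\sum_(z in touched) 3 <= \sum_(z in touched) #|R z|)%N.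
    by apply: leq_sum => z zN; apply: star_ge3; rewrite // k0 ffunE.
  by rewrite sum_nat_const; lia.
- by rewrite k0 eqxx in kn0.
rewrite (addv_idPl _) /=; last by rewrite -memvE.
rewrite subn1 => dimF; have {}dimF : (11 <= \dim (fspan d setT))%N by lia.
have /dim_touched t11 : (0 < \dim (fspan d setT))%N by lia.
pose A := touched :&: [set z | kappa z != 0]; pose B := touched :\: A.
have A4 : (#|A| <= 4)%N.
  by apply: leq_trans kappa4; apply: subset_leq_card; apply: subsetIr.
have cAB : (#|A| + #|B| = #|touched|)%N.
  by rewrite -(cardsID A touched) /B; congr (#|_| + _)%N; rewrite setIA setIid.
have sumB : (3 * #|B| <= \sum_(z in B) #|R z|)%N.
  rewrite mulnC -sum_nat_const; apply: leq_sum => z; rewrite in_setD => /andP[zA zN].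
  apply: star_ge3 => //; apply/eqP; apply: contraNT zA => kz.
  by rewrite in_setI zN inE.
have sumAB : (\sum_(z in A) #|R z| + \sum_(z in B) #|R z| <= 30)%N.
  rewrite (big_setID A) /= in sum_touched; move: sum_touched.
  by rewrite (setIidPr (subsetIl _ _)).
have A_ge1 z : z \in A -> (1 <= #|R z|)%N.
  by rewrite !inE card_gt0 => /andP[].
have sumA : (#|A| <= \sum_(z in A) #|R z|)%N.
  by rewrite -sum1_card; apply: leq_sum => z; apply: A_ge1.
(* With 13 vertices, at least 9 nonterminals of degree 3 and 4 terminals of degree 1 would already
   give 31. *)
have t12 : #|touched| = 12%N by lia.
have distinct z w : z \in A -> w \in A -> z != w -> R z != R w.
  move=> zA wA zw; apply/eqP=> Rzw.
  have := @dim_touched_eq z w zw (subsetP (subsetIl _ _) _ zA) (subsetP (subsetIl _ _) _ wA) Rzw.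
  by rewrite t12 => /(_ isT); lia.
have kA z : z \in A -> kappa z != 0 by rewrite !inE => /andP[].
suff : (2 * #|A| <= (\sum_(z in A) #|R z|).+1)%N by lia.
have [/existsP[z /andP[zA /eqP Rz]]|] := boolP [exists z in A, #|R z| == 1%N].
  rewrite (bigD1 z) //= Rz (cardsD1 z A) zA.
  suff : (\sum_(w in A :\ z) 2 <= \sum_(w in A | w != z) #|R w|)%N.
    by rewrite sum_nat_const; lia.
  rewrite [X in (_ <= X)%N](eq_bigl (mem (A :\ z))); last by move=> w; rewrite !inE andbC.
  apply: leq_sum => w; rewrite in_setD1 => /andP[wz wA].
  have := star_sum_ge3 (kA _ wA) (kA _ zA) (distinct _ _ wA zA wz); rewrite Rz; lia.
rewrite negb_exists => /forallP no1.
rewrite mulnC -sum_nat_const leqW //; apply: leq_sum => z zA.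
by have := no1 z; rewrite zA /=; have := A_ge1 z zA; lia.
Qed.

End DegreeCount.

(** * M*(K6) is not a terminal quotient *)

Section K6.
Let G6 := complete_graph 6.

Lemma card_edge_K6 : #|edge G6| = 15%N.
Proof.
rewrite card_sig -sum1_card big_mkcond /= -(pair_big xpredT xpredT
  (fun i j : 'I_6 => if (i < j)%N then 1 else 0)%N) /=.
by rewrite !big_ord_recl !big_ord0.
Qed.

Local Notation dK := (edgev (fun e : edge G6 => (ends e).1) (fun e => (ends e).2)).

Lemma K6_rkE (S : {set edge G6}) : @rk (cycle_matroid G6) S = \dim (fspan dK S).
Proof.
rewrite /= cycle_rkE; congr (\dim <<_>>); apply: eq_map => e.
by rewrite mxcol_incidence; apply/ffunP=> z; rewrite !ffunE.
Qed.

Lemma dK_inj : injective dK.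
Proof.
move=> e f def; apply: val_inj; rewrite [LHS]surjective_pairing [RHS]surjective_pairing.
have := valP e; have := valP f; move: def; rewrite /edgev /= /ends /=.
case: (val e) (val f) => [i j] [k l] /= def kl ij.
have nij : i != j by rewrite neq_ltn ij.
have /ffunP/(_ i) := def; have /ffunP/(_ j) := def.
rewrite !ffunE !eqxx (negPf nij) (eq_sym j i) (negPf nij).
case: (eqVneq i k) => [ik|nik].
  by rewrite -ik (eq_sym j i) (negPf nij); case: (eqVneq j l) => [->|].
case: (eqVneq i l) => // il; case: (eqVneq j k) => [jk|njk].
  by move: kl ij; rewrite -jk -il => /ltnW; rewrite leqNgt => /negP.
by rewrite -il (eq_sym j i) (negPf nij).
Qed.

Lemma K6_rk_le5 (S : {set edge G6}) : (@rk (cycle_matroid G6) S <= 5)%N.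
Proof.
rewrite K6_rkE; pose g (i : 'I_5) := unitv (ord0 : 'I_6) + unitv (lift ord0 i).
apply: (@leq_trans (\dim (fspan g setT))); last first.
  by apply: leq_trans (dim_fspan_le _ _) _; rewrite cardsT card_ord.
apply: dimvS; apply: fspan_sub => e _; move: (ends e) => [i j].
have U (k : 'I_6) : unitv ord0 + unitv k \in fspan g setT.
  case: (unliftP ord0 k) => [l ->|->]; first by apply: (mem_fspan g); rewrite inE.
  by rewrite F2_addvv mem0v.
have -> : dK e = (unitv ord0 + unitv (ends e).1) + (unitv ord0 + unitv (ends e).2).
  by rewrite /edgev; f2.
by rewrite rpredD ?U.
Qed.

Lemma K6_rk_small (S : {set edge G6}) : (#|S| <= 2)%N -> @rk (cycle_matroid G6) S = #|S|.
Proof.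
move=> S2; rewrite K6_rkE; apply: dim_fspan_indep => D sD.
have := leq_trans (subset_leq_card sD) S2.
case: (set_0Vmem D) => [//|[e eD]]; rewrite (cardsD1 e) eD ltnS => D1.
have dne f : dK f != 0.
  apply/eqP=> /ffunP/(_ (ends f).1); rewrite !ffunE eqxx.
  have := valP f; rewrite /ends /=; case: (val f) => i j /= ij.
  by rewrite eq_sym -val_eqE gtn_eqF.
rewrite (bigD1 e) //=; case: (set_0Vmem (D :\ e)) => [D0|[f fD]].
  rewrite big_pred0 ?addr0 => [/eqP|f]; first by rewrite (negPf (dne e)).
  by have /setP/(_ f) := D0; rewrite !inE andbC.
move: (fD); rewrite in_setD1 => /andP[fe _].
have D1E : D :\ e = [set f].
  by apply/eqP; rewrite eq_sym eqEcard sub1set fD cards1.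
rewrite (eq_bigl (mem [set f])) ?big_set1; last first.
  by move=> g; rewrite -D1E !inE andbC.
move/eqP; rewrite addr_eq0 oppv_id => /eqP/dK_inj ef.
by rewrite ef eqxx in fe.
Qed.

Lemma dual_K6_not_terminal_quotient : ~ terminal_quotient (dual (cycle_matroid G6)).
Proof.
set N := dual _; have cN : #|ground N| = 15%N by apply: card_edge_K6.
case=> T [x [y [p [q [s [t rep]]]]]].
have rk_set0 : cycle_rk (set0 : {set edge G6}) = 0%N := @rk0 (cycle_matroid G6).
have rk5 := K6_rk_le5 setT; rewrite /= in rk5.
have rkN : (10 <= rk [set: ground N])%N.
  by rewrite /= /dual_rk setCT cardsT card_edge_K6 /= rk_set0; lia.
have cogirth (S : {set ground N}) : (#|S| <= 2)%N -> rk (~: S) = rk [set: ground N].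
  move=> S2; have := K6_rk_small S2; rewrite /= => rkS.
  rewrite /= /dual_rk setCT setCK /= rkS rk_set0 addn0; congr (_ - _)%N.
  by rewrite addnC cardsC cardsT.
set kappa := (X in <[X]>%VS) in rep.
have k4 : (#|[set z | kappa z != 0%R]| <= 4)%N.
  apply: (@leq_trans #|[set p; q; s; t]|).
    apply: subset_leq_card; apply/subsetP=> z; rewrite !inE /kappa !ffunE.
    by do 4!case: (z == _).
  by rewrite -!setUA !cardsU1 cards1; do !case: (_ \notin _).
have [kF|kF] := boolP (kappa \in fspan (edgev x y) setT).
  by apply: (degree_count cN rkN cogirth rep k4); right.
have kn0 : kappa != 0 by apply: contraNneq kF => ->; rewrite mem0v.
(* When [kappa] lies outside the span of the columns, the quotient changes no rank, and [kappa] may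
   be replaced by 0. *)
have rep0 : represents (edgev x y) <[(0 : {ffun T -> ('F_2)^o})]>.
  move=> S; rewrite rep; apply: (qrk_transfer (f := \1%VF) (H := fspan (edgev x y) setT)).
  - by move=> e; rewrite id_lfunE F2_addvv mem0v.
  - by move=> v /vlineP[a ->]; rewrite scaler0 linear0 mem0v.
  - by move=> e; apply: mem_fspan; rewrite inE.
  - by apply/subvP=> v /vlineP[a ->]; rewrite scaler0 mem0v.
  - move=> v vF; rewrite id_lfunE => /vlineP[a va]; move: vF; rewrite va [a]F2_natE.
    by case: (a != 0); rewrite ?scale1r ?(negPf kF) // scale0r memv_line.
apply: (degree_count cN rkN cogirth rep0); last by left.
by rewrite (eq_card (B := pred0)) ?card0 // => z; rewrite !inE ffunE eqxx.
Qed.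

End K6.

(** * Detecting PG(3,2) minus a line *)

Definition pg_comb (V : vectType 'F_2) (g1 g2 g3 g4 : V) (b1 b2 b3 b4 : bool) : V :=
  g1 *+ b1 + g2 *+ b2 + g3 *+ b3 + g4 *+ b4.

(* After contracting the vectors [ws], the available vectors [S] cover the
   complement of the line spanned by [g1] and [g2] in the projective space
   spanned by [g1], ..., [g4]. *)
Definition has_pg (V : vectType 'F_2) (K : {vspace V}) (S : V -> Prop) : Prop :=
  exists (ws : seq V) (g1 g2 g3 g4 : V),
    [/\ forall w, w \in ws -> S w,
        forall b1 b2 b3 b4, pg_comb g1 g2 g3 g4 b1 b2 b3 b4 \in (K + <<ws>>)%VS ->
          [/\ b1 = false, b2 = false, b3 = false & b4 = false] &
        forall b1 b2 b3 b4, b3 || b4 ->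
          exists2 z, S z & z + pg_comb g1 g2 g3 g4 b1 b2 b3 b4 \in (K + <<ws>>)%VS].

Lemma has_pg_sub (V : vectType 'F_2) (K : {vspace V}) (S S' : V -> Prop) :
  (forall v, S v -> S' v) -> has_pg K S -> has_pg K S'.
Proof.
move=> SS' [ws [g1 [g2 [g3 [g4 [wsS ind cov]]]]]].
exists ws, g1, g2, g3, g4; split=> // [w /wsS/SS'//|b1 b2 b3 b4 b34].
by have [z /SS' Sz zK] := cov b1 b2 b3 b4 b34; exists z.
Qed.

Lemma has_pg_contract (V : vectType 'F_2) (K : {vspace V}) (S : V -> Prop) ws :
  (forall w, w \in ws -> S w) -> has_pg (K + <<ws>>)%VS S -> has_pg K S.
Proof.
move=> wsS [ws' [g1 [g2 [g3 [g4 [wsS' ind cov]]]]]].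
exists (ws ++ ws'), g1, g2, g3, g4; rewrite span_cat addvA; split=> // w.
by rewrite mem_cat => /orP[/wsS|/wsS'].
Qed.

(** A configuration may be sought in a model space [V'] that has already absorbed [K], provided that
    each model vector agrees modulo [K] with an available one. *)
Lemma has_pg_transfer (V V' : vectType 'F_2) (f : 'Hom(V', V)) (H : {vspace V'})
    (K : {vspace V}) (S : V -> Prop) (S' : V' -> Prop) :
  (forall v, v \in H -> f v \in K -> v = 0) ->
  (forall v, S' v -> v \in H /\ exists2 z, S z & z + f v \in K) ->
  has_pg 0 S' -> has_pg K S.
Proof.
move=> kerf SS' [ws [g1 [g2 [g3 [g4 []]]]]]; rewrite add0v => wsS ind cov.
have wsH : (<<ws>> <= H)%VS by apply/span_subvP=> w /wsS/SS'[].
(* The points of the missing line are not covered, but each is a sum of two covered points, so they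
   too lie in [H]. *)
have gH b1 b2 b3 b4 : pg_comb g1 g2 g3 g4 b1 b2 b3 b4 \in H.
  have one b1' b2' b3' b4' : b3' || b4' -> pg_comb g1 g2 g3 g4 b1' b2' b3' b4' \in H.
    move=> b34; have [z /SS'[zH _] zw] := cov b1' b2' b3' b4' b34.
    have -> : pg_comb g1 g2 g3 g4 b1' b2' b3' b4' =
      z + (z + pg_comb g1 g2 g3 g4 b1' b2' b3' b4') by f2.
    by rewrite rpredD // (subvP wsH).
  have [b34|] := boolP (b3 || b4); first exact: one.
  rewrite negb_or => /andP[/negPf-> /negPf->].
  have -> : pg_comb g1 g2 g3 g4 b1 b2 false false =
      pg_comb g1 g2 g3 g4 b1 b2 true false + pg_comb g1 g2 g3 g4 false false true false.
    by rewrite /pg_comb; case: b1; case: b2; rewrite /= ?mulr0n ?mulr1n; f2.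
  by rewrite rpredD ?one.
have fcomb b1 b2 b3 b4 : f (pg_comb g1 g2 g3 g4 b1 b2 b3 b4) =
    pg_comb (f g1) (f g2) (f g3) (f g4) b1 b2 b3 b4.
  by rewrite /pg_comb !linearD /= !linearMn.
(* The contracted model vectors are replaced by available vectors that generate the same subspace
   modulo [K]. *)
have [zs zsS zsK] : exists2 zs : seq V, (forall z, z \in zs -> S z) &
    (K + <<zs>> = K + f @: <<ws>>)%VS.
  elim: ws wsS {ind cov wsH} => [|w ws IHws] wsS.
    by exists [::] => //; rewrite !span_nil limg0.
  have [zs zsS zsK] := IHws (fun u uw => wsS u (mem_behead (s := w :: ws) uw)).
  have [_ [z Sz zK]] := SS' w (wsS w (mem_head _ _)).
  exists (z :: zs) => [u|]; first by rewrite inE => /orP[/eqP->|/zsS].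
  rewrite !span_cons limgD limg_line !addvA ![(K + <[_]>)%VS]addvC -!addvA zsK.
  rewrite [LHS]addvC [RHS]addvC.
  have : (K <= K + f @: <<ws>>)%VS by apply: addvSl.
  move: (K + f @: <<ws>>)%VS => Q KQ.
  apply/eqP; rewrite eqEsubv; apply/andP; split; rewrite subv_add addvSl -memvE /=.
    have -> : z = (z + f w) + f w by f2.
    by rewrite memv_add ?memv_line // (subvP KQ).
  have -> : f w = (z + f w) + z by f2.
  by rewrite memv_add ?memv_line // (subvP KQ).
exists zs, (f g1), (f g2), (f g3), (f g4); rewrite zsK; split=> // [b1 b2 b3 b4|b1 b2 b3 b4 b34].
  rewrite -fcomb => /memv_addP[k kK [_ /memv_imgP[w ww ->] fE]].
  apply: ind; have : pg_comb g1 g2 g3 g4 b1 b2 b3 b4 + w = 0.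
    apply: kerf; first by rewrite rpredD // (subvP wsH).
    by rewrite linearD /= fE -addrA F2_addvv addr0.
  by move/eqP; rewrite addr_eq0 oppv_id => /eqP->.
have [v Sv vw] := cov b1 b2 b3 b4 b34; have [_ [z Sz zK]] := SS' v Sv.
exists z => //; rewrite -fcomb.
have -> : z + f (pg_comb g1 g2 g3 g4 b1 b2 b3 b4) =
    (z + f v) + f (v + pg_comb g1 g2 g3 g4 b1 b2 b3 b4) by rewrite [f (v + _)]linearD /=; f2.
by rewrite memv_add // memv_img.
Qed.

Lemma linear_add (V V' : vectType 'F_2) (f g : V -> V') :
  linear f -> linear g -> linear (fun v => f v + g v).
Proof. by move=> lf lg a u v; rewrite lf lg scalerDr addrACA. Qed.

Lemma linear_coord_scale (V V' : vectType 'F_2) n (X : n.-tuple V) i (p : 'End(V)) (g : V') :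
  linear (fun v => coord X i (p v) *: g).
Proof. by move=> a u v; rewrite !linearP /= scalerDl scalerA. Qed.

(** Coordinates are taken along the line [U] and a complement of it, with [U] sent to the span of
    [g1] and [g2]. A vector outside [U] has a nonzero third or fourth coordinate, which is exactly
    the covered case. *)
Lemma has_pg_minor (M : matroid) (V : vectType 'F_2) (c : ground M -> V) K
    (L : {set ground (PG 3)}) :
  PG_line L -> represents c K -> has_pg K (fun v => exists e, c e = v) ->
  has_minor M (delete L).
Proof.
case=> U [dU LU] repM [ws [g1 [g2 [g3 [g4 []]]]]]; set K' := (K + _)%VS.
move=> wsS ind cov.
have dUC : \dim U^C = 2%N by rewrite dimv_compl dU dimvf.
pose X := tcast dU (vbasis U); pose Y := tcast dUC (vbasis U^C).
have bX : basis_of U X by rewrite val_tcast; apply: vbasisP.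
have bY : basis_of U^C Y by rewrite val_tcast; apply: vbasisP.
pose i1 : 'I_2 := lift ord0 ord0.
pose q : 'End('rV['F_2]_4) := (\1%VF - projv U)%R.
have qE v : q v = v - projv U v by rewrite /q add_lfunE opp_lfunE id_lfunE.
pose om (v : 'rV['F_2]_4) : V :=
  coord X ord0 (projv U v) *: g1 + coord X i1 (projv U v) *: g2 +
  coord Y ord0 (q v) *: g3 + coord Y i1 (q v) *: g4.
have om_lin : linear om by do ![apply: linear_coord_scale | apply: linear_add].
have [f fE] := linear_hom om_lin.
pose b1 v := coord X ord0 (projv U v) != 0; pose b2 v := coord X i1 (projv U v) != 0.
pose b3 v := coord Y ord0 (q v) != 0; pose b4 v := coord Y i1 (q v) != 0.
have scaleE (a : 'F_2) (g : V) : a *: g = g *+ (a != 0).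
  by rewrite {1}[a]F2_natE scaler_nat.
have omE v : om v = pg_comb g1 g2 g3 g4 (b1 v) (b2 v) (b3 v) (b4 v).
  by rewrite /om !scaleE.
have coord0 (W : {vspace 'rV['F_2]_4}) (Z : 2.-tuple 'rV['F_2]_4) v :
    basis_of W Z -> v \in W -> coord Z ord0 v = 0 -> coord Z i1 v = 0 -> v = 0.
  move=> bZ vW z0 z1; rewrite (coord_basis bZ vW) !big_ord_recl big_ord0.
  by rewrite -/i1 z0 z1 !scale0r !addr0.
have qC v : q v \in (U^C)%VS by rewrite qE; apply: memv_projC.
have om_inj v : om v \in K' -> v = 0.
  rewrite omE => /ind[/negbFE/eqP c1 /negbFE/eqP c2 /negbFE/eqP c3 /negbFE/eqP c4].
  have := coord0 _ _ _ bX (memv_proj U v) c1 c2.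
  have := coord0 _ _ _ bY (qC v) c3 c4; rewrite qE => + p0.
  by rewrite p0 subr0.
have om_cov v : v \notin U -> exists e, c e + om v \in K'.
  move=> vU; have [|_ [e <-] eK] := cov (b1 v) (b2 v) (b3 v) (b4 v).
    apply: contraR vU; rewrite negb_or /b3 /b4 !negbK => /andP[/eqP c3 /eqP c4].
    have := coord0 _ _ _ bY (qC v) c3 c4; rewrite qE => /eqP.
    by rewrite subr_eq0 => /eqP->; apply: memv_proj.
  by exists e; rewrite omE.
have notU (p : ground (delete L)) : pg_vec p \notin U.
  by have := valP p; rewrite /= -LU.
have [h hE] := fin_all_exists (fun p => om_cov _ (notU p)).
pose C := [set e | c e \in ws].
have CK : (fspan c C + K = K')%VS.
  rewrite addvC /K'; congr (_ + _)%VS; apply/eqP; rewrite eqEsubv; apply/andP; split.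
    by apply: fspan_sub => e; rewrite inE => /memv_span.
  by apply/span_subvP=> w ww; have [e ce] := wsS w ww; rewrite -ce mem_fspan // inE ce.
apply/has_minorP; exists C, h; split.
- move=> p p' hpp; apply: pg_vec_inj; apply/eqP; rewrite -subr_eq0 oppv_id; apply/eqP.
  apply: om_inj; rewrite -fE linearD /= !fE.
  have -> : om (pg_vec p) + om (pg_vec p') =
    (c (h p) + om (pg_vec p)) + (c (h p) + om (pg_vec p')) by f2.
  by rewrite rpredD // hpp.
- move=> p; rewrite inE; apply/negP=> /memv_span chp.
  have := pg_vec_neq0 p; rewrite (om_inj (pg_vec p)) ?eqxx //.
  have -> : om (pg_vec p) = c (h p) + (c (h p) + om (pg_vec p)) by f2.
  by rewrite rpredD // (subvP (addvSr _ _)).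
move=> S; rewrite (minor_represents _ _ _ repM) CK pg_vec_represents.
apply: esym; apply: (qrk_transfer (f := f) (H := fullv)).
- by move=> p; rewrite fE hE.
- by move=> v; rewrite memv0 => /eqP->; rewrite linear0 mem0v.
- by move=> p; apply: memvf.
- exact: subvf.
- by move=> v _; rewrite fE memv0 => /om_inj->.
Qed.

Definition indv (J : finType) (Z : {set J}) : {ffun J -> ('F_2)^o} :=
  \sum_(j in Z) unitv j.

Lemma indv_enum (J : finType) (Z : {set J}) : indv Z = \sum_(j <- enum Z) unitv j.
Proof. by rewrite big_enum. Qed.

Lemma indvE (J : finType) (Z : {set J}) j : indv Z j = (j \in Z)%:R.
Proof.
rewrite /indv sum_ffunE; have [jZ|jZ] := boolP (j \in Z).
  rewrite (bigD1 j) //= ffunE eqxx big1 ?addr0 // => i /andP[_ ij].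
  by rewrite ffunE eq_sym (negPf ij).
rewrite big1 // => i iZ; rewrite ffunE; case: eqP => // ji.
by move: jZ; rewrite ji iZ.
Qed.

Lemma span_ker (V : vectType 'F_2) (f : 'Hom(V, ('F_2)^o)) ws v :
  (forall w, w \in ws -> f w = 0) -> v \in (0 + <<ws>>)%VS -> f v = 0.
Proof.
move=> fws; rewrite add0v => vws; apply/eqP; rewrite -memv_ker; apply: subvP vws.
by apply/span_subvP=> w /fws fw; rewrite memv_ker fw.
Qed.

Ltac pg_cover_case z :=
  first [ exists z; [by auto | rewrite /pg_comb /= ?mulr0n ?mulr1n;
    match goal with |- is_true (?e \in _) =>
      first [ (have -> : e = 0 by f2); exact: mem0v
            | match goal with H : is_true (?t \in _) |- _ =>
                (have -> : e = t by f2); exact: H end ] end] ].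

Section PointConfigurations.
Variables (V : vectType 'F_2) (K : {vspace V}) (S P : V -> Prop).
Hypothesis pairS : forall u v, P u -> P v -> S (u + v).

(* Six points summing to zero have 15 pairwise sums: all of PG(3,2). *)
Lemma has_pg_six (x1 x2 x3 x4 x5 x6 : V) ws :
  P x1 -> P x2 -> P x3 -> P x4 -> P x5 -> P x6 ->
  (forall w, w \in ws -> S w) ->
  x1 + x2 + x3 + x4 + x5 + x6 \in (K + <<ws>>)%VS ->
  (forall b1 b2 b3 b4,
    pg_comb (x1 + x5) (x2 + x5) (x3 + x5) (x4 + x5) b1 b2 b3 b4 \in (K + <<ws>>)%VS ->
    [/\ b1 = false, b2 = false, b3 = false & b4 = false]) ->
  has_pg K S.
Proof.
move=> P1 P2 P3 P4 P5 P6 wsS total ind.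
exists ws, (x1 + x5), (x2 + x5), (x3 + x5), (x4 + x5); split=> // b1 b2 b3 b4.
case: b1; case: b2; case: b3; case: b4 => // _.
- pg_cover_case (x5 + x6).
- pg_cover_case (x4 + x6).
- pg_cover_case (x3 + x6).
- pg_cover_case (x2 + x6).
- pg_cover_case (x1 + x3).
- pg_cover_case (x1 + x4).
- pg_cover_case (x1 + x6).
- pg_cover_case (x2 + x3).
- pg_cover_case (x2 + x4).
- pg_cover_case (x3 + x4).
- pg_cover_case (x3 + x5).
- pg_cover_case (x4 + x5).
Qed.

(* Two 4-circuits of terminals meeting in two terminals, with one free vertex. *)
Lemma has_pg_two_circuits (a b c d e f s : V) ws :
  P a -> P b -> P c -> P d -> P e -> P f -> P s ->
  (forall w, w \in ws -> S w) ->
  a + b + c + d \in (K + <<ws>>)%VS -> a + b + e + f \in (K + <<ws>>)%VS ->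
  (forall b1 b2 b3 b4,
    pg_comb (a + b) (a + s + c + e) (a + c) (a + e) b1 b2 b3 b4 \in (K + <<ws>>)%VS ->
    [/\ b1 = false, b2 = false, b3 = false & b4 = false]) ->
  has_pg K S.
Proof.
move=> Pa Pb Pc Pd Pe Pf Ps wsS Z Z' ind.
exists ws, (a + b), (a + s + c + e), (a + c), (a + e); split=> // b1 b2 b3 b4.
case: b1; case: b2; case: b3; case: b4 => // _.
- pg_cover_case (s + b).
- pg_cover_case (s + f).
- pg_cover_case (s + d).
- pg_cover_case (d + e).
- pg_cover_case (b + c).
- pg_cover_case (b + e).
- pg_cover_case (s + a).
- pg_cover_case (s + e).
- pg_cover_case (s + c).
- pg_cover_case (c + e).
- pg_cover_case (a + c).
- pg_cover_case (a + e).
Qed.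

(* Of the five 4-subsets of five points, three are present; the two missing ones
   lie on a common line. *)
Lemma has_pg_five (i j k l m : V) :
  P i -> P j -> P k -> P l -> P m ->
  S (i + j + l + m) -> S (i + j + k + m) -> S (i + j + k + l) ->
  (forall b1 b2 b3 b4,
    pg_comb (i + j) (i + k + l + m) (i + k) (i + l) b1 b2 b3 b4 \in (K + <<[::]>>)%VS ->
    [/\ b1 = false, b2 = false, b3 = false & b4 = false]) ->
  has_pg K S.
Proof.
move=> Pi Pj Pk Pl Pm Sk Sl Sm ind.
exists [::], (i + j), (i + k + l + m), (i + k), (i + l); split=> // b1 b2 b3 b4.
case: b1; case: b2; case: b3; case: b4 => // _.
- pg_cover_case (j + m).
- pg_cover_case (i + j + l + m).
- pg_cover_case (i + j + k + m).
- pg_cover_case (i + j + k + l).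
- pg_cover_case (j + k).
- pg_cover_case (j + l).
- pg_cover_case (i + m).
- pg_cover_case (l + m).
- pg_cover_case (k + m).
- pg_cover_case (k + l).
- pg_cover_case (i + k).
- pg_cover_case (i + l).
Qed.

End PointConfigurations.

Ltac split_ands :=
  repeat match goal with H : is_true (_ && _) |- _ => case/andP: H => ? ? end.
Ltac simpl_neqs :=
  repeat match goal with
  | H : is_true (?x != ?y) |- context [?x == ?y] => rewrite (negPf H)
  | H : is_true (?x != ?y) |- context [?y == ?x] => rewrite (eq_sym y x) (negPf H)
  | H : is_true (?x \notin ?s) |- context [?x \in ?s] => rewrite (negPf H)
  end; rewrite ?eqxx.

Lemma sum_pair_even (V : lmodType 'F_2) (I : Type) (v : V) (F : I -> V) (r : seq I) :
  ~~ odd (size r) -> \sum_(i <- r) (v + F i) = \sum_(i <- r) F i.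
Proof.
move=> ev; suff -> : \sum_(i <- r) (v + F i) = v *+ odd (size r) + \sum_(i <- r) F i.
  by rewrite (negPf ev) add0r.
elim: r {ev} => [|i r IHr]; first by rewrite !big_nil addr0.
rewrite !big_cons IHr /=; case: (odd _); rewrite /= ?mulr0n ?mulr1n; f2.
Qed.

(** * Even vertex sets of a complete graph *)

Section EvenSets.
Variables (J : finType) (S : {ffun J -> ('F_2)^o} -> Prop).
Hypothesis pairS : forall i j, S (unitv i + unitv j).

Let vtx (u : {ffun J -> ('F_2)^o}) : Prop := exists j, u = unitv j.
Let vtxS u v : vtx u -> vtx v -> S (u + v).
Proof. by move=> [i ->] [j ->]. Qed.
Let vtxI j : vtx (unitv j). Proof. by exists j. Qed.

Lemma label_hom (Q : pred J) :
  {f : 'Hom({ffun J -> ('F_2)^o}, ('F_2)^o) | forall j, f (unitv j) = (Q j)%:R}.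
Proof.
by have [f [_ fE]] := lincomb (fun j => (Q j)%:R : ('F_2)^o); exists f.
Qed.

(** Contract the set itself and merge every vertex beyond the fifth into the sixth. An odd number of
    vertices is merged, so six points with sum zero remain. *)
Lemma has_pg_large (Z : {set J}) :
  S (indv Z) -> ~~ odd #|Z| -> (6 <= #|Z|)%N -> has_pg 0 S.
Proof.
rewrite indv_enum cardE; have := enum_uniq Z.
case: (enum Z) => [|j1 [|j2 [|j3 [|j4 [|j5 [|j6 r]]]]]] //= uq SZ ev _.
rewrite !negbK in ev.
set z := (X in S X) in SZ; pose ws := z :: [seq unitv j6 + unitv j | j <- r].
have sumr : \sum_(j <- r) unitv j \in <<ws>>%VS.
  rewrite -(sum_pair_even (unitv j6)) //; rewrite big_seq; apply: rpred_sum => j jr.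
  apply: memv_span; rewrite inE; apply/orP; right.
  exact: (map_f (fun j => unitv j6 + unitv j)).
rewrite !inE !negb_or in uq; split_ands.
apply: (@has_pg_six _ 0 S vtx vtxS (unitv j1) (unitv j2) (unitv j3) (unitv j4)
   (unitv j5) (unitv j6) ws) => //.
- by move=> w; rewrite inE => /orP[/eqP->//|/mapP[j _ ->]].
- rewrite add0v; set tot := (X in X \in _).
  have -> : tot = z + \sum_(j <- r) unitv j.
    by rewrite /tot /z !big_cons /=; f2.
  by rewrite rpredD // memv_span // mem_head.
move=> b1 b2 b3 b4 mem.
(* The functional counts [i] and the merged vertices. It kills everything contracted, since it meets
   the even set evenly, and it therefore reads off the coefficient at [i]. *)
have value i : [&& i != j5, i != j6 & i \notin r] -> i \in [:: j1; j2; j3; j4] ->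
    ((i == j1) && b1) (+) ((i == j2) && b2) (+) ((i == j3) && b3) (+) ((i == j4) && b4)
    = false.
  move=> /and3P[i5 i6 ir] i4.
  have [f fE] := label_hom (fun j => (j == i) || (j \in j6 :: r)).
  have fr : f (\sum_(j <- r) unitv j) = 0.
    rewrite -(sum_pair_even (unitv j6)) // linear_sum big_seq big1 // => j jr.
    by rewrite linearD /= !fE !inE eqxx jr !orbT F2_addrr.
  have fz : f z = 0.
    rewrite /z !big_cons !linearD /= fr !fE !inE; simpl_neqs; rewrite ?orbT ?orbF.
    move: i4; rewrite !inE => /or4P[] /eqP ei; move: i5 i6 ir; rewrite ei => i5 i6 ir;
      by simpl_neqs; apply/val_inj.
  have /span_ker/(_ mem) : forall w, w \in ws -> f w = 0.
    move=> w; rewrite inE => /orP[/eqP->//|/mapP[j jr ->]].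
    by rewrite linearD /= !fE !inE eqxx jr !orbT F2_addrr.
  rewrite /pg_comb !linearD /= !linearMn !linearD /= !fE !inE; simpl_neqs.
  move: i4; rewrite !inE => /or4P[] /eqP ei; move: i5 i6 ir; rewrite ei => i5 i6 ir;
    by simpl_neqs; clear mem; case: b1; case: b2; case: b3; case: b4.
by split; [move: (value j1) | move: (value j2) | move: (value j3) | move: (value j4)];
  rewrite !inE; simpl_neqs; rewrite ?orbT ?addbF ?addFb /= => /(_ isT isT).
Qed.

Lemma natrF2_addb (a b : bool) : a%:R + b%:R = (a (+) b)%:R :> 'F_2.
Proof. by case: a; case: b; apply/val_inj. Qed.

Lemma natrF2_mulrb (a b : bool) : (a%:R : 'F_2) *+ b = (b && a)%:R.
Proof. by case: b. Qed.

Lemma natrF2_eq0 (a : bool) : (a%:R : 'F_2) = 0 -> a = false.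
Proof. by case: a. Qed.

(** The primed letters let one argument treat intersections of size 0, 1 and 2: contracting [a + a']
    and [b + b'] leads to two circuits through [a] and [b], and these vectors are zero when the
    letters agree. *)
Lemma has_pg_crossing_seq a b c d a' b' e f s :
  uniq [:: a; b; c; d; e; f; s] -> uniq [:: a'; b'; c; d; e; f; s] ->
  a' != b -> b' != a ->
  S (unitv a + unitv b + unitv c + unitv d) ->
  S (unitv a' + unitv b' + unitv e + unitv f) -> has_pg 0 S.
Proof.
move=> uq uq' a'b b'a SZ SZ'.
rewrite /= !inE !negb_or in uq; rewrite /= !inE !negb_or in uq'; split_ands.
pose ws := [:: unitv a + unitv b + unitv c + unitv d;
  unitv a' + unitv b' + unitv e + unitv f; unitv a + unitv a'; unitv b + unitv b'].
have wsW w : w \in ws -> w \in (0 + <<ws>>)%VS by rewrite add0v; apply: memv_span.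
apply: (@has_pg_two_circuits _ 0 S vtx vtxS (unitv a) (unitv b) (unitv c) (unitv d)
  (unitv e) (unitv f) (unitv s) ws) => //.
- by move=> w; rewrite !inE => /or4P[] /eqP->.
- by apply: wsW; rewrite mem_head.
- have -> : unitv a + unitv b + unitv e + unitv f =
    (unitv a' + unitv b' + unitv e + unitv f) + (unitv a + unitv a') + (unitv b + unitv b') by f2.
  by apply: rpredD; [apply: rpredD|]; apply: wsW; rewrite !inE eqxx ?orbT.
move=> b1 b2 b3 b4 mem.
(* A 0-1 labelling of the vertices that vanishes on all contracted vectors yields an equation in the
   coefficients. The four labellings chosen below eliminate the coefficients one by one. *)
have value (Q : pred J) :
    [/\ Q a (+) Q b (+) Q c (+) Q d = false, Q a' (+) Q b' (+) Q e (+) Q f = false,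
        Q a = Q a' & Q b = Q b'] ->
    (b1 && (Q a (+) Q b)) (+) (b2 && (Q a (+) Q s (+) Q c (+) Q e)) (+)
    (b3 && (Q a (+) Q c)) (+) (b4 && (Q a (+) Q e)) = false.
  case=> q1 q2 q3 q4; have [g gE] := label_hom Q.
  have /span_ker/(_ mem) : forall w, w \in ws -> g w = 0.
    move=> w; rewrite !inE => /or4P[] /eqP->; rewrite !linearD /= !gE !natrF2_addb.
    + by rewrite q1.
    + by rewrite q2.
    + by rewrite q3 addbb.
    + by rewrite q4 addbb.
  rewrite /pg_comb !linearD /= !linearMn !linearD /= !gE !natrF2_addb !natrF2_mulrb.
  by rewrite !natrF2_addb => /natrF2_eq0.
have := value (pred1 s); rewrite /=; simpl_neqs; rewrite /= ?andbF ?addbF ?andbT /= => /(_ _) v2.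
have {v2} b2F : b2 = false by apply: v2.
have := value (pred4 b b' d f); rewrite /=; simpl_neqs; rewrite /= ?orbT ?orbF ?andbF ?addbF ?andbT /= => /(_ _) v1.
have {v1} b1F : b1 = false by apply: v1.
have := value (pred2 c d); rewrite /=; simpl_neqs; rewrite /= ?orbT ?orbF ?andbF ?addbF ?andbT /= ?b2F ?b1F => /(_ _) v3.
have {v3} b3F : b3 = false by apply: v3.
have := value (pred2 e f); rewrite /=; simpl_neqs; rewrite /= ?orbT ?orbF ?andbF ?addbF ?andbT /= ?b2F ?b1F => /(_ _) v4.
have {v4} b4F : b4 = false by apply: v4.
by [].
Qed.

Lemma has_pg_five_sets i j k l m : uniq [:: i; j; k; l; m] ->
  S (unitv i + unitv j + unitv l + unitv m) ->
  S (unitv i + unitv j + unitv k + unitv m) ->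
  S (unitv i + unitv j + unitv k + unitv l) -> has_pg 0 S.
Proof.
rewrite /= !inE !negb_or => uq Sk Sl Sm; split_ands.
apply: (@has_pg_five _ 0 S vtx vtxS (unitv i) (unitv j) (unitv k) (unitv l) (unitv m)) => //.
move=> b1 b2 b3 b4 mem.
have value (Q : pred J) :
    (b1 && (Q i (+) Q j)) (+) (b2 && (Q i (+) Q k (+) Q l (+) Q m)) (+)
    (b3 && (Q i (+) Q k)) (+) (b4 && (Q i (+) Q l)) = false.
  have [g gE] := label_hom Q.
  have /span_ker/(_ mem) : forall w, w \in [::] -> g w = 0 by [].
  rewrite /pg_comb !linearD /= !linearMn !linearD /= !gE !natrF2_addb !natrF2_mulrb.
  by rewrite !natrF2_addb => /natrF2_eq0.
have := value (pred1 j); have := value (pred1 m); have := value (pred1 k).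
have := value (pred1 l); rewrite /=; simpl_neqs; clear mem value.
by case: b1; case: b2; case: b3; case: b4.
Qed.

End EvenSets.

Section EvenSetFamilies.
Variables (J : finType) (S : {ffun J -> ('F_2)^o} -> Prop).
Hypothesis pairS : forall i j, S (unitv i + unitv j).

Lemma indvU1 j (Z : {set J}) : j \notin Z -> indv (j |: Z) = unitv j + indv Z.
Proof. by move=> jZ; rewrite /indv big_setU1. Qed.

Lemma indvD1 j (Z : {set J}) : j \in Z -> indv (Z :\ j) = unitv j + indv Z.
Proof. by move=> jZ; rewrite [in RHS]/indv (big_setD1 j) //= -/(indv _); f2. Qed.

Lemma indv1 (j : J) : indv [set j] = unitv j.
Proof. by rewrite /indv big_set1. Qed.

Lemma has_pg_crossing (Z Z' : {set J}) s : S (indv Z) -> S (indv Z') ->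
  #|Z| = 4%N -> #|Z'| = 4%N -> s \notin Z -> s \notin Z' -> (#|Z :&: Z'| <= 2)%N ->
  has_pg 0 S.
Proof.
move=> SZ SZ' cZ cZ' sZ sZ'; rewrite cardE.
have iZ : indv Z = \sum_(j <- enum (Z :&: Z')) unitv j + \sum_(j <- enum (Z :\: Z')) unitv j.
  by rewrite !big_enum /indv (big_setID Z').
have iZ' : indv Z' = \sum_(j <- enum (Z :&: Z')) unitv j + \sum_(j <- enum (Z' :\: Z)) unitv j.
  by rewrite !big_enum /indv (big_setID Z) setIC.
have s1 : (size (enum (Z :&: Z')) + size (enum (Z :\: Z')) = 4)%N by rewrite -!cardE cardsID.
have s2 : (size (enum (Z :&: Z')) + size (enum (Z' :\: Z)) = 4)%N.
  by rewrite -!cardE setIC cardsID.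
have uq : uniq (s :: enum (Z :&: Z') ++ enum (Z :\: Z') ++ enum (Z' :\: Z)).
  rewrite /= !mem_cat !mem_enum !inE (negPf sZ) (negPf sZ') !andbF /=.
  rewrite !cat_uniq !enum_uniq !andbT /= ; apply/andP; split.
    apply/hasPn=> j; rewrite mem_cat !mem_enum !inE.
    by case: (j \in Z); case: (j \in Z').
  by apply/hasPn=> j; rewrite !mem_enum !inE; case: (j \in Z); case: (j \in Z').
rewrite iZ in SZ; rewrite iZ' in SZ'.
move: s1 s2 uq SZ SZ'.
case: (enum (Z :&: Z')) => [|i1 [|i2 []]] //.
- case: (enum (Z :\: Z')) => [|a [|b [|c [|d []]]]] //.
  case: (enum (Z' :\: Z)) => [|a' [|b' [|e [|f []]]]] // _ _.
  rewrite !big_cons !big_nil !add0r !addr0 !addrA => uq SZ SZ' _.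
  apply: (has_pg_crossing_seq pairS (s := s)) SZ SZ'; move: uq; rewrite /= !inE !negb_or => uq;
    split_ands; repeat (apply/andP; split); first [done | by rewrite eq_sym].
- case: (enum (Z :\: Z')) => [|b [|c [|d []]]] //.
  case: (enum (Z' :\: Z)) => [|b' [|e [|f []]]] // _ _.
  rewrite !big_cons !big_nil !addr0 !addrA => uq SZ SZ' _.
  apply: (has_pg_crossing_seq pairS (s := s)) SZ SZ'; move: uq; rewrite /= !inE !negb_or => uq;
    split_ands; repeat (apply/andP; split); first [done | by rewrite eq_sym].
case: (enum (Z :\: Z')) => [|c [|d []]] //.
case: (enum (Z' :\: Z)) => [|e [|f []]] // _ _.
rewrite !big_cons !big_nil !addr0 !addrA => uq SZ SZ' _.
apply: (has_pg_crossing_seq pairS (s := s)) SZ SZ'; move: uq; rewrite /= !inE !negb_or => uq;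
  split_ands; repeat (apply/andP; split); first [done | by rewrite eq_sym].
Qed.

Lemma has_pg_five_subsets (F : {set J}) k l m : #|F| = 5%N ->
  k \in F -> l \in F -> m \in F -> k != l -> k != m -> l != m ->
  S (indv (F :\ k)) -> S (indv (F :\ l)) -> S (indv (F :\ m)) -> has_pg 0 S.
Proof.
move=> cF kF lF mF kl km lm; rewrite !indvD1 //.
have /cards2P[i [j [ij FE]]] : #|F :\ k :\ l :\ m| == 2%N.
  have := cardsD1 k F; have := cardsD1 l (F :\ k); have := cardsD1 m (F :\ k :\ l).
  by rewrite !in_setD1 kF lF mF cF (eq_sym l) (eq_sym m) (eq_sym m) kl km lm /=; lia.
have iF : indv F = unitv k + (unitv l + (unitv m + (unitv i + unitv j))).
  rewrite /indv (big_setD1 k) // (big_setD1 l) ?in_setD1 1?eq_sym ?kl //=.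
  rewrite (big_setD1 m) ?in_setD1 /= ?mF; last by rewrite !(eq_sym m) lm km.
  by rewrite FE big_setU1 ?big_set1 // inE.
have Fmem z : z \in [set i; j] -> [&& z != m, z != l & z != k].
  by rewrite -FE !in_setD1 => /and4P[-> -> ->].
have /and3P[im il ik] := Fmem i (set21 _ _).
have /and3P[jm jl jk] := Fmem j (set22 _ _).
have -> : unitv k + indv F = unitv i + unitv j + unitv l + unitv m by rewrite iF; f2.
have -> : unitv l + indv F = unitv i + unitv j + unitv k + unitv m by rewrite iF; f2.
have -> : unitv m + indv F = unitv i + unitv j + unitv k + unitv l by rewrite iF; f2.
by apply: has_pg_five_sets; rewrite // /= !inE !negb_or ij ik il im jk jl jm kl km lm.
Qed.

End EvenSetFamilies.

(** * The common triple of terminals *)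

Section TerminalStructure.
Variables (J0 X Y : finType) (S : {ffun (J0 + bool)%type -> ('F_2)^o} -> Prop).
(** [Xs x] stands for the terminals whose sum is a [Y1] vector, which is only available added to a
    vertex and so must be odd; [Ys y] does the same for a [Y0] vector. The two vertices in [bool]
    lie outside all these sets: one completes an odd set to an even one, the other is the free
    vertex of the crossing argument. *)
Variables (Xs : X -> {set J0}) (Ys : Y -> {set J0}) (r0 : J0).
Let J : finType := (J0 + bool)%type.
Definition inlset (Z : {set J0}) : {set J} := [set (inl z : J) | z in Z].
Hypothesis pairS : forall i j, S (unitv i + unitv j).
Hypothesis oddX : forall x, odd #|Xs x|.
Hypothesis evenY : forall y, ~~ odd #|Ys y|.
Hypothesis SX : forall x j, S (unitv j + indv (inlset (Xs x))).
Hypothesis SY : forall y, S (indv (inlset (Ys y))).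
Hypothesis noPG : ~ has_pg 0 S.

Let s1 : J := inr true.
Let s2 : J := inr false.

Let inl_inj' : injective (inl : J0 -> J).
Proof. by move=> a b [->]. Qed.

Let card_inl Z : #|inlset Z| = #|Z|.
Proof. exact: card_imset. Qed.

Let in_inl z Z : (inl z \in inlset Z) = (z \in Z).
Proof. exact: mem_imset. Qed.

Let inr_inl b Z : (inr b \in inlset Z) = false.
Proof. by apply/negP=> /imsetP[z _]. Qed.

Let inlI Z Z' : inlset (Z :&: Z') = inlset Z :&: inlset Z'.
Proof. by apply: imsetI => a b _ _ /inl_inj'. Qed.

Let inlU1 z Z : inlset (z |: Z) = inl z |: inlset Z.
Proof. exact: imsetU1. Qed.

Let inlD1 z Z : inlset (Z :\ z) = inlset Z :\ inl z.
Proof.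
apply/setP=> -[w|b]; rewrite !inE ?inr_inl ?andbF // !in_inl !inE.
by rewrite (inj_eq inl_inj').
Qed.

Let cardX x : #|Xs x| = 1%N \/ #|Xs x| = 3%N.
Proof.
have := oddX x; have [le3|gt3] := leqP #|Xs x| 3.
  by move: le3; case: #|Xs x| => [|[|[|[|n]]]] //=; [left|right].
move=> ox; case: noPG; apply: (@has_pg_large _ S pairS (s1 |: inlset (Xs x))).
- by rewrite indvU1 ?inr_inl.
- by rewrite cardsU1 inr_inl card_inl /= ox.
- rewrite cardsU1 inr_inl card_inl; move: gt3 ox.
  by case: #|Xs x| => [|[|[|[|[|n]]]]].
Qed.

Let cardY y : (#|Ys y| <= 4)%N.
Proof.
rewrite leqNgt; apply/negP=> gt4; apply: noPG.
apply: (@has_pg_large _ S pairS (inlset (Ys y))); rewrite ?card_inl //.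
by move: gt4 (evenY y); case: #|Ys y| => [|[|[|[|[|[|n]]]]]].
Qed.

Let pairY y : #|Ys y| != 4%N -> exists i j, indv (Ys y) = unitv i + unitv j.
Proof.
move: (cardY y) (evenY y); rewrite indv_enum cardE.
case: (enum (Ys y)) => [|i [|j [|k [|l []]]]] //= _ _ _.
  by exists r0, r0; rewrite big_nil F2_addvv.
by exists i, j; rewrite !big_cons big_nil addr0.
Qed.

(* The 4-sets pairwise meet in three points and no three of them lie in a common
   5-set, so they all contain a common triple. *)
Lemma terminal_structure : exists p q s : J0,
  (forall x, (exists j, indv (Xs x) = unitv j) \/
             indv (Xs x) = unitv p + unitv q + unitv s) /\
  (forall y, (exists i j, indv (Ys y) = unitv i + unitv j) \/
             exists r, indv (Ys y) = unitv p + unitv q + unitv s + unitv r).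
Proof.
have crossing Z Z' s : S (indv Z) -> S (indv Z') -> #|Z| = 4%N -> #|Z'| = 4%N ->
    s \notin Z -> s \notin Z' -> (3 <= #|Z :&: Z'|)%N.
  move=> *; rewrite ltnNge; apply/negP=> le2; apply: noPG.
  exact: (has_pg_crossing pairS (Z := Z) (Z' := Z') (s := s)).
have single x : #|Xs x| = 1%N -> exists j, indv (Xs x) = unitv j.
  by move/eqP/cards1P=> [j ->]; exists j; rewrite indv1.
have triple (P : {set J0}) : #|P| = 3%N -> exists p q s, indv P = unitv p + unitv q + unitv s.
  rewrite indv_enum cardE; case: (enum P) => [|p [|q [|s []]]] // _.
  by exists p, q, s; rewrite !big_cons big_nil addr0 addrA.
have addone (P Z : {set J0}) : #|P| = 3%N -> #|Z| = 4%N -> P \subset Z ->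
    exists r, indv Z = indv P + unitv r.
  move=> cP cZ sPZ; have /cards1P[r rE] : #|Z :\: P| == 1%N.
    by have := cardsDS sPZ; rewrite cP cZ => ->.
  exists r; rewrite /indv (big_setID P) /= rE big_set1.
  by rewrite (setIidPr sPZ).
have finish (P : {set J0}) : #|P| = 3%N -> (forall x, #|Xs x| = 1%N \/ Xs x = P) ->
    (forall y, #|Ys y| = 4%N -> P \subset Ys y) -> exists p q s : J0,
    (forall x, (exists j, indv (Xs x) = unitv j) \/
               indv (Xs x) = unitv p + unitv q + unitv s) /\
    (forall y, (exists i j, indv (Ys y) = unitv i + unitv j) \/
               exists r, indv (Ys y) = unitv p + unitv q + unitv s + unitv r).
  move=> cP hX hY; have [p [q [s Ppqs]]] := triple P cP; exists p, q, s.
  split=> [x|y]; first by case: (hX x) => [/single|->]; [left|right].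
  case: (eqVneq #|Ys y| 4%N) => [c4|/pairY]; [right|by left].
  by have [r ->] := addone P (Ys y) cP c4 (hY y c4); exists r; rewrite Ppqs.
have [no3|] := boolP [forall x, #|Xs x| != 3%N]; last first.
  rewrite negb_forall => /existsP[x0]; rewrite negbK => /eqP c3.
  have SZ x : S (indv (s1 |: inlset (Xs x))) by rewrite indvU1 ?inr_inl.
  have cZ x : #|Xs x| = 3%N -> #|s1 |: inlset (Xs x)| = 4%N.
    by move=> c; rewrite cardsU1 inr_inl card_inl c.
  have s2Z Z : s2 \notin s1 |: inlset Z by rewrite !inE inr_inl.
  apply: (finish (Xs x0)) => // [x|y c4].
    case: (cardX x) => c; [by left|right]; apply/eqP; apply/negPn/negP=> ne.
    have := crossing _ _ _ (SZ x0) (SZ x) (cZ _ c3) (cZ _ c) (s2Z _) (s2Z _).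
    rewrite -setUIr -inlI cardsU1 inr_inl card_inl /= => I2.
    have cU := cardsUI (Xs x0) (Xs x).
    have I3 : (#|Xs x0 :&: Xs x| < 3)%N.
      rewrite ltnNge; apply: contra ne => ge3.
      have /eqP e1 : Xs x0 :&: Xs x == Xs x0 by rewrite eqEcard subsetIl c3.
      have /eqP e2 : Xs x0 :&: Xs x == Xs x by rewrite eqEcard subsetIr c.
      by apply/eqP; exact: etrans (esym e2) e1.
    have cD (A B : {set J0}) : #|A| = 3%N -> #|A :&: B| = 2%N -> exists2 a, a \in A & a \notin B.
      move=> cA cAB; have : (0 < #|A :\: B|)%N by have := cardsID B A; lia.
      by case/card_gt0P=> a; rewrite inE => /andP[aB aA]; exists a.
    have [a a0 a1] : exists2 a, a \in Xs x0 & a \notin Xs x by apply: cD => //; lia.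
    have [b b1 b0] : exists2 b, b \in Xs x & b \notin Xs x0.
      by apply: cD => //; rewrite setIC; lia.
    have UE : a |: Xs x = Xs x0 :|: Xs x.
      apply/eqP; rewrite eqEcard subUset sub1set inE a0 subsetUr /= cardsU1 a1 c; lia.
    have UE' : b |: Xs x0 = Xs x0 :|: Xs x.
      apply/eqP; rewrite eqEcard subUset sub1set inE b1 orbT subsetUl /= cardsU1 b0 c3; lia.
    (* Two distinct triples meet in two points, and dropping [s1], [a] or [b] from this 5-set gives
       an available 4-set each time. *)
    pose F := s1 |: inlset (Xs x0 :|: Xs x); apply: noPG.
    have s1F : s1 \notin inlset (Xs x0 :|: Xs x) by rewrite inr_inl.
    apply: (@has_pg_five_subsets _ S pairS F s1 (inl a) (inl b)).
    + by rewrite cardsU1 s1F card_inl; lia.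
    + by rewrite setU11.
    + by rewrite !inE in_inl inE a0.
    + by rewrite !inE in_inl inE b1 orbT.
    + by [].
    + by [].
    + by rewrite (inj_eq inl_inj'); apply: contraNneq a1 => ->.
    + by rewrite setU1K // -UE inlU1 indvU1 ?in_inl.
    + have -> : F :\ inl a = s1 |: inlset (Xs x).
        apply/setP=> -[z|[]]; rewrite !inE ?inr_inl //= ?in_inl -UE !inE.
        by rewrite (inj_eq inl_inj'); case: (eqVneq z a) => [->|] //=; rewrite (negPf a1).
      exact: SZ.
    have -> : F :\ inl b = s1 |: inlset (Xs x0).
      apply/setP=> -[z|[]]; rewrite !inE ?inr_inl //= ?in_inl -UE' !inE.
      by rewrite (inj_eq inl_inj'); case: (eqVneq z b) => [->|] //=; rewrite (negPf b0).
    exact: SZ.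
  have s2Y : s2 \notin inlset (Ys y) by rewrite inr_inl.
  have := crossing _ _ _ (SZ x0) (SY y) (cZ _ c3) _ (s2Z _) s2Y.
  rewrite card_inl => /(_ c4); rewrite setIUl.
  have -> : [set s1] :&: inlset (Ys y) = set0.
    by apply/setP=> z; rewrite !inE; case: eqP => // ->; rewrite inr_inl.
  rewrite set0U -inlI card_inl => I3; apply/setIidPl/eqP.
  by rewrite eqEcard subsetIl c3.
have X1 x : #|Xs x| = 1%N by case: (cardX x) => // c; have := forallP no3 x; rewrite c.
have [no4|] := boolP [forall y, #|Ys y| != 4%N].
  (* Nothing refers to the triple in this case, so its members are arbitrary. *)
  exists r0, r0, r0; split=> [x|y]; left; first exact: single.
  by apply: pairY; apply: (forallP no4).
rewrite negb_forall => /existsP[y0]; rewrite negbK => /eqP c0.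
have cross4 y y' : #|Ys y| = 4%N -> #|Ys y'| = 4%N -> (3 <= #|Ys y :&: Ys y'|)%N.
  move=> c c'; rewrite -card_inl inlI.
  by apply: (crossing _ _ s1); rewrite ?card_inl ?inr_inl.
(* If there is only one 4-set, any three of its elements serve as the triple. *)
have [all0|] := boolP [forall y, (#|Ys y| == 4%N) ==> (Ys y == Ys y0)].
  have /card_gt0P[r rY] : (0 < #|Ys y0|)%N by rewrite c0.
  apply: (finish (Ys y0 :\ r)) => [|x|y c4]; last 1 first.
  - have := forallP all0 y; rewrite c4 /= => /eqP->; exact: subsetDl.
  - by have := cardsD1 r (Ys y0); rewrite rY c0 => -[].
  - by left.
rewrite negb_forall => /existsP[y1]; rewrite negb_imply => /andP[/eqP c1 ne].
have I3 := cross4 _ _ c0 c1; have cU := cardsUI (Ys y0) (Ys y1).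
have I4 : (#|Ys y0 :&: Ys y1| < 4)%N.
  rewrite ltnNge; apply: contra ne => ge4.
  have /eqP e1 : Ys y0 :&: Ys y1 == Ys y0 by rewrite eqEcard subsetIl c0.
  have /eqP e2 : Ys y0 :&: Ys y1 == Ys y1 by rewrite eqEcard subsetIr c1.
  by apply/eqP; exact: etrans (esym e2) e1.
(* Two distinct 4-sets determine the triple. A 4-set that misses a point [e] of it would be their
   5-element union without [e], a third 4-subset of that union. *)
apply: (finish (Ys y0 :&: Ys y1)) => [|x|y c4]; [lia|by left|].
apply/negPn/negP=> /subsetPn[e]; rewrite inE => /andP[e0 e1] eY.
have cD (A B : {set J0}) : #|A| = 4%N -> (#|A :&: B| < 4)%N -> exists2 a, a \in A & a \notin B.
  move=> cA cAB; have : (0 < #|A :\: B|)%N by have := cardsID B A; lia.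
  by case/card_gt0P=> a; rewrite inE => /andP[aB aA]; exists a.
have [a a0 a1] := cD _ _ c0 I4.
have [b b1 b0] : exists2 b, b \in Ys y1 & b \notin Ys y0 by apply: cD; rewrite // setIC.
pose U := Ys y0 :|: Ys y1; have c5 : #|U| = 5%N by rewrite /U; lia.
have eU : e \in U by rewrite inE e0.
have drop1 (A : {set J0}) c : #|A| = 4%N -> A \subset U -> c \in U -> c \notin A -> U :\ c = A.
  move=> cA sA cU' cA'; apply/esym/eqP; rewrite eqEcard cA.
  have := cardsD1 c U; rewrite cU' c5 => -[]; rewrite add0n => <-; rewrite leqnn andbT.
  by rewrite subsetD1 sA.
have sub y' : #|Ys y'| = 4%N -> e \in Ys y' -> Ys y' :\ e \subset Ys y.
  move=> c' e'; have := cross4 _ _ c' c4 => le.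
  have /eqP <- : Ys y' :&: Ys y == Ys y' :\ e; last by apply: subsetIr.
  rewrite eqEcard; have := cardsD1 e (Ys y'); rewrite e' c' => -[]; rewrite add0n => <-; rewrite le andbT.
  by rewrite subsetD1 subsetIl inE (negPf eY) andbF.
have YE : Ys y = U :\ e.
  apply/esym/eqP; rewrite eqEcard; have := cardsD1 e U; rewrite eU c5 => -[]; rewrite add0n => <-.
  by rewrite c4 leqnn andbT /U setDUl subUset !sub.
apply: noPG; apply: (@has_pg_five_subsets _ S pairS (inlset U) (inl e) (inl a) (inl b)).
- by rewrite card_inl.
- by rewrite in_inl.
- by rewrite in_inl inE a0.
- by rewrite in_inl inE b1 orbT.
- by rewrite (inj_eq inl_inj'); apply: contraNneq a1 => <-.
- by rewrite (inj_eq inl_inj'); apply: contraNneq b0 => <-.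
- by rewrite (inj_eq inl_inj'); apply: contraNneq a1 => ->.
- by rewrite -inlD1 -YE.
- by rewrite -inlD1 (drop1 (Ys y1)) ?subsetUr // inE a0.
- by rewrite -inlD1 (drop1 (Ys y0)) ?subsetUl // inE b1 orbT.
Qed.

End TerminalStructure.

(** * Templates *)

Section UniversalConforming.
Variables (Phi : template) (I : finType) (delta : I -> {ffun tcol Phi -> 'F_2}).
Hypothesis deltaP : forall i, delta i \in tDelta Phi.

Definition rowT : finType := (tX Phi + I)%type.
Definition frameT : finType := ({ffun tX Phi -> 'F_2} * {ffun I -> 'F_2})%type.
Definition colT : finType := (tcol Phi + frameT + I * tY1 Phi)%type.

Definition weight (f : {ffun I -> ('F_2)^o}) : nat := #|[set i | f i != 0%R]|.

Definition frame_ok (lf : frameT) : bool :=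
  (lf.1 \in tLambda Phi) && (weight lf.2 <= 2)%N.

Definition univ' : bmatrix rowT colT := fun b e =>
  match e, b with
  | inl (inl y), inl x => tA1 x y
  | inl (inl y), inr i => delta i y
  | inl (inr lf), inl x => if frame_ok lf then lf.1 x else 0
  | inl (inr lf), inr i => if frame_ok lf then lf.2 i else 0
  | inr iy, inl x => 0
  | inr iy, inr i => (i == iy.1)%:R
  end.

Definition univ : bmatrix rowT colT := fun b e =>
  if e is inr iy then univ' b e + univ' b (inl (inl (inl (inr iy.2)))) else univ' b e.

Definition univX (x : tX Phi) : rowT := inl x.
Definition univY (y : tcol Phi) : colT := inl (inl y).

Lemma in_Xset (b : rowT) : (b \in Xset univX) = (if b is inl _ then true else false).
Proof.
case: b => [x|i]; first by apply/imsetP; exists x.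
by apply/negP=> /imsetP[].
Qed.

Lemma in_YCset (e : colT) :
  (e \in YCset univY) = (if e is inl (inl _) then true else false).
Proof.
case: e => [[y|lf]|iy]; first by apply/imsetP; exists y.
  by apply/negP=> /imsetP[].
by apply/negP=> /imsetP[].
Qed.

Lemma univ_conforms : matrix_conforms univX univY univ.
Proof.
pose Z : {set colT} := [set e | if e is inr _ then true else false].
exists univ', Z; split; first split.
- by [].
- by apply/subsetP=> -[[y|lf]|iy]; rewrite !inE // in_YCset.
- by move=> [x|i] [[y|lf]|iy]; rewrite in_Xset // inE.
- case=> [[y|lf]|[i y]]; rewrite inE // => _; rewrite /lower_weight.
  transitivity #|[set (inr i : rowT)]|; last by rewrite cards1.
  apply: eq_card => -[x|j]; rewrite !inE in_Xset //=.
  by rewrite -[inr j == inr i :> rowT]/(j == i); case: (j == i).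
- case=> [[y|[l f]]|iy]; rewrite !inE ?in_YCset // => _; rewrite /lower_weight.
  have [ok|nok] := boolP (frame_ok (l, f)); last first.
    rewrite (_ : [set b in _ | _] = set0) ?cards0 //; apply/setP=> -[x|i].
      by rewrite !inE in_Xset.
    by rewrite !inE in_Xset /= (negPf nok) eqxx.
  have /andP[_ wt] := ok; apply: leq_trans wt.
  have injr : injective (inr : I -> rowT) by move=> i j [->].
  rewrite /weight -(card_imset _ injr); apply: subset_leq_card; apply/subsetP=> -[x|i].
    by rewrite !inE in_Xset.
  by rewrite !inE in_Xset /= ok => fi; apply: imset_f; rewrite inE.
- case=> [[y|[l f]]|iy]; rewrite !inE ?in_YCset // => _.
  have [ok|nok] := boolP (frame_ok (l, f)).
    have /andP[lL _] := ok; rewrite (_ : [ffun _ => _] = l) //.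
    by apply/ffunP=> x; rewrite ffunE /= ok.
  rewrite (_ : [ffun _ => _] = 0); first by have [] := tLambda_subgroup Phi.
  by apply/ffunP=> x; rewrite !ffunE /= (negPf nok).
- case=> [x|i]; rewrite !inE in_Xset // => _.
  by rewrite (_ : [ffun _ => _] = delta i) //; apply/ffunP=> y; rewrite ffunE.
- by move=> b [[y|lf]|iy]; rewrite inE.
- case=> [[y|lf]|[i y]]; rewrite inE // => _.
  by exists (inl (inl (inl (inr y)))) => //; apply/imsetP; exists y.
Qed.

Definition vecXI (l : {ffun tX Phi -> ('F_2)^o}) (f : {ffun I -> ('F_2)^o}) :
    {ffun rowT -> ('F_2)^o} :=
  [ffun b => match b with inl x => l x | inr i => f i end].

Definition colA1 (y : tcol Phi) : {ffun tX Phi -> ('F_2)^o} := [ffun x => tA1 x y].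

Definition colY (y : tcol Phi) : {ffun rowT -> ('F_2)^o} :=
  vecXI (colA1 y) [ffun i => delta i y].

(** A bare [Y1] column is missing here because it is deleted; only its sums with unit vectors
    survive. *)
Definition univ_avail (v : {ffun rowT -> ('F_2)^o}) : Prop :=
  [\/ exists (l : {ffun tX Phi -> ('F_2)^o}) f, [/\ l \in tLambda Phi, (weight f <= 2)%N & v = vecXI l f],
      exists y : tY0 Phi, v = colY (inl (inl y)) |
      exists i (y : tY1 Phi), v = vecXI 0 (unitv i) + colY (inl (inr y))].

Definition univ_matroid : matroid :=
  @contract_delete (vector_matroid univ) (Cset univY) (Y1set univY).

Definition univ_vec (x : ground univ_matroid) : {ffun rowT -> ('F_2)^o} :=
  mxcol univ (out_val (out_val x)).

Lemma univ_matroid_conforms : conforms Phi univ_matroid.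
Proof.
exists rowT, colT, univX, univY, univ; split.
- by move=> x x' [].
- by move=> y y' [].
- exact: univ_conforms.
- by exists id; split; [exists id | move=> S; rewrite imset_id].
Qed.

Lemma mxcol_univY y : mxcol univ (univY y) = colY y.
Proof. by apply/ffunP=> -[x|i]; rewrite !ffunE. Qed.

Lemma univ_vec_represents :
  represents univ_vec (fspan (fun c : tC Phi => colY (inr c)) setT).
Proof.
have -> : fspan (fun c : tC Phi => colY (inr c)) setT = (fspan (mxcol univ) (Cset univY) + 0)%VS.
  rewrite addv0; apply/eqP; rewrite eqEsubv; apply/andP; split; apply: fspan_sub.
    by move=> c _; rewrite -mxcol_univY mem_fspan //; apply/imsetP; exists c.
  by move=> _ /imsetP[c _ ->]; rewrite mxcol_univY (mem_fspan (fun c => colY (inr c))) ?inE.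
apply: (@contract_delete_represents (vector_matroid univ)).
exact: vector_matroid_represents.
Qed.

Lemma univ_vec_avail v : univ_avail v -> exists x, univ_vec x = v.
Proof.
have elt (e : colT) : e \notin Cset univY -> e \notin Y1set univY ->
    exists x : ground univ_matroid, univ_vec x = mxcol univ e.
  move=> eC eY; have eY' : (Sub e eC : {x : colT | x \notin Cset univY}) \notin
      [set x : @outside (vector_matroid univ) (Cset univY) | out_val x \in Y1set univY].
    by rewrite inE.
  by exists (Sub (Sub e eC : {x : colT | x \notin Cset univY}) eY').
case=> [[l [f [lL wf ->]]]|[y ->]|[i [y ->]]].
- have [||x xE] := elt (inl (inr (l, f))).
  + by apply/negP=> /imsetP[].
  + by apply/negP=> /imsetP[].
  exists x; rewrite xE; apply/ffunP=> -[z|j]; rewrite !ffunE /= /frame_ok /= lL wf //.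
- have [||x xE] := elt (univY (inl (inl y))).
  + by apply/negP=> /imsetP[].
  + by apply/negP=> /imsetP[].
  by exists x; rewrite xE mxcol_univY.
have [||x xE] := elt (inr (i, y)).
- by apply/negP=> /imsetP[].
- by apply/negP=> /imsetP[].
exists x; rewrite xE; apply/ffunP=> -[z|j]; rewrite !ffunE /= ?ffunE //.
Qed.

Lemma univ_has_pg_minor (L : {set ground (PG 3)}) : PG_line L ->
  has_pg (fspan (fun c : tC Phi => colY (inr c)) setT) univ_avail ->
  exists2 M, conforms Phi M & has_minor M (delete L).
Proof.
move=> hL pg; exists univ_matroid; first exact: univ_matroid_conforms.
by apply: has_pg_minor hL univ_vec_represents (has_pg_sub univ_vec_avail pg).
Qed.

End UniversalConforming.

Section VecXI.
Variables (Phi : template) (I : finType).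
Implicit Types (l : {ffun tX Phi -> ('F_2)^o}) (f : {ffun I -> ('F_2)^o}).

Lemma vecXID l l' f f' : vecXI l f + vecXI l' f' = vecXI (l + l') (f + f').
Proof. by apply/ffunP=> -[x|i]; rewrite !ffunE. Qed.

Lemma vecXI0 : vecXI 0 0 = 0 :> {ffun rowT Phi I -> ('F_2)^o}.
Proof. by apply/ffunP=> -[x|i]; rewrite !ffunE. Qed.

Lemma vecXI_sum (E : finType) (D : {set E}) (l : E -> _) (f : E -> _) :
  \sum_(e in D) vecXI (l e) (f e) =
  vecXI (\sum_(e in D) l e) (\sum_(e in D) f e) :> {ffun rowT Phi I -> ('F_2)^o}.
Proof.
apply: (big_ind3 (fun u v w => u = vecXI v w)) => //; first by rewrite vecXI0.
by move=> _ l1 f1 _ l2 f2 -> ->; rewrite vecXID.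
Qed.

Lemma weightD f f' : (weight (f + f')%R <= weight f + weight f')%N.
Proof.
apply: leq_trans (_ : #|[set i | f i != 0%R] :|: [set i | f' i != 0%R]| <= _)%N.
  apply: subset_leq_card; apply/subsetP=> i; rewrite !inE ffunE.
  by apply: contraR; rewrite negb_or !negbK => /andP[/eqP-> /eqP->]; rewrite addr0.
by rewrite cardsU leq_subr.
Qed.

Lemma weight_unitv (i : I) : (weight (unitv i) <= 1)%N.
Proof.
apply: leq_trans (_ : #|[set i]| <= _)%N; last by rewrite cards1.
apply: subset_leq_card; apply/subsetP=> j; by rewrite !inE ffunE; case: (j == i).
Qed.

Lemma weight0 : weight (0 : {ffun I -> ('F_2)^o}) = 0%N.
Proof. by apply: eq_card0 => i; rewrite !inE ffunE eqxx. Qed.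

End VecXI.

Lemma basis_mod (T : finType) (V : vectType 'F_2) (a : T -> V) (K : {vspace V}) :
  exists (I : finType) (f : I -> T),
    (forall D : {set I}, \sum_(i in D) a (f i) \in K -> D = set0) /\
    (forall t, exists D : {set I}, a t + \sum_(i in D) a (f i) \in K).
Proof.
pose indep (A : {set T}) := [forall D : {set T},
  (D \subset A) && (\sum_(t in D) a t \in K) ==> (D == set0)].
have indep0 : indep set0.
  by apply/forallP=> D; apply/implyP=> /andP[]; rewrite subset0.
case: (arg_maxnP (fun A : {set T} => #|A|) indep0) => A indA maxA.
pose f (x : {t | t \in A}) := val x.
have finj : injective f by apply: val_inj.
exists {t | t \in A}, f; split=> [D sumD|t].
  have /implyP := forallP indA (f @: D); rewrite big_imset /=; last by move=> ? ? _ _ /finj.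
  rewrite sumD andbT imset_eq0 => h; apply/eqP/h/subsetP=> _ /imsetP[x _ ->].
  exact: (valP x).
have [tA|tA] := boolP (t \in A).
  by exists [set Sub t tA]; rewrite big_set1 F2_addvv mem0v.
have : ~~ indep (t |: A).
  apply/negP=> /maxA le; have : (#|t |: A| <= #|A|)%N := le.
  by rewrite cardsU1 tA add1n ltnn.
rewrite negb_forall => /existsP[D]; rewrite negb_imply => /andP[/andP[sD sumD] Dn0].
have tD : t \in D.
  apply: contraR Dn0 => tD; have /implyP := forallP indA D; apply; rewrite sumD andbT.
  by apply/subsetP=> u uD; have := subsetP sD u uD; rewrite !inE; case: eqP => // ut; rewrite -ut uD in tD.
exists [set x | f x \in D :\ t].
rewrite (_ : \sum_(i in _) _ = \sum_(u in D :\ t) a u); first by rewrite -(big_setD1 t).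
rewrite -(big_imset a) /=; last by move=> ? ? _ _ /finj.
apply: eq_bigl => u; apply/imsetP/idP => [[x]|uD]; first by rewrite inE => ? ->.
have uA : u \in A.
  by move: uD; rewrite in_setD1 => /andP[ut /(subsetP sD)]; rewrite !inE (negPf ut).
by exists (Sub u uA); rewrite // inE.
Qed.

(** * Lambda and Delta of a template avoiding PG(3,2) minus a line *)

Section TemplateFacts.
Variables (L : {set ground (PG 3)}) (Phi : template).
Hypothesis hL : PG_line L.
Hypothesis noPG : forall M, conforms Phi M -> ~ has_minor M (delete L).

Lemma Delta0 : 0 \in tDelta Phi.
Proof. by have [] := tDelta_subgroup Phi. Qed.

Lemma Lambda0 : (0 : {ffun tX Phi -> ('F_2)^o}) \in tLambda Phi.
Proof. by have [] := tLambda_subgroup Phi. Qed.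

Lemma univ_no_pg (I : finType) (delta : I -> {ffun tcol Phi -> 'F_2}) :
  (forall i, delta i \in tDelta Phi) ->
  ~ has_pg (fspan (fun c : tC Phi => colY delta (inr c)) setT) (univ_avail delta).
Proof.
by move=> dP pg; have [M cM mM] := univ_has_pg_minor dP hL pg; apply: (noPG cM mM).
Qed.

(* Otherwise contracting the columns in [s] together with an element carrying
   their Lambda-part contracts the sum of five rows, leaving PG(3,2). *)
Lemma Delta_orth (s : {set tcol Phi}) (d : {ffun tcol Phi -> 'F_2}) :
  d \in tDelta Phi -> \sum_(y in s) colA1 y \in tLambda Phi -> \sum_(y in s) d y = 0.
Proof.
move=> dD lL; apply/eqP/negPn/negP=> dn0.
have d1 : \sum_(y in s) d y = 1 by rewrite [LHS]F2_natE dn0.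
(* Five rows repeat the vector [d]. The zero row of each [Y1] element supplies a unit vector, so
   that its deleted column can be recovered as a sum of two available vectors. *)
pose I : finType := ('I_5 + tY1 Phi)%type.
pose delta (i : I) : {ffun tcol Phi -> 'F_2} := if i is inl _ then d else 0.
have deltaP i : delta i \in tDelta Phi by case: i => [i|y] //=; apply: Delta0.
apply: (univ_no_pg deltaP).
pose e (i : I) : {ffun rowT Phi I -> ('F_2)^o} := vecXI 0 (unitv i).
set K := fspan _ _.
pose w0 := [seq colY delta (inl (inl y)) | y <- enum (tY0 Phi)].
pose w1 := [seq e (inr y) | y <- enum (tY1 Phi)].
pose w2 := [seq e (inr y) + colY delta (inl (inr y)) | y <- enum (tY1 Phi)].
pose lam : {ffun tX Phi -> ('F_2)^o} := \sum_(y in s) colA1 y.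
(* This puts every template column into the contracted space; together with [lam] it also puts there
   the sum of the five unit vectors, so these and 0 are six points with sum zero. *)
pose ws := vecXI lam 0 :: w0 ++ w1 ++ w2.
have wsW w : w \in ws -> w \in (K + <<ws>>)%VS.
  by move=> /memv_span; apply: (subvP (addvSr _ _)).
have in0 y : colY delta (inl (inl y)) \in w0 by apply/mapP; exists y; rewrite ?mem_enum.
have in1 y : e (inr y) \in w1 by apply/mapP; exists y; rewrite ?mem_enum.
have in2 y : e (inr y) + colY delta (inl (inr y)) \in w2.
  by apply/mapP; exists y; rewrite ?mem_enum.
have colW y : colY delta y \in (K + <<ws>>)%VS.
  case: y => [[y|y]|c].
  - by apply: wsW; rewrite inE !mem_cat in0 orbT.
  - have -> : colY delta (inl (inr y)) = e (inr y) + (e (inr y) + colY delta (inl (inr y))) by f2.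
    apply: rpredD; apply: wsW; rewrite inE !mem_cat.
      by rewrite in1 !orbT.
    by rewrite in2 !orbT.
  apply: (subvP (addvSl _ _)); exact: (mem_fspan (fun c => colY delta (inr c))).
pose P (u : {ffun rowT Phi I -> ('F_2)^o}) : Prop :=
  exists2 f : {ffun I -> ('F_2)^o}, (weight f <= 1)%N & u = vecXI 0 f.
have pairS u v : P u -> P v -> univ_avail delta (u + v).
  move=> [f wf ->] [g wg ->]; constructor 1; exists 0, (f + g); split.
  - exact: Lambda0.
  - by apply: leq_trans (weightD _ _) _; lia.
  - by rewrite vecXID addr0.
have Pe i : P (e i) by exists (unitv i) => //; apply: weight_unitv.
have P0 : P 0 by exists 0; rewrite ?weight0 // vecXI0.
pose o k (lt : (k < 5)%N) : I := inl (Ordinal lt).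
apply: (@has_pg_six _ K _ P pairS (e (o 0 isT)) (e (o 1 isT)) (e (o 2 isT))
  (e (o 3 isT)) (e (o 4 isT)) 0 ws) => //.
- move=> w; rewrite inE !mem_cat => /orP[/eqP->|/or3P[] /mapP[y _ ->]].
  + by constructor 1; exists lam, 0; rewrite weight0.
  + by constructor 2; exists y.
  + constructor 1; exists 0, (unitv (inr y)); split=> //; first exact: Lambda0.
    by apply: leq_trans (weight_unitv _) _.
  + by constructor 3; exists (inr y), y.
- rewrite addr0 [X in X \in _](_ : _ = vecXI lam 0 + \sum_(y in s) colY delta y).
    by rewrite rpredD ?rpred_sum ?wsW ?mem_head.
  rewrite vecXI_sum vecXID -/lam F2_addvv add0r /e !vecXID !addr0; congr vecXI.
  apply/ffunP=> i; rewrite sum_ffunE.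
  under eq_bigr do rewrite ffunE.
  case: i => [i|y]; last first.
    by rewrite big1 => [|z _]; rewrite !ffunE ?addr0 //=; apply/val_inj.
  rewrite d1 !ffunE; case: i => [[|[|[|[|[|]]]]] lti] //; by apply/val_inj.
move=> b1 b2 b3 b4 mem.
(* Every contracted vector has equal entries in the five repeated rows. *)
have value k (lt : (k < 5)%N) (v := pg_comb (e (o 0 isT) + e (o 4 isT))
      (e (o 1 isT) + e (o 4 isT)) (e (o 2 isT) + e (o 4 isT)) (e (o 3 isT) + e (o 4 isT)) b1 b2 b3 b4) :
    v (inr (o k lt)) + v (inr (o 4 isT)) = 0.
  have [f fE] := coord_hom (inr (o k lt) : rowT Phi I).
  have [g gE] := coord_hom (inr (o 4 isT) : rowT Phi I).
  have : (K + <<ws>> <= lker (f + g)%R)%VS.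
    have ker_col y : colY delta y \in lker (f + g)%R.
      by rewrite memv_ker add_lfunE fE gE !ffunE /= F2_addrr.
    rewrite subv_add; apply/andP; split; first by apply: fspan_sub => c _.
    apply/span_subvP=> w; rewrite inE !mem_cat => /orP[/eqP->|/or3P[] /mapP[y _ ->]] //.
    + by rewrite memv_ker add_lfunE fE gE !ffunE addr0.
    + by rewrite memv_ker add_lfunE fE gE !ffunE.
    + by rewrite rpredD // memv_ker add_lfunE fE gE !ffunE.
  by move/subvP/(_ _ mem); rewrite memv_ker add_lfunE fE gE => /eqP.
move: (value 0%N isT) (value 1%N isT) (value 2%N isT) (value 3%N isT).
rewrite /pg_comb /e !ffunE /=; clear mem value.
by case: b1; case: b2; case: b3; case: b4; rewrite /= !ffunE.
Qed.

(** If [l] were independent of the [C] columns, three rows would suffice: every vector on three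
    coordinates other than 0 and the all-one vector has weight 1 or 2, and is available with and
    without [l]. The points missed are [l], the all-one vector and their sum, which form a line. *)
Lemma Lambda_sub_C (l : {ffun tX Phi -> ('F_2)^o}) : l \in tLambda Phi ->
  exists s : {set tC Phi}, l = \sum_(c in s) colA1 (inr c).
Proof.
move=> lL; pose Q := fspan (fun c : tC Phi => colA1 (inr c)) setT.
have [/memv_fspan[s _ ->]|lQ] := boolP (l \in Q); first by exists s.
pose delta (i : 'I_3) : {ffun tcol Phi -> 'F_2} := 0.
have deltaP i : delta i \in tDelta Phi by apply: Delta0.
case: (univ_no_pg deltaP); set K := fspan _ _.
have memK v : v \in K -> (forall i, v (inr i) = 0) /\ exists2 q, q \in Q & v = vecXI q 0.
  case/memv_fspan=> s _ ->; rewrite vecXI_sum.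
  have -> : \sum_(c in s) [ffun i : 'I_3 => delta i (inr c)] = 0 :> {ffun 'I_3 -> ('F_2)^o}.
    by rewrite big1 // => c _; apply/ffunP=> i; rewrite !ffunE.
  split=> [i|]; first by rewrite !ffunE.
  exists (\sum_(c in s) colA1 (inr c)) => //; apply: rpred_sum => c _.
  by apply: (mem_fspan (fun c => colA1 (inr c))).
pose o k (lt : (k < 3)%N) : 'I_3 := Ordinal lt.
pose e i : {ffun rowT Phi 'I_3 -> ('F_2)^o} := vecXI 0 (unitv i).
pose one : {ffun 'I_3 -> ('F_2)^o} := [ffun=> 1].
exists [::], (vecXI l 0), (vecXI 0 one), (e (o 0 isT)), (e (o 1 isT)).
rewrite span_nil addv0; split=> // b1 b2 b3 b4.
  move=> /memK[zero [q qQ vE]].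
  have combE i : (b2 (+) ((i == o 0%N isT) && b3) (+) ((i == o 1%N isT) && b4)) = false.
    have := zero i; rewrite /pg_comb; clear.
    case: b1; case: b2; case: b3; case: b4; rewrite /= ?mulr0n ?mulr1n !ffunE;
      by case: (i == _); case: (i == _).
  have b2F : b2 = false by have := combE (o 2%N isT); rewrite /= !addbF.
  have b3F : b3 = false by have := combE (o 0%N isT); rewrite b2F /= addbF.
  have b4F : b4 = false by have := combE (o 1%N isT); rewrite b2F /=.
  split=> //; apply/negbTE/negP=> b1T; case/negP: lQ.
  rewrite (_ : l = q) //; apply/ffunP=> x; have /ffunP/(_ (inl x)) := vE.
  by rewrite b1T b2F b3F b4F /pg_comb /= !mulr0n !addr0 !ffunE.
move=> b34; pose f : {ffun 'I_3 -> ('F_2)^o} := one *+ b2 + unitv (o 0%N isT) *+ b3 + unitv (o 1%N isT) *+ b4.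
exists (vecXI (l *+ b1) f); last first.
  rewrite (_ : vecXI _ _ = pg_comb (vecXI l 0) (vecXI 0 one) (e (o 0%N isT)) (e (o 1%N isT)) b1 b2 b3 b4) ?F2_addvv ?mem0v //.
  apply/ffunP=> -[x|i]; rewrite /pg_comb /f; clear; case: b1; case: b2; case: b3; case: b4;
    by rewrite /= ?mulr0n ?mulr1n !ffunE ?addr0 ?add0r.
constructor 1; exists (l *+ b1), f; split=> //.
  by case: (b1); [rewrite mulr1n | rewrite mulr0n; apply: Lambda0].
have [k fk] : exists k, f k = 0.
  rewrite /f; clear f; move: b34; case: b2; case: b3; case: b4 => //= _;
    rewrite ?mulr0n ?mulr1n;
    [exists (o 0%N isT) | exists (o 0%N isT) | exists (o 1%N isT)
    | exists (o 2%N isT) | exists (o 2%N isT) | exists (o 2%N isT)];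
    by rewrite !ffunE; apply/val_inj.
apply: leq_trans (_ : #|~: [set k]| <= _)%N; last by have := cardsC1 k; rewrite card_ord => ->.
by apply: subset_leq_card; apply/subsetP=> i; rewrite !inE; apply: contraNneq => ->; rewrite fk.
Qed.

End TemplateFacts.

(** * Terminals of a template *)

Section TerminalBasis.
Variables (L : {set ground (PG 3)}) (Phi : template).
Hypothesis hL : PG_line L.
Hypothesis noPG : forall M, conforms Phi M -> ~ has_minor M (delete L).

Definition spanC : {vspace {ffun tX Phi -> ('F_2)^o}} :=
  fspan (fun c : tC Phi => colA1 (inr c)) setT.
Definition colY1 (y : tY1 Phi) := colA1 (inl (inr y)).
Definition colY0 (y : tY0 Phi) := colA1 (inl (inl y)).

Definition terminal (I : finType) (f : I -> tY1 Phi) (o : option I) :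
  {ffun tX Phi -> ('F_2)^o} := if o is Some i then colY1 (f i) else 0.

(* [None] stands for the root, whose terminal vector is zero; it is used to fix
   the parity of a set of basis terminals. *)
Definition parity_lift (I : finType) (b : bool) (D : {set I}) : {set option I} :=
  if odd #|D| == b then Some @: D else None |: Some @: D.

Lemma odd_parity_lift (I : finType) b (D : {set I}) : odd #|parity_lift b D| = b.
Proof.
have cS : #|[set Some i | i in D]| = #|D| by apply: card_imset => i j [].
rewrite /parity_lift; case: eqP => [<-|]; first by rewrite cS.
rewrite cardsU1 cS; have -> : None \notin [set Some i | i in D] by apply/negP=> /imsetP[].
by rewrite /=; case: (odd _); case: b.
Qed.

Lemma sum_parity_lift (I : finType) (f : I -> tY1 Phi) b (D : {set I}) :
  \sum_(o in parity_lift b D) terminal f o = \sum_(i in D) colY1 (f i).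
Proof.
have sS : \sum_(o in [set Some i | i in D]) terminal f o = \sum_(i in D) colY1 (f i).
  by rewrite big_imset //= => i j _ _ [].
have nS : None \notin [set Some i | i in D] by apply/negP=> /imsetP[].
by rewrite /parity_lift; case: eqP => // _; rewrite big_setU1 //= sS add0r.
Qed.

(** Contracting each terminal vector plus the unit vector of its row identifies terminals with
    vertices, so that expansions in the terminal basis become vertex sets to which
    [terminal_structure] applies. *)
Lemma template_terminals : exists (I : finType) (f : I -> tY1 Phi) (p q s : option I),
  [/\ forall D : {set I}, \sum_(i in D) colY1 (f i) \in spanC -> D = set0,
      forall y, (exists j, colY1 y + terminal f j \in spanC) \/
        colY1 y + (terminal f p + terminal f q + terminal f s) \in spanC &
      forall y, colY0 y \in (fspan colY1 setT + spanC)%VS ->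
        (exists i j, colY0 y + (terminal f i + terminal f j) \in spanC) \/
        (exists r, colY0 y + (terminal f p + terminal f q + terminal f s + terminal f r)
           \in spanC)].
Proof.
have [I [f [ind span]]] := basis_mod colY1 spanC.
have [DX DXP] := fin_all_exists span.
have spanY y : exists D : {set I}, colY0 y \in (fspan colY1 setT + spanC)%VS ->
    colY0 y + \sum_(i in D) colY1 (f i) \in spanC.
  have [yS|_] := boolP (colY0 y \in (fspan colY1 setT + spanC)%VS); last by exists set0.
  pose G := (fspan (colY1 \o f) setT + spanC)%VS.
  have /subvP/(_ _ yS)/memv_addP[u /memv_fspan[D _ ->] [q qQ ->]] :
      (fspan colY1 setT + spanC <= G)%VS.
    rewrite subv_add addvSr andbT; apply: fspan_sub => t _.
    have -> : colY1 t = \sum_(i in DX t) (colY1 \o f) i + (colY1 t + \sum_(i in DX t) colY1 (f i)).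
      by rewrite /=; f2.
    by rewrite memv_add ?DXP // rpred_sum // => i _; rewrite (mem_fspan (colY1 \o f)).
  exists D => _ /=; have -> : forall u v : {ffun tX Phi -> ('F_2)^o}, u + v + u = v by move=> u' v'; f2.
  by [].
have [DY DYP] := fin_all_exists spanY.
(* One row for each basis terminal, one for the root, and two spare rows for the free vertices. *)
pose J : finType := (option I + bool)%type.
pose delta (i : J) : {ffun tcol Phi -> 'F_2} := 0.
have deltaP i : delta i \in tDelta Phi by apply: Delta0.
have colYE y : colY delta y = vecXI (colA1 y) 0.
  by congr vecXI; apply/ffunP=> i; rewrite !ffunE.
pose e (j : J) : {ffun rowT Phi J -> ('F_2)^o} := vecXI 0 (unitv j).
pose K := fspan (fun c : tC Phi => colY delta (inr c)) setT.
pose w (o : option I) := e (inl o) + (if o is Some i then colY delta (inl (inr (f i))) else 0).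
pose ws := [seq w o | o <- enum [set: option I]].
have wE o : w o = e (inl o) + vecXI (terminal f o) 0.
  by rewrite /w; case: o => [i|] /=; rewrite ?colYE // vecXI0.
have KQ v : v \in spanC -> vecXI v 0 \in K.
  case/memv_fspan=> s _ ->; rewrite (_ : vecXI _ _ = \sum_(c in s) colY delta (inr c)).
    by apply: rpred_sum => c _; rewrite (mem_fspan (fun c => colY delta (inr c))).
  under [RHS]eq_bigr do rewrite colYE.
  by rewrite vecXI_sum big1_eq.
have wsS v : v \in ws -> univ_avail delta v.
  case/mapP=> -[i|] _ ->; first by constructor 3; exists (inl (Some i)), (f i).
  constructor 1; exists 0, (unitv (inl None)); split; first exact: Lambda0.
    by apply: leq_trans (weight_unitv _) _.
  by rewrite /w addr0.
have psi_lin : linear (fun v => vecXI 0 v : {ffun rowT Phi J -> ('F_2)^o}).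
  by move=> a u v; apply/ffunP=> -[x|i]; rewrite !ffunE ?scaler0 ?addr0.
have [psi psiE] := linear_hom psi_lin.
have [par parE] := label_hom (J := J) xpredT.
(* The unit vector of the root is itself contracted, so only vectors of even weight embed
   faithfully. *)
pose H := lker par.
have par_ind (Z : {set J}) : par (indv Z) = (odd #|Z|)%:R.
  rewrite /indv linear_sum /=; under eq_bigr do rewrite parE.
  rewrite sumr_const; elim: #|Z| => [|n IHn] //; rewrite mulrS IHn /=.
  by case: (odd n); apply/val_inj.
(* Independence of the basis modulo [C] reduces the set to at most the root, and parity removes the
   root. *)
have kerpsi v : v \in H -> psi v \in (K + <<ws>>)%VS -> v = 0.
  move=> vH /memv_addP[k /memv_fspan[s _ ->] [u]].
  move=> /(memv_fspan (c := w) (S := setT))[D _ ->].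
  rewrite psiE; under eq_bigr do rewrite colYE.
  under [X in _ + X]eq_bigr do rewrite wE vecXID add0r addr0.
  rewrite !vecXI_sum vecXID big1_eq add0r => E.
  have vE : v = \sum_(o in D) unitv (inl o).
    by apply/ffunP=> j; have /ffunP/(_ (inr j)) := E; rewrite !ffunE.
  have aE : \sum_(i in s) colA1 (inr i) = \sum_(o in D) terminal f o.
    apply/eqP; rewrite -subr_eq0 oppv_id; apply/eqP/ffunP=> x.
    by have /ffunP/(_ (inl x)) := E; rewrite !ffunE => <-.
  pose D' := [set i | Some i \in D].
  have DE : D :\ None = [set Some i | i in D'].
    apply/setP=> -[i|]; last by rewrite !inE; apply/esym/negP=> /imsetP[].
    by rewrite mem_imset ?inE // => a b [].
  have D'0 : D' = set0.
    apply: ind; have -> : \sum_(i in D') colY1 (f i) = \sum_(o in D) terminal f o.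
      transitivity (\sum_(o in D :\ None) terminal f o).
        by rewrite DE big_imset //= => a b _ _ [].
      have [ND|ND] := boolP (None \in D); first by rewrite [RHS](big_setD1 None) //= add0r.
      by rewrite (setDidPl _) // disjoint_sym disjoints1.
    rewrite -aE; apply: rpred_sum => c _; exact: (mem_fspan (fun c => colA1 (inr c))).
  rewrite D'0 imset0 in DE; rewrite vE; have [ND|ND] := boolP (None \in D).
    move: vH; rewrite vE memv_ker (big_setD1 None) //= DE big_set0 addr0 parE.
    by rewrite oner_eq0.
  rewrite (_ : D = set0) ?big_set0 //; apply/setP=> o; have /setP/(_ o) := DE.
  by rewrite !inE; case: (eqVneq o None) ND => [->|] //= /negPf.
pose S' v := v \in H /\ exists2 z, univ_avail delta z & z + psi v \in (K + <<ws>>)%VS.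
have noS' : ~ has_pg 0 S'.
  move=> pg; apply: (univ_no_pg hL noPG deltaP); apply: (has_pg_contract wsS).
  by apply: (has_pg_transfer kerpsi) pg => v [].
have pairS i j : S' (unitv i + unitv j).
  split; first by rewrite memv_ker linearD /= !parE F2_addrr.
  exists (vecXI 0 (unitv i + unitv j)); last by rewrite psiE F2_addvv mem0v.
  constructor 1; exists 0, (unitv i + unitv j); split=> //; first exact: Lambda0.
  by apply: leq_trans (weightD _ _) _; have := weight_unitv i; have := weight_unitv j; lia.
have psi_set (O : {set option I}) :
    psi (indv (inlset O)) + vecXI (\sum_(o in O) terminal f o) 0 \in (K + <<ws>>)%VS.
  have -> : psi (indv (inlset O)) = \sum_(o in O) e (inl o).
    rewrite /indv /inlset big_imset /=; last by move=> a b _ _ [].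
    by rewrite linear_sum /=; apply: eq_bigr => o _; rewrite psiE.
  rewrite (_ : vecXI _ 0 = \sum_(o in O) vecXI (terminal f o) 0); last by rewrite vecXI_sum big1_eq.
  rewrite -big_split /=; apply: rpred_sum => o _; rewrite -wE.
  by apply: (subvP (addvSr _ _)); apply: memv_span; apply: map_f; rewrite mem_enum inE.
have card_inlset (O : {set option I}) : #|inlset O| = #|O| by apply: card_imset => a b [].
pose Xs y := parity_lift true (DX y).
(* A [Y0] vector outside the span gets the empty set as a default, since nothing is claimed about
   it. *)
pose Ys y := if colY0 y \in (fspan colY1 setT + spanC)%VS then parity_lift false (DY y) else set0.
have oddX y : odd #|Xs y| by apply: odd_parity_lift.
have evenY y : ~~ odd #|Ys y|.
  by rewrite /Ys; case: ifP => _; rewrite ?odd_parity_lift ?cards0.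
have K_ws v : v \in spanC -> vecXI v 0 \in (K + <<ws>>)%VS.
  by move/KQ; apply: (subvP (addvSl _ _)).
have SX y j : S' (unitv j + indv (inlset (Xs y))).
  split; first by rewrite memv_ker linearD /= parE par_ind card_inlset oddX F2_addrr.
  exists (e j + colY delta (inl (inr y))); first by constructor 3; exists j, y.
  rewrite linearD /= psiE -/(e j) colYE.
  set P := psi _; set R := \sum_(o in Xs y) terminal f o.
  have -> : e j + vecXI (colY1 y) 0 + (e j + P) = (P + vecXI R 0) + vecXI (colY1 y + R) 0.
    have -> : vecXI (colY1 y + R) 0 = vecXI (colY1 y) 0 + vecXI R 0 :> {ffun rowT Phi J -> ('F_2)^o} by rewrite vecXID addr0.
    by f2.
  by rewrite rpredD ?psi_set // K_ws // /R sum_parity_lift.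
have SY y : S' (indv (inlset (Ys y))).
  split; first by rewrite memv_ker par_ind card_inlset (negPf (evenY y)).
  rewrite /Ys; case: ifP => [yS|_]; last first.
    exists 0; last by rewrite /inlset imset0 /indv big_set0 linear0 addr0 mem0v.
    by constructor 1; exists 0, 0; rewrite weight0 vecXI0; split=> //; apply: Lambda0.
  exists (colY delta (inl (inl y))); first by constructor 2; exists y.
  rewrite colYE; set P := psi _; set O := parity_lift _ _ in P *.
  pose R := \sum_(o in O) terminal f o.
  have -> : vecXI (colY0 y) 0 + P = (P + vecXI R 0) + vecXI (colY0 y + R) 0.
    have -> : vecXI (colY0 y + R) 0 = vecXI (colY0 y) 0 + vecXI R 0 :> {ffun rowT Phi J -> ('F_2)^o} by rewrite vecXID addr0.
    by f2.
  by rewrite rpredD ?psi_set // K_ws // /R sum_parity_lift DYP.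
have [p [q [s [hX hY]]]] := terminal_structure None pairS oddX evenY SX SY noS'.
have [T [_ TE]] := lincomb (terminal f).
have Tind O : T (indv O) = \sum_(o in O) terminal f o.
  by rewrite /indv linear_sum /=; apply: eq_bigr => o _; rewrite TE.
exists I, f, p, q, s; split=> // [y|y yS].
  have := DXP y; rewrite -(sum_parity_lift f true) -Tind -/(Xs y).
  case: (hX y) => [[j ->]|->]; first by rewrite TE; left; exists j.
  by rewrite !linearD /= !TE; right.
have := DYP y yS; rewrite -(sum_parity_lift f false) -Tind.
have -> : parity_lift false (DY y) = Ys y by rewrite /Ys yS.
by case: (hY y) => [[i [j ->]]|[r ->]]; rewrite !linearD /= !TE; [left; exists i, j|right; exists r].
Qed.

End TerminalBasis.

Lemma sum_option (T : finType) (V : zmodType) (G : option T -> V) :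
  \sum_o G o = G None + \sum_i G (Some i).
Proof.
rewrite (bigD1 None) //=; congr (_ + _).
rewrite (eq_bigl (fun o => o \in [set Some i | i in [set: T]])); last first.
  by case=> [i|]; rewrite ?mem_imset ?inE //=; [move=> a b [] | apply/esym/negP=> /imsetP[]].
by rewrite big_imset /=; [apply: eq_bigl => i; rewrite inE | move=> a b _ _ []].
Qed.

Lemma k_connected_isom (M N : matroid) k : isom M N -> k_connected k M -> k_connected k N.
Proof.
case=> h [[g hK gK] rkh] kM j S jk [jS jCS conn].
have imh (T : {set ground N}) : h @: (h @^-1: T) = T.
  apply/setP=> x; apply/imsetP/idP => [[y]|xT]; first by rewrite inE => ? ->.
  by exists (g x); rewrite ?inE gK.
have hinj : injective h := can_inj hK.
have rkpre (T : {set ground N}) : rk (h @^-1: T) = rk T by rewrite -rkh imh.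
have cpre (T : {set ground N}) : #|h @^-1: T| = #|T| by rewrite -(card_imset _ hinj) imh.
apply: (kM j (h @^-1: S) jk); split; rewrite -?preimsetC ?cpre //.
by rewrite /connectivity -preimsetC !rkpre -(preimsetT h) rkpre.
Qed.

Lemma hom_ffunE (T : finType) (V : vectType 'F_2) (f : 'Hom({ffun T -> ('F_2)^o}, V)) v :
  f v = \sum_x v x *: f (unitv x).
Proof.
have vE : v = \sum_x v x *: unitv x.
  apply/ffunP=> z; rewrite sum_ffunE.
  have at_z x : (v x *: unitv x) z = v x * (z == x)%:R by rewrite [LHS]ffunE ffunE.
  transitivity (\sum_x (v x * (z == x)%:R : 'F_2)); last by apply: eq_bigr => x _.
  rewrite (bigD1 z) //= eqxx mulr1 big1 ?addr0 // => x xz.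
  by rewrite eq_sym (negPf xz) mulr0.
by rewrite {1}vE linear_sum /=; apply: eq_bigr => x _; rewrite linearZ.
Qed.

Lemma sum_scale_support (T : finType) (V : vectType 'F_2) (a : T -> 'F_2) (g : T -> V) :
  \sum_x a x *: g x = \sum_(x in [set x | a x != 0]) g x.
Proof.
rewrite [RHS]big_mkcond; apply: eq_bigr => x _; rewrite inE {1}[a x]F2_natE.
by case: (_ != _); rewrite ?scale1r ?scale0r.
Qed.

(** * Matroids conforming to a restricted template *)

Section Conforming.
Variables (L : {set ground (PG 3)}) (Phi : template).
Hypothesis hL : PG_line L.
Hypothesis noPG : forall M, conforms Phi M -> ~ has_minor M (delete L).
Variables (B E : finType) (iX : tX Phi -> B) (iY : tcol Phi -> E).
Variables (A A' : bmatrix B E) (Z : {set E}).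
Hypothesis resp : respects_with iX iY A' Z.
Hypothesis AE : forall b e, e \notin Z -> A b e = A' b e.
Hypothesis AZ : forall i, i \in Z -> exists2 j, j \in Y1set iY &
  forall b, A b i = A' b i + A' b j.

Let VB := {ffun B -> ('F_2)^o}.
Let cy (y : tcol Phi) : VB := mxcol A (iY y).
Let K : {vspace VB} := fspan (mxcol A) (Cset iY).

Let Y_notZ y : iY y \notin Z.
Proof.
apply/negP=> yZ; have := subsetP (resp_Z resp) _ yZ.
by rewrite inE => /negP; apply; apply: imset_f.
Qed.

Let X_in x : iX x \in Xset iX. Proof. exact: imset_f. Qed.

Let cyX x y : cy y (iX x) = colA1 y x.
Proof. by rewrite !ffunE AE ?Y_notZ // (resp_A1 resp). Qed.

Let sum_cyX (s : {set tcol Phi}) x :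
  (\sum_(y in s) cy y) (iX x) = (\sum_(y in s) colA1 y) x.
Proof. by rewrite !sum_ffunE; apply: eq_bigr => y _; apply: cyX. Qed.

Let sum_cy_low (s : {set tcol Phi}) b : \sum_(y in s) colA1 y \in tLambda Phi ->
  b \notin Xset iX -> (\sum_(y in s) cy y) b = 0.
Proof.
move=> sL bX; have dD : [ffun y => A' b (iY y)] \in tDelta Phi.
  by apply: (resp_Delta resp); rewrite inE.
rewrite sum_ffunE -[RHS](Delta_orth hL noPG dD sL).
by apply: eq_bigr => y _; rewrite !ffunE AE ?Y_notZ.
Qed.

Lemma K_sum v : v \in K -> exists s : {set tC Phi}, v = \sum_(c in s) cy (inr c).
Proof.
move=> vK; have : v \in fspan (fun c => cy (inr c)) setT.
  apply: subvP vK; apply: fspan_sub => _ /imsetP[c _ ->].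
  by apply: (mem_fspan (fun c => cy (inr c))).
by case/memv_fspan=> s _ ->; exists s.
Qed.

Lemma cyC_in_K c : cy (inr c) \in K.
Proof. by apply: (mem_fspan (mxcol A)); apply/imsetP; exists c. Qed.

(** A relation modulo the [C] columns needs checking only in the rows of [X]: once those entries
    cancel, orthogonality of Delta makes all other entries cancel. *)
Lemma lift_spanC (v : {ffun tcol Phi -> ('F_2)^o}) :
  \sum_y v y *: colA1 y \in spanC Phi -> \sum_y v y *: cy y \in K.
Proof.
have [F1 [F1E F1u]] := lincomb (@colA1 Phi); have [F [FE Fu]] := lincomb cy.
rewrite -F1E -FE => /memv_fspan[s _ F1v].
pose u := v + \sum_(c in s) unitv (inr c).
have F1u0 : F1 u = 0.
  rewrite linearD /= F1v linear_sum /=; under [X in _ + X]eq_bigr do rewrite F1u.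
  by rewrite F2_addvv.
have Fu0 : F u = 0.
  move: F1u0; rewrite F1E FE !sum_scale_support => s0; apply/ffunP=> b; rewrite [RHS]ffunE.
  have [/imsetP[x _ ->]|bX] := boolP (b \in Xset iX).
    by rewrite sum_cyX s0 ffunE.
  by apply: sum_cy_low; rewrite // s0; apply: Lambda0.
have -> : v = u + \sum_(c in s) unitv (inr c) by rewrite /u; f2.
rewrite linearD /= Fu0 add0r linear_sum /=; apply: rpred_sum => c _.
by rewrite Fu cyC_in_K.
Qed.

(** Lambda is covered by sums of [C] columns, so modulo [K] a frame column loses its part in [X]. *)
Lemma lambda_in_K (v : VB) : [ffun x => v (iX x)] \in tLambda Phi ->
  (forall b, b \notin Xset iX -> v b = 0) -> v \in K.
Proof.
move=> vL v0; have [s sE] := Lambda_sub_C hL noPG vL.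
pose s' : {set tcol Phi} := [set inr c | c in s].
have s'E (T : zmodType) (g : tcol Phi -> T) : \sum_(y in s') g y = \sum_(c in s) g (inr c).
  by rewrite big_imset //= => a b _ _ [].
have -> : v = \sum_(y in s') cy y.
  apply/ffunP=> b; have [/imsetP[x _ ->]|bX] := boolP (b \in Xset iX).
    rewrite sum_cyX s'E -sE ffunE //.
  by rewrite v0 // sum_cy_low // s'E -sE.
by rewrite s'E; apply: rpred_sum => c _; apply: cyC_in_K.
Qed.

Variables (I : finType) (f : I -> tY1 Phi) (p q s : option I).
Hypothesis ind : forall D : {set I},
  \sum_(i in D) colY1 (f i) \in spanC Phi -> D = set0.
Hypothesis Y1P : forall y, (exists j, colY1 y + terminal f j \in spanC Phi) \/
  colY1 y + (terminal f p + terminal f q + terminal f s) \in spanC Phi.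
Hypothesis Y0P : forall y,
  (exists i j, colY0 y + (terminal f i + terminal f j) \in spanC Phi) \/
  (exists r, colY0 y + (terminal f p + terminal f q + terminal f s + terminal f r)
     \in spanC Phi).

(** The vertices are the rows outside [X], the basis terminals with their root [Some None], and one
    extra vertex [None] standing for the sum of [p], [q] and [s]. Rows in [X] belong to the type but
    are excluded by [good]. *)
Let VG : finType := (B + option (option I))%type.
Let Tv (o : option I) : VB := if o is Some i then cy (inl (inr (f i))) else 0.
Let tv (u : VG) : VB :=
  match u with
  | inl b => if b \in Xset iX then 0 else unitv b
  | inr (Some o) => Tv o
  | inr None => Tv p + Tv q + Tv s
  end.
Let good (u : VG) : bool := if u is inl b then b \notin Xset iX else true.

Let lifto (o : option I) : {ffun tcol Phi -> ('F_2)^o} :=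
  if o is Some i then unitv (inl (inr (f i))) else 0.

(** A [Y0] column joins two terminals, or one terminal and the extra vertex; a [Z] column joins a
    row to a terminal or to the extra vertex; a frame column joins at most two rows, missing ends
    being filled by the root, whose vector is 0. *)
Lemma edge_ends e : e \notin Cset iY -> e \notin Y1set iY ->
  exists u v : VG, [/\ good u, good v & mxcol A e + (tv u + tv v) \in K].
Proof.
move=> eC eY1.
have [F1 [F1E F1u]] := lincomb (@colA1 Phi); have [F [FE Fu]] := lincomb cy.
have F1l o : F1 (lifto o) = terminal f o by case: o => [i|] /=; rewrite ?F1u ?linear0.
have Fl o : F (lifto o) = Tv o by case: o => [i|] /=; rewrite ?Fu ?linear0.
have lift v : F1 v \in spanC Phi -> F v \in K by rewrite F1E FE; apply: lift_spanC.
have [/imsetP[y _ ye]|eYC] := boolP (e \in YCset iY).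
  case: y ye => [[y|y]|c] ye.
  - case: (Y0P y) => [[i [j h]]|[r h]].
      exists (inr (Some i)), (inr (Some j)); split=> //=; rewrite ye -/(cy _).
      have := lift (unitv (inl (inl y)) + (lifto i + lifto j)).
      by rewrite !linearD /= !F1l !Fl F1u Fu; apply.
    exists (inr None), (inr (Some r)); split=> //=; rewrite ye -/(cy _).
    have := lift (unitv (inl (inl y)) + (lifto p + lifto q + lifto s + lifto r)).
    by rewrite !linearD /= !F1l !Fl F1u Fu; apply.
  - by case/negP: eY1; apply/imsetP; exists y.
  - by case/negP: eC; apply/imsetP; exists c.
have [eZ|eZ] := boolP (e \in Z).
  have [_ /imsetP[y _ ->] AeE] := AZ eZ.
  have /eqP/cards1P[b0 bE] := resp_Z_unit resp eZ.
  have b0X : b0 \notin Xset iX.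
    by have := set11 b0; rewrite -bE !inE => /andP[].
  have colE : mxcol A e = unitv b0 + cy (inl (inr y)).
    apply/ffunP=> b; rewrite !ffunE AeE (AE _ (Y_notZ _)); congr (_ + _).
    have [bX|bX] := boolP (b \in Xset iX).
      rewrite (resp_Z_zero resp) //; case: eqP => // bb0; by rewrite bb0 (negPf b0X) in bX.
    have : (b \in [set b0]) = (A' b e != 0) by rewrite -bE !inE bX.
    by rewrite inE => ->; exact: F2_natE.
  case: (Y1P y) => [[j h]|h].
    exists (inl b0), (inr (Some j)); split=> //=; rewrite (negPf b0X) colE.
    have := lift (unitv (inl (inr y)) + lifto j).
    rewrite !linearD /= !F1l !Fl F1u Fu => /(_ h) hK.
    by rewrite [X in X \in _](_ : _ = cy (inl (inr y)) + Tv j) //; f2.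
  exists (inl b0), (inr None); split=> //=; rewrite (negPf b0X) colE.
  have := lift (unitv (inl (inr y)) + (lifto p + lifto q + lifto s)).
  rewrite !linearD /= !F1l !Fl F1u Fu => /(_ h) hK.
  by rewrite [X in X \in _](_ : _ = cy (inl (inr y)) + (Tv p + Tv q + Tv s)) //; f2.
have eYZ : e \in ~: (YCset iY :|: Z) by rewrite !inE negb_or eYC.
have le2 := resp_frame resp eYZ; have lL := resp_Lambda resp eYZ.
(* Modulo [K] the frame column is the sum of the unit vectors of its support below [X]. *)
set W := [set b in ~: Xset iX | A' b e != 0] in le2.
have low : mxcol A e + indv W \in K.
  apply: lambda_in_K => [|b bX]; last first.
    rewrite !ffunE indvE AE // !inE bX /=.
    by rewrite {1}[A' b e]F2_natE F2_addrr.
  rewrite (_ : [ffun _ => _] = [ffun x => A' (iX x) e]) //; apply/ffunP=> x.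
  by rewrite !ffunE indvE AE // !inE X_in /= addr0.
have Wgood b : b \in W -> b \notin Xset iX by rewrite !inE => /andP[].
move: le2 low Wgood; rewrite /lower_weight -/W cardE indv_enum => le2 low Wgood.
have {}Wgood b : b \in enum W -> b \notin Xset iX by rewrite mem_enum => /Wgood.
move: le2 low Wgood; case: (enum W) => [|b [|b' []]] // _; rewrite ?big_cons big_nil ?addr0 => low Wgood.
- by exists (inr (Some None)), (inr (Some None)); split=> //=; rewrite !addr0.
- exists (inl b), (inr (Some None)); have bX := Wgood b (mem_head _ _).
  by split=> //=; rewrite (negPf bX) addr0.
exists (inl b), (inl b'); have bX := Wgood b (mem_head _ _).
have bX' : b' \notin Xset iX by apply: Wgood; rewrite !inE eqxx orbT.
by split=> //=; rewrite (negPf bX) (negPf bX').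
Qed.

Lemma conforming_terminal_quotient :
  terminal_quotient (@contract_delete (vector_matroid A) (Cset iY) (Y1set iY)).
Proof.
set N := contract_delete _ _.
have repN : @represents N _ (fun x => mxcol A (out_val (out_val x))) K.
  rewrite -(addv0 K); apply: (@contract_delete_represents (vector_matroid A)).
  exact: vector_matroid_represents.
have outE (x : ground N) : exists uv : VG * VG, [/\ good uv.1, good uv.2 &
    mxcol A (out_val (out_val x)) + (tv uv.1 + tv uv.2) \in K].
  have [||u [v h]] := @edge_ends (out_val (out_val x)); last by exists (u, v).
    exact: (valP (out_val x)).
  by have := valP x; rewrite inE.
have [en enP] := fin_all_exists outE.
pose vp : VG := inr (Some p); pose vq : VG := inr (Some q); pose vs : VG := inr (Some s).
pose vm : VG := inr None.
exists VG, (fun x => (en x).1), (fun x => (en x).2), vp, vq, vs, vm => S; rewrite repN.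
set kappa := (X in <[X]>%VS).
have [Om [OmE Omu]] := lincomb tv.
have [par parE] := label_hom (J := VG) xpredT.
(* [H] is to consist of the even vectors that vanish on the rows of [X]; on these, passing to [K]
   loses only [kappa]. *)
have res_lin : linear (fun v : {ffun VG -> ('F_2)^o} => [ffun o =>
    if o is Some b then if b \in Xset iX then v (inl b) else 0 else par v] :
    {ffun option B -> ('F_2)^o}).
  move=> a u v; apply/ffunP=> -[b|]; rewrite !ffunE; last by rewrite linearP.
  by case: ifP => // _; rewrite scaler0 addr0.
have [res resE] := linear_hom res_lin.
pose H := lker res.
have memH v : (v \in H) = (res v == 0) by apply: memv_ker.
have resu u : good u -> res (unitv u) = unitv None.
  move=> gu; rewrite resE; apply/ffunP=> -[b|]; rewrite !ffunE ?parE //; case: ifP => // bX.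
  by case: u gu => [b'|o] //= b'X; case: eqP => // -[bb']; rewrite bb' (negPf b'X) in bX.
have pairH u v : good u -> good v -> unitv u + unitv v \in H.
  move=> gu gv; by rewrite memH (linearD res) /= !resu // F2_addvv.
have kH : kappa \in H.
  by rewrite /kappa -addrA; apply: rpredD; apply: pairH.
have Omk : Om kappa = 0 by rewrite /kappa !linearD /= !Omu /=; f2.
apply: (qrk_transfer (f := Om) (H := H)).
- by move=> x; have [_ _] := enP x; rewrite linearD /= !Omu.
- by move=> v /vlineP[a ->]; rewrite linearZ /= Omk scaler0 mem0v.
- by move=> x; have [g1 g2 _] := enP x; apply: pairH.
- by apply/subvP=> _ /vlineP[a ->]; apply: memvZ.
(* Adding a multiple of [kappa] clears the extra vertex. What is left vanishes: on the basis
   terminals by independence in the rows of [X], on the remaining rows by orthogonality of Delta,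
   and at the root by parity. *)
move=> v vH vK; pose v' := v + v vm *: kappa.
suff v'0 : v' = 0.
  have -> : v = v' + v vm *: kappa by rewrite /v'; f2.
  by rewrite v'0 add0r memvZ ?memv_line.
have v'H : v' \in H by rewrite rpredD // memvZ.
have v'K : Om v' \in K by rewrite linearD linearZ /= Omk scaler0 addr0.
have v'm : v' vm = 0.
  rewrite !ffunE eqxx /= !add0r /GRing.scale /= mulr1; exact: F2_addrr.
move: v' v'H v'K v'm => w; rewrite memH => /eqP resw wK wm {v vH vK}.
have wX b : b \in Xset iX -> w (inl b) = 0.
  by move=> bX; have /ffunP/(_ (Some b)) := resw; rewrite resE !ffunE bX.
have parw : par w = 0 by have /ffunP/(_ None) := resw; rewrite resE !ffunE.
have OmwE : Om w = \sum_b w (inl b) *: tv (inl b) +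
    \sum_i w (inr (Some (Some i))) *: cy (inl (inr (f i))).
  rewrite OmE big_sumType /= !sum_option /= -/vm wm scale0r add0r scaler0 add0r //.
have [t tE] := K_sum wK.
have wf i : w (inr (Some (Some i))) = 0.
  pose D := [set i | w (inr (Some (Some i))) != 0].
  suff D0 : D = set0.
    by apply/eqP; have /setP/(_ i) := D0; rewrite !inE => /negbFE.
  apply: ind; rewrite -(sum_scale_support (fun i => w (inr (Some (Some i))))).
  have -> : \sum_i w (inr (Some (Some i))) *: colY1 (f i) = \sum_(c in t) colA1 (inr c).
    apply/ffunP=> x; have /ffunP/(_ (iX x)) := tE; rewrite OmwE ffunE.
    rewrite [X in X + _](_ : _ = 0); last first.
      rewrite sum_ffunE big1 // => b _; rewrite ffunE /=; case: ifP => bX.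
        by rewrite ffunE scaler0.
      rewrite ffunE; case: eqP => [xb|]; last by rewrite scaler0.
      by rewrite -xb X_in in bX.
    rewrite add0r !sum_ffunE => h.
    transitivity (\sum_i (w (inr (Some (Some i))) *: cy (inl (inr (f i)))) (iX x)).
      by apply: eq_bigr => i' _; rewrite [LHS]ffunE [RHS]ffunE cyX.
    by rewrite h; apply: eq_bigr => c _; rewrite cyX.
  by apply: rpred_sum => c _; apply: (mem_fspan (fun c => colA1 (inr c))).
have Om_low : Om w = \sum_b w (inl b) *: tv (inl b).
  by rewrite OmwE [X in _ + X]big1 ?addr0 // => i _; rewrite wf scale0r.
have Omw_at b : Om w b = w (inl b).
  rewrite Om_low sum_ffunE (bigD1 b) //= big1 => [|b' b'b].
    rewrite addr0 ffunE; case: ifP => bX; last by rewrite ffunE eqxx /GRing.scale /= mulr1.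
    by rewrite wX // ffunE scaler0.
  rewrite ffunE; case: ifP => _; first by rewrite ffunE scaler0.
  by rewrite ffunE eq_sym (negPf b'b) scaler0.
have wb b : w (inl b) = 0.
  have [/wX //|bX] := boolP (b \in Xset iX).
  pose t' : {set tcol Phi} := [set inr c | c in t].
  have t'E (T : zmodType) (g : tcol Phi -> T) : \sum_(y in t') g y = \sum_(c in t) g (inr c).
    by rewrite big_imset //= => a c _ _ [].
  rewrite -Omw_at tE -t'E sum_cy_low // (_ : \sum_(y in t') _ = 0); first exact: Lambda0.
  apply/ffunP=> x; rewrite -sum_cyX t'E -tE Omw_at wX //; by rewrite ffunE.
have wr : w (inr (Some None)) = 0.
  move: parw; rewrite (hom_ffunE par) big_sumType /= !sum_option /=.
  rewrite big1 => [|b _]; last by rewrite wb scale0r.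
  rewrite add0r -/vm wm scale0r add0r [X in _ + X]big1 => [|i _]; last by rewrite wf scale0r.
  by rewrite addr0 parE /GRing.scale /= mulr1.
by apply/ffunP=> -[b|[[i|]|]]; rewrite [RHS]ffunE ?wb ?wf ?wr ?wm.
Qed.

End Conforming.

Lemma conforms_terminal_quotient (L : {set ground (PG 3)}) (Phi : template) (M : matroid) k :
  PG_line L -> (forall M', conforms Phi M' -> ~ has_minor M' (delete L)) ->
  conforms Phi M -> k_connected k M -> (#|tY0 Phi| < k)%N -> (2 * k <= #|ground M|)%N ->
  terminal_quotient M.
Proof.
move=> hL noPG [B [E [iX [iY [A [injX injY [A' [Z [resp AE AZ]]] iso]]]]]] kM Y0k Mk.
set N := contract_delete _ _ in iso.
have kN := k_connected_isom iso kM.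
have {}Mk : (2 * k <= #|ground N|)%N by have [h [bh _]] := iso; rewrite -(bij_eq_card bh).
suff tN : terminal_quotient N.
  exact: terminal_quotient_minor tN (isom_has_minor (isom_sym iso)).
have [I [f [p [q [s [ind Y1P Y0P]]]]]] := template_terminals hL noPG.
apply: (conforming_terminal_quotient hL noPG resp AE AZ ind Y1P) => y0.
apply: Y0P; set G := (fspan _ _ + _)%VS.
have repN : @represents N _ (fun x => mxcol A (out_val (out_val x))) (fspan (mxcol A) (Cset iY)).
  rewrite -(addv0 (fspan _ _)); apply: (@contract_delete_represents (vector_matroid A)).
  exact: vector_matroid_represents.
set c := (fun x => _) in repN; set K := fspan _ _ in repN.
have pi_lin : linear (fun v : {ffun B -> ('F_2)^o} =>
    [ffun x => v (iX x)] : {ffun tX Phi -> ('F_2)^o}).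
  by move=> a u v; apply/ffunP=> x; rewrite !ffunE.
have [pi piE] := linear_hom pi_lin.
have Y_notZ y : iY y \notin Z.
  apply/negP=> yZ; have := subsetP (resp_Z resp) _ yZ.
  by rewrite inE => /negP; apply; apply: imset_f.
have piY y : pi (mxcol A (iY y)) = colA1 y.
  by rewrite piE; apply/ffunP=> x; rewrite !ffunE AE // (resp_A1 resp).
have CG v : v \in spanC Phi -> v \in G by apply: (subvP (addvSr _ _)).
have piK v : v \in K -> pi v \in G.
  move=> vK; suff /subvP/(_ _ (memv_img pi vK)) : (pi @: K <= G)%VS by [].
  rewrite limg_fspan; apply: fspan_sub => _ /imsetP[d _ ->]; rewrite /= piY.
  by apply/CG/(mem_fspan (fun d => colA1 (inr d))).
pose Y0img := [set iY (inl (inl y)) | y : tY0 Phi].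
pose S0 := [set x : ground N | out_val (out_val x) \in Y0img].
(* Apart from [Y0] elements, the part of a column in [X] is either a [Y1] column or a Lambda vector,
   and the latter is a sum of [C] columns. *)
have piS x : x \notin S0 -> pi (c x) \in G.
  rewrite inE => xY0; set e := out_val (out_val x) in xY0 *.
  have eC : e \notin Cset iY by apply: (valP (out_val x)).
  have eY1 : e \notin Y1set iY by have := valP x; rewrite inE.
  have eYC : e \notin YCset iY.
    apply/negP=> /imsetP[[[y|y]|d] _ eE].
    - by case/negP: xY0; apply/imsetP; exists y.
    - by case/negP: eY1; apply/imsetP; exists y.
    - by case/negP: eC; apply/imsetP; exists d.
  rewrite /c -/e piE; have [eZ|eZ] := boolP (e \in Z).
    have [_ /imsetP[y _ ->] AeE] := AZ _ eZ.
    rewrite (_ : [ffun _ => _] = colY1 y); last first.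
      apply/ffunP=> z; rewrite !ffunE AeE (resp_Z_zero resp) ?imset_f // add0r.
      by rewrite (resp_A1 resp).
    by apply: (subvP (addvSl _ _)); rewrite mem_fspan.
  have eYZ : e \in ~: (YCset iY :|: Z) by rewrite !inE negb_or eYC.
  have lL := resp_Lambda resp eYZ; have [t tE] := Lambda_sub_C hL noPG lL.
  rewrite (_ : [ffun _ => _] = [ffun z => A' (iX z) e]).
    rewrite tE; apply/CG/rpred_sum => d _; exact: (mem_fspan (fun d => colA1 (inr d))).
  by apply/ffunP=> z; rewrite !ffunE AE.
have notC : iY (inl (inl y0)) \notin Cset iY by apply/negP=> /imsetP[d _ /injY].
have notY1 : iY (inl (inl y0)) \notin Y1set iY by apply/negP=> /imsetP[d _ /injY].
have notY1' : (Sub (iY (inl (inl y0))) notC : {x : E | x \notin Cset iY}) \notin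
    [set x : @outside (vector_matroid A) (Cset iY) | out_val x \in Y1set iY].
  by rewrite inE.
pose x0 : ground N := Sub (Sub (iY (inl (inl y0))) notC : {x : E | x \notin Cset iY}) notY1'.
have x0E : c x0 = mxcol A (iY (inl (inl y0))) by [].
have x0S : x0 \in S0 by rewrite inE; apply/imsetP; exists y0.
have S0_gt0 : (0 < #|S0|)%N by apply/card_gt0P; exists x0.
have S0_le : (#|S0| <= #|tY0 Phi|)%N.
  have vinj : injective (fun x : ground N => (out_val (out_val x) : E)).
    by move=> x x' h; apply: val_inj; apply: val_inj.
  rewrite -(card_imset _ vinj); apply: leq_trans (_ : #|Y0img| <= _)%N; last exact: leq_imset_card.
  by apply: subset_leq_card; apply/subsetP=> _ /imsetP[x xS ->]; move: xS; rewrite inE.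
(* A nonspanning complement would make the connectivity of [S0] less than its size, giving a
   separation of order |S0|, which is below [k]. *)
have rk_full : (rk [set: ground N] <= rk (~: S0))%N.
  have nsep : ~ separation #|S0| S0 by apply: kN; rewrite S0_gt0 (leq_ltn_trans S0_le).
  have rS := rk_le_card S0; have cC := cardsC S0.
  rewrite leqNgt; apply/negP=> lt; apply: nsep; split; first by [].
    by apply: leq_trans (_ : k <= _)%N; lia.
  move: rS lt S0_gt0; rewrite /connectivity.
  by move: (rk S0) (rk (~: S0)) (rk [set: ground N]) #|S0| => a b t n; lia.
have : (rk (x0 |: ~: S0) <= rk (~: S0))%N by apply: leq_trans rk_full; apply: rkS; apply: subsetT.
rewrite (rkU1_closure repN) x0E => mem.
have <- : pi (mxcol A (iY (inl (inl y0)))) = colY0 y0 by apply: piY.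
case/memv_addP: mem => u uS [v vK ->]; rewrite linearD /=; apply: rpredD; last exact: piK.
suff /subvP/(_ _ (memv_img pi uS)) : (pi @: fspan c (~: S0) <= G)%VS by [].
by rewrite limg_fspan; apply: fspan_sub => x; rewrite in_setC => /piS.
Qed.

(** * Cotemplates and the main equivalence *)

(** Every template has a conforming matroid with an M(K6) minor: on five zero rows of Delta, the
    frame columns with zero part in [X] include all vectors of weight 1 and 2, which are the edges
    of K6 with the row of one vertex omitted. *)
Lemma coconforms_dual_K6 (Psi : template) : exists2 M, coconforms Psi M &
  has_minor M (dual (cycle_matroid (complete_graph 6))).
Proof.
pose delta (i : 'I_5) : {ffun tcol Psi -> 'F_2} := 0.
have deltaP i : delta i \in tDelta Psi by apply: Delta0.
pose N := univ_matroid delta; exists (dual N).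
  have [B [E [iX [iY [A [injX injY confA iso]]]]]] := univ_matroid_conforms deltaP.
  exists B, E, iX, iY, A; split=> //.
  exact: isom_trans (dual_dual_isom N) iso.
apply: has_minor_dual.
pose dK := edgev (fun e : edge (complete_graph 6) => (ends e).1) (fun e => (ends e).2).
pose u (i : 'I_6) : {ffun 'I_5 -> ('F_2)^o} :=
  if unlift ord0 i is Some j then unitv j else 0.
have [Om [OmE Omu]] := lincomb (fun i => vecXI 0 (u i) : {ffun rowT Psi 'I_5 -> ('F_2)^o}).
have wu i : (weight (u i) <= 1)%N.
  by rewrite /u; case: (unlift _ _) => [j|]; rewrite ?weight_unitv ?weight0.
have elt e : exists x : ground N, univ_vec x = Om (dK e).
  apply: univ_vec_avail; rewrite linearD /= !Omu vecXID addr0.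
  constructor 1; exists 0, (u (ends e).1 + u (ends e).2); split=> //; first exact: Lambda0.
  apply: leq_trans (weightD _ _) _.
  by have := wu (ends e).1; have := wu (ends e).2; lia.
have [h hE] := fin_all_exists elt.
set K := fspan (fun c : tC Psi => colY delta (inr c)) setT.
have K0 v i : v \in K -> v (inr i) = 0.
  case/memv_fspan=> s _ ->; rewrite sum_ffunE big1 // => c _.
  by rewrite !ffunE.
have [par parE] := label_hom (J := 'I_6) xpredT.
have dH e : dK e \in lker par by rewrite memv_ker linearD /= !parE F2_addrr.
have kerOm v : v \in lker par -> Om v \in K -> v = 0.
  move=> vH vK; have vl j : v (lift ord0 j) = 0.
    rewrite -(K0 _ j vK) OmE sum_ffunE big_ord_recl /= [X in X + _](_ : _ = 0); last first.
      by rewrite !ffunE /u unlift_none ffunE scaler0.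
    rewrite add0r (bigD1 j) //= big1 => [|i ij].
      by rewrite addr0 !ffunE /u liftK ffunE eqxx /GRing.scale /= mulr1.
    by rewrite !ffunE /u liftK ffunE eq_sym (negPf ij) scaler0.
  have v0 : v ord0 = 0.
    move: vH; rewrite memv_ker (hom_ffunE par) big_ord_recl big1 => [|j _].
      by rewrite addr0 parE /GRing.scale /= mulr1 => /eqP.
    by rewrite vl scale0r.
  by apply/ffunP=> i; rewrite [RHS]ffunE; case: (unliftP ord0 i) => [j ->|->].
apply/has_minorP; exists set0, h; split.
- move=> e e' hee; apply: dK_inj; apply/eqP; rewrite -subr_eq0 oppv_id; apply/eqP.
  apply: kerOm; first by rewrite rpredD.
  by rewrite linearD /= -!hE hee F2_addvv mem0v.
- by move=> x; rewrite inE.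
move=> S; transitivity (qrk dK 0 S); first by rewrite /qrk addv0 dimv0 subn0 -K6_rkE.
rewrite (minor_represents _ _ _ (@univ_vec_represents Psi _ delta)) fspan0 add0v.
apply: esym; apply: (qrk_transfer (f := Om) (H := lker par)) => //.
- by move=> e; rewrite /= hE F2_addvv mem0v.
- by move=> v; rewrite memv0 => /eqP->; rewrite linear0 mem0v.
- exact: sub0v.
- by move=> v vH vK; rewrite memv0; apply/eqP/kerOm.
Qed.

Theorem theorem1p2 (L : {set ground (PG 3)}) (hL : PG_line L) :
  template_hypothesis ->
  exists k : nat, (0 < k)%N /\
    forall M : matroid, binary M -> k_connected k M -> (2 * k <= #|ground M|)%N ->
      (~ (has_minor M (delete L) \/
          has_minor M (dual (cycle_matroid (complete_graph 6))))
       <-> even_cycle_with_blocking_pair M).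
Proof.
move=> TH; pose K6 := dual (cycle_matroid (complete_graph 6)).
pose P M := binary M /\ ~ (has_minor M (delete L) \/ has_minor M K6).
have [||k [s [t [Phi [Psi [k_gt0 hPhi hPsi hM]]]]]] := TH P.
- split=> [M []//|]; exists (PG 3); split.
    by eexists _, _, _; exists id; split; [exists id | move=> S; rewrite imset_id].
  by case=> _; apply; left; apply: delete_has_minor.
- move=> M N [bM noM] MN; split; first exact: binary_minor bM MN.
  by case=> mN; apply: noM; [left|right]; apply: has_minor_trans MN mN.
(* One constant has to serve all the templates at once, so the largest [Y0] is taken. *)
pose kY := \max_(i < s) #|tY0 (Phi i)|.
exists (maxn k kY.+1); split; first by rewrite leq_max k_gt0.
move=> M bM kM cM; split=> [noM|BP]; last first.
  have tM := blocking_pair_terminal_quotient BP; case=> mM.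
    exact: (PG3_line_not_terminal_quotient hL (terminal_quotient_minor tM mM)).
  exact: (dual_K6_not_terminal_quotient (terminal_quotient_minor tM mM)).
have kk : (k <= maxn k kY.+1)%N by rewrite leq_maxl.
have [|||[i cM']|[j _]] := hM M; first by split.
- by move=> l S /andP[l0 lk]; apply: kM; rewrite l0 (leq_trans lk).
- by apply: leq_trans cM; rewrite leq_mul2l kk orbT.
- apply: terminal_quotient_blocking_pair.
  apply: (conforms_terminal_quotient hL _ cM' kM _ cM) => [M' /hPhi[_ noM'] mM'|].
    by apply: noM'; left.
  by rewrite leq_max ltnS (leq_bigmax i) orbT.
have [M' cM' mM'] := coconforms_dual_K6 (Psi j).
by have [_ []] := hPsi _ _ cM'; right.
Qed.
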